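(* Let $1/2\le\alpha<1$, let $\beta\ge 1+2\alpha$, and let $c\ge 0$. Let $Y_1,Y_2$ be square-integrable real random variables. Let $T\sim\operatorname{Beta}(\alpha,\beta)$ and let $\varepsilon$ be a Rademacher sign, with $T$ and $\varepsilon$ independent of each other and $(T,\varepsilon)$ independent of $(Y_1,Y_2)$. If $$Y_1^2\preceq_{\mathrm{cx}}Y_2^2,$$ then $$\left((1-T)^\alpha Y_1+cT^\alpha\varepsilon\right)^2\preceq_{\mathrm{cx}}\left((1-T)^\alpha Y_2+cT^\alpha\varepsilon\right)^2 .$$
   Context: A Rademacher sign takes the values $+1$ and $-1$ with probability $1/2$ each. $\operatorname{Beta}(\alpha,\beta)$ is the law on $(0,1)$ with density proportional to $t^{\alpha-1}(1-t)^{\beta-1}$. Convex order: for integrable real random variables $U,V$, $U\preceq_{\mathrm{cx}}V$ means $\mathbb{E}\Phi(U)\le\mathbb{E}\Phi(V)$ for every convex function $\Phi$ for which the expectations exist. *)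

(* Defs.v *)
From HB Require Import structures.
From mathcomp Require Import all_boot all_order all_algebra.
From mathcomp Require Import all_classical all_reals all_analysis.
Set Implicit Arguments.
Unset Strict Implicit.
Unset Printing Implicit Defensive.
Import Order.TTheory GRing.Theory Num.Theory.
Import numFieldNormedType.Exports.

Local Open Scope classical_set_scope.
Local Open Scope ring_scope.

Section definitions.
Context {d : measure_display} {Om : measurableType d} {R : realType}.
Variable P : probability Om R.

(* Existence in the extended sense: at most one of the two parts is infinite,
   so that 'E_P[X] is unambiguous in [-oo, +oo]. *)
Definition expectation_exists (X : Om -> R) : Prop :=
  ('E_P[X^\+] < +oo \/ 'E_P[X^\-] < +oo)%E.

Definition cx_le (U V : Om -> R) : Prop :=
  [/\ U \in Lfun P 1, V \in Lfun P 1 &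
      forall Phi : R -> R, convex_function setT (Phi : R^o -> R^o) ->
        expectation_exists (Phi \o U) -> expectation_exists (Phi \o V) ->
        ('E_P[Phi \o U] <= 'E_P[Phi \o V])%E].

Definition independent_RV {d1 d2 : measure_display}
    {E1 : measurableType d1} {E2 : measurableType d2}
    (X : Om -> E1) (Y : Om -> E2) : Prop :=
  forall (A : set E1) (B : set E2), measurable A -> measurable B ->
    P (X @^-1` A `&` Y @^-1` B) = (P (X @^-1` A) * P (Y @^-1` B))%E.

Definition rademacher (e : Om -> R) : Prop :=
  P (e @^-1` [set 1]) = (2^-1)%:E /\ P (e @^-1` [set -1]) = (2^-1)%:E.

End definitions.

(* The library's beta_pdf and beta_prob only cover natural parameters. *)
Section beta_law.
Context {R : realType}.
Implicit Types a b t : R.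

Definition beta_weight a b t : R := t `^ (a - 1) * (1 - t) `^ (b - 1).

Definition real_beta_fun a b : R :=
  \int[@lebesgue_measure R]_(t in `]0, 1[) beta_weight a b t.

Definition real_beta_pdf a b t : R :=
  (beta_weight a b \_ `]0, 1[) t / real_beta_fun a b.

Definition has_beta_law {d : measure_display} {Om : measurableType d}
    (P : probability Om R) (X : {RV P >-> R}) a b : Prop :=
  forall A : set R, measurable A ->
    (distribution P X A =
      \int[@lebesgue_measure R]_(t in A) (real_beta_pdf a b t)%:E)%E.

End beta_law.

(* Main.v *)
Require Import Defs.
From HB Require Import structures.
From mathcomp Require Import all_boot all_order all_algebra.
From mathcomp Require Import all_classical all_reals all_analysis.
From mathcomp Require Import measurable_realfun ring lra.
Import Order.TTheory GRing.Theory Num.Theory.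
Import numFieldNormedType.Exports.

Local Open Scope classical_set_scope.
Local Open Scope ring_scope.

Set Implicit Arguments.
Unset Strict Implicit.
Unset Printing Implicit Defensive.

(** Put p = 1/alpha, q = p - 1 and g = beta - 1; then 0 < q <= 1 and g >= 1.

    Nonnegative variables with equal means are in convex order as soon as their
    means of every hinge x |-> (x - k)_+ with k > 0 are ordered ([cx_le_hinges]),
    because on [0, +oo[ a convex function is a limit from below of sums of its
    tangent at 0 and nonnegative combinations of hinges.  As (T, eps) is independent of
    Y, the mean of the hinge with k = r^2 of the perturbed square is E Psi(Y^2),
    where Psi(u) = E (((1-T)^alpha sqrt u + c T^alpha eps)^2 - r^2)_+
    ([hinge_transfer]).  So it is enough to know that Psi is convex on the whole
    line: the hypothesis on Y1^2 and Y2^2 is then applied to Psi itself.  For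
    r = 0 the function Psi is affine on [0, +oo[, which gives the equality of
    the means.

    Convexity of Psi.  The variable b = - eps T^alpha has a density proportional
    to omega(b)^g with omega(b) = 1 - |b|^p, and (1-T)^alpha is the height
    a(b) = omega(b)^(1/p) of the unit curve of the l^p norm above b.  After
    scaling c to 1, and with s = sqrt u, Psi(u) is a multiple of
        int_{-1}^{1} omega(b)^g ((a(b) s - b)^2 - r^2)_+ db   ([avg_hinge]).
    Let S be the set where the integrand is positive, h = omega^g a (an even
    function) and B(b) = r s a(b) / (1 - s a'(b)).  Two differentiations in u show
    that Psi'' has the sign of
        sum over the ends b_i of S of h(b_i) |B(b_i)|  +  int_S h(b) b db.
    If r < 1, then S is [-1, b1] together with [b2, 1], where |b1| < b2, and the
    integral is minus the integral of h(b) b over [|b1|, b2].  Now h is a convex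
    function of b^2, so the trapezoid rule bounds that integral by the mean of
    h(b1), h(b2) times (b2^2 - b1^2)/2 ([moment_trapezoid]); this last number is
    at most B(b1) + B(b2) ([boundary_term_trapezoid], an inequality between two
    points of the l^p curve and their dual vectors that rests on [dual_gap]);
    and both h and B are larger at b1 than at b2, so Chebyshev's sum inequality
    concludes ([avg_hinge_touches_small]).  If r >= 1, then S is empty or an
    interval whose right end alone provides enough ([boundary_term_large],
    [avg_hinge_touches_large]).

    The shape of S changes with u, so Psi is never differentiated.  Convexity is
    tested instead by functions touching the graph from below
    ([touches_below_convex]): near u, the integral without positive part over a
    set of fixed shape, whose ends move at constant speed, is a smooth lower
    bound of Psi, exact at u; with the speeds of the true ends its second
    derivative at u is the one above ([touch_of_boundary]). *)

(** * Inequalities between powers *)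

Section powers.
Context {R : realType}.
Implicit Types x y e k l m p q t : R.

(** Bernoulli's inequality is Young's inequality for x and 1 with the conjugate
    exponents e and e / (e - 1). *)
Lemma bernoulli_powR x e : 0 < x -> 1 <= e -> 1 + e * (x - 1) <= x `^ e.
Proof.
move=> x0; rewrite le_eqVlt => /predU1P[<-|e1].
  by rewrite powRr1 ?(ltW x0)//; lra.
have e0 : 0 < e by lra.
have e1n : e - 1 != 0 by apply/eqP; lra.
have en : e != 0 by apply/eqP; lra.
have e'0 : 0 < e / (e - 1) by rewrite divr_gt0; lra.
have := @conjugate_powR _ x 1 e (e / (e - 1)) (ltW x0) ler01 e0 e'0.
rewrite powR1 mulr1.
have -> : e^-1 + (e / (e - 1))^-1 = 1 by field; rewrite en e1n.
move=> /(_ erefl).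
have -> : 1 / (e / (e - 1)) = 1 - e^-1 by field; rewrite en e1n.
move=> H.
have : e * x <= e * (x `^ e / e + (1 - e^-1)) by rewrite ler_wpM2l // ltW.
have -> : e * (x `^ e / e + (1 - e^-1)) = x `^ e + e - 1 by field; rewrite en.
lra.
Qed.

(** The convex function z^e takes the value 1 at the point 1 of [x, y], where its
    chord is not lower: compare both ends with the tangent at 1. *)
Lemma powR_chord1 x y e : 0 < x -> x <= 1 -> 1 <= y -> 1 <= e ->
  y - x <= (1 - x) * y `^ e + (y - 1) * x `^ e.
Proof.
move=> x0 x1 y1 e1.
have Hx := bernoulli_powR x0 e1.
have Hy : 1 + e * (y - 1) <= y `^ e by apply: bernoulli_powR => //; lra.
have : (1 - x) * (1 + e * (y - 1)) <= (1 - x) * y `^ e by rewrite ler_wpM2l; lra.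
have : (y - 1) * (1 + e * (x - 1)) <= (y - 1) * x `^ e by rewrite ler_wpM2l; lra.
move=> ? ?.
have : (1 - x) * (1 + e * (y - 1)) + (y - 1) * (1 + e * (x - 1)) = y - x by ring.
lra.
Qed.

Definition dsinh k t : R := expR (k * t) - expR (- (k * t)).

#[local] Instance is_derive_dsinh k t : is_derive t 1 (dsinh k) (k * (expR (k * t) + expR (- (k * t)))).
Proof.
rewrite /dsinh; apply: is_derive_eq.
rewrite /GRing.scale /=; ring.
Qed.

(** The function k |-> sinh(k t)/k is nondecreasing: the difference of the two
    sides vanishes at t = 0 and has the derivative 2 k p (cosh(p t) - cosh(k t)). *)
Lemma sinh_slope_le k p t : 0 <= k -> k <= p -> 0 <= t ->
  p * (expR (k * t) - expR (- (k * t))) <= k * (expR (p * t) - expR (- (p * t))).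
Proof.
move=> k0 kp t0.
pose f u := k * dsinh p u - p * dsinh k u.
have df (u : R) : is_derive u 1 f
    (k * (p * (expR (p * u) + expR (- (p * u)))) - p * (k * (expR (k * u) + expR (- (k * u))))).
  rewrite /f; apply: is_derive_eq. by rewrite /GRing.scale /=; ring.
suff : f 0 <= f t by rewrite /f /dsinh !mulr0 oppr0 expR0 subrr !mulr0 subr0; lra.
move: t0; rewrite le_eqVlt => /predU1P[<-//|t0].
have cf : {within `[0, t], continuous f}.
  by apply: derivable_within_continuous => x _; apply: ex_derive.
have [c] := @MVT _ f (fun u => k * (p * (expR (p * u) + expR (- (p * u)))) -
   p * (k * (expR (k * u) + expR (- (k * u))))) _ _ t0 (fun x _ => df x) cf.
rewrite in_itv /= => /andP[c0 ct] E.
rewrite -subr_ge0 E subr0; apply: mulr_ge0; last exact: ltW.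
have -> : forall A B : R, k * (p * A) - p * (k * B) = (k * p) * (A - B) by move=> *; ring.
apply: mulr_ge0; first by rewrite mulr_ge0 // (le_trans k0).
have e1 : 1 <= expR (k * c) by rewrite -expR0 ler_expR mulr_ge0 // ltW.
have e2 : expR (k * c) <= expR (p * c) by rewrite ler_expR ler_wpM2r // ltW.
rewrite !expRN.
set X := expR (k * c) in e1 e2 *; set Y := expR (p * c) in e2 *.
have X0 : X != 0 by apply/eqP; lra.
have Y0 : Y != 0 by apply/eqP; lra.
have -> : Y + Y^-1 - (X + X^-1) = (Y - X) * (X * Y - 1) / (X * Y) by field; rewrite X0 Y0.
apply: divr_ge0; last by nra.
by apply: mulr_ge0; nra.
Qed.

(** [sinh_slope_le] at t = ln x, multiplied by x^m; this form with a free centre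
    m covers the two comparisons of powers that follow. *)
Lemma powR_sinh_le k p m x : 0 <= k -> k <= p -> 1 <= x ->
  p * (x `^ (m + k) - x `^ (m - k)) <= k * (x `^ (m + p) - x `^ (m - p)).
Proof.
move=> k0 kp x1.
have x0 : 0 < x by lra.
have xE e : x `^ e = expR (e * ln x) by rewrite /powR gt_eqF.
have lx : 0 <= ln x by rewrite ln_ge0.
have := sinh_slope_le k0 kp lx => /(ler_wpM2l (expR_ge0 (m * ln x))).
rewrite !xE !mulrDl !expRD !mulNr; lra.
Qed.

Lemma powR_gt1_lin q x : 0 <= q <= 1 -> 1 <= x ->
  (1 + q) * (x - x `^ q) <= (1 - q) * (x `^ (1 + q) - 1).
Proof.
move=> /andP[q0 q1] x1.
have := @powR_sinh_le ((1 - q) / 2) ((1 + q) / 2) ((1 + q) / 2) x.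
have -> : (1 + q) / 2 + (1 - q) / 2 = 1 by lra.
have -> : (1 + q) / 2 - (1 - q) / 2 = q by lra.
have -> : (1 + q) / 2 + (1 + q) / 2 = 1 + q by lra.
rewrite subrr powRr0 powRr1; last by lra.
move=> H; have := H _ _ x1; move=> /(_ ltac:(lra) ltac:(lra)); lra.
Qed.

Lemma powR_lt1_lin q x : 0 <= q -> 0 < x <= 1 ->
  (2 + q) * (x - x `^ (1 + q)) <= q * (1 - x `^ (2 + q)).
Proof.
move=> q0 /andP[x0 x1].
have x1' : 1 <= x^-1 by rewrite invf_ge1.
have E e : x^-1 `^ (- e) = x `^ e.
  by rewrite -powR_inv1 ?(ltW x0)// -powRrM mulrN mulN1r opprK.
have := @powR_sinh_le (q / 2) ((2 + q) / 2) (- ((2 + q) / 2)) x^-1.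
have -> : - ((2 + q) / 2) + q / 2 = - 1 by lra.
have -> : - ((2 + q) / 2) - q / 2 = - (1 + q) by lra.
have -> : - ((2 + q) / 2) - (2 + q) / 2 = - (2 + q) by lra.
rewrite addNr powRr0 !E powRr1; last by lra.
move=> H; have := H ltac:(lra) ltac:(lra) x1'; lra.
Qed.
End powers.

Section gap.
Context {R : realType}.
Implicit Types (q b s r : R).

Lemma one_powR e : 1 `^ e = 1 :> R.
Proof. by rewrite powR1. Qed.

(** The form of [powRD] whose side condition is positivity of the base. *)
Lemma powRD_gt0 x e f : 0 < x -> x `^ (e + f) = x `^ e * x `^ f :> R.
Proof. by move=> x0; rewrite powRD // (gt_eqF x0) implybT. Qed.

Lemma powR_ratio_le q x y : 0 <= q -> q <= 1 -> 0 <= x -> x <= y :> R ->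
  x * y `^ q <= y * x `^ q.
Proof.
move=> q0 q1; rewrite le_eqVlt => /predU1P[<- y0|x0 xy].
  by rewrite mul0r mulr_ge0 ?powR_ge0.
have y0 : 0 < y by exact: lt_le_trans xy.
have H z : 0 < z -> z = z `^ q * z `^ (1 - q) :> R.
  by move=> z0; rewrite -powRD_gt0 // (addrC q) subrK powRr1 // ltW.
have -> : x * y `^ q = x `^ q * y `^ q * x `^ (1 - q) by rewrite {1}(H x x0); ring.
have -> : y * x `^ q = x `^ q * y `^ q * y `^ (1 - q) by rewrite {1}(H y y0); ring.
rewrite ler_wpM2l ?mulr_ge0 ?powR_ge0 //.
by rewrite ge0_ler_powR ?nnegrE ?subr_ge0 // ltW.
Qed.

(** (a1, b1) and (a2, b2) are points of the unit curve of the l^(1+q) norm, and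
    P1, P2 are the pairings of each with the dual vector of the other, both at
    most 1 by Hoelder; the lemma compares the asymmetry P1 - P2 with the defect
    1 - P1 P2.  In the ratios l = a2/a1 and m = b2/b1 the defect is a product by
    the Cauchy-Binet identity, and all that remains are the inequalities between
    powers of one variable proved above. *)
Lemma dual_gap q (a1 a2 b1 b2 P1 P2 : R) : 0 < q -> q <= 1 ->
  0 < a2 -> a2 < a1 -> 0 < b1 -> b1 < b2 ->
  a1 `^ (1 + q) + b1 `^ (1 + q) = 1 -> a2 `^ (1 + q) + b2 `^ (1 + q) = 1 ->
  P1 = a2 * a1 `^ q + b2 * b1 `^ q -> P2 = a1 * a2 `^ q + b1 * b2 `^ q ->
  (P1 - P2) * (a1 + a2) <= (a1 - a2) * (1 - P1 * P2).
Proof.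
move=> q0 q1 a20 a21 b10 b12 E1 E2 P1D P2D.
have a10 : 0 < a1 by lra.
have b20 : 0 < b2 by lra.
(* In these coordinates A + B = 1 and A (l L) + B (m M) = 1. *)
pose l := a2 / a1; pose m := b2 / b1; pose L := l `^ q; pose M := m `^ q.
pose A := a1 `^ (1 + q); pose B := b1 `^ (1 + q).
have l0 : 0 < l by rewrite divr_gt0.
have l1 : l < 1 by rewrite ltr_pdivrMr // mul1r.
have m1 : 1 < m by rewrite ltr_pdivlMr // mul1r.
have m0 : 0 < m by lra.
have a2E : a2 = a1 * l by rewrite /l; field; rewrite gt_eqF.
have b2E : b2 = b1 * m by rewrite /m; field; rewrite gt_eqF.
have S z : 0 < z -> z `^ (1 + q) = z * z `^ q :> R.
  by move=> z0; rewrite powRD_gt0 // powRr1 // ltW.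
have AE : A = a1 * a1 `^ q by rewrite /A S.
have BE : B = b1 * b1 `^ q by rewrite /B S.
have a2q : a2 `^ q = a1 `^ q * L by rewrite a2E powRM // ltW.
have b2q : b2 `^ q = b1 `^ q * M by rewrite b2E powRM // ltW.
have A0 : 0 < A by rewrite powR_gt0.
have B0 : 0 < B by rewrite powR_gt0.
have L0 : 0 < L by rewrite powR_gt0.
have L1 : L < 1 by rewrite /L -[ltRHS](one_powR q) gt0_ltr_powR // nnegrE ltW.
have M1 : 1 < M by rewrite /M -[ltLHS](one_powR q) gt0_ltr_powR // nnegrE ltW.
have AB : A + B = 1 by [].
have ABl : A * (l * L) + B * (m * M) = 1.
  by move: E2; rewrite !S // a2q b2q {1}a2E {1}b2E => <-; rewrite AE BE; ring.
have P1E : P1 = A * l + B * m by rewrite P1D {1}a2E {1}b2E AE BE; ring.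
have P2E : P2 = A * L + B * M by rewrite P2D a2q b2q AE BE; ring.
have I1 : (1 + q) * (m - M) <= (1 - q) * (m * M - 1).
  by have := @powR_gt1_lin _ q m; rewrite S //; apply; lra.
have I3 : (2 + q) * (l - l * L) <= q * (1 - l * l * L).
  have := @powR_lt1_lin _ q l.
  have -> : l `^ (2 + q) = l * l * L.
    have -> : 2 + q = 1 + (1 + q) by lra.
    by rewrite powRD_gt0 // powRr1 ?(ltW l0)// S // mulrA.
  by rewrite S //; apply; lra.
have I21 : m - l <= (1 - l) * (m * M) + (m - 1) * (l * L).
  by rewrite -!S //; apply: powR_chord1; lra.
have I22 : M - L <= (1 - L) * (m * M) + (M - 1) * (l * L).
  have -> : m * M = M `^ ((1 + q) / q).
    by rewrite -S // /M -powRrM; congr (_ `^ _); field; rewrite gt_eqF.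
  have -> : l * L = L `^ ((1 + q) / q).
    by rewrite -S // /L -powRrM; congr (_ `^ _); field; rewrite gt_eqF.
  by apply: powR_chord1 => //; [lra|lra|rewrite ler_pdivlMr //; lra].
(* I21 and I22 are chord inequalities for the exponents 1+q and (1+q)/q at the
   same two points; their combination bounds the mixed defect. *)
have J1 : (1 - l) * (1 - L) <= B * ((m - l) * (M - L)).
  have N0 : 0 < m * M - l * L by rewrite subr_gt0 ltr_pM // ?ltW //; lra.
  rewrite -(ler_pM2r N0).
  have -> : B * ((m - l) * (M - L)) * (m * M - l * L)
            = (1 - l * L) * ((m - l) * (M - L)).
    have : B * (m * M - l * L) = 1 - l * L.
      have -> : B * (m * M - l * L) = (A * (l * L) + B * (m * M)) - (A + B) * (l * L) by ring.
      by rewrite ABl AB mul1r.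
    by move=> <-; ring.
  have K1 := ler_wpM2l (ltW L0) I21.
  have K2 := ler_wpM2l (ltW l0) I22.
  lra.
have J2 : (P1 - P2) * (1 + l) <= A * ((1 - l) * ((1 - l) * (1 - L))).
  have K : (1 + q) * (P1 - P2) <= A * ((1 - q) * (1 - l * L) - (1 + q) * (L - l)).
    have : B * ((1 + q) * (m - M)) <= B * ((1 - q) * (m * M - 1)) by rewrite ler_wpM2l // ltW.
    have -> : B * ((1 - q) * (m * M - 1)) = (1 - q) * (A * (1 - l * L)).
      have -> : B * ((1 - q) * (m * M - 1)) = (1 - q) * (B * (m * M) - B) by ring.
      congr (_ * _).
      have -> : B * (m * M) = 1 - A * (l * L) by lra.
      lra.
    rewrite P1E P2E; lra.
  have K' : (1 + l) * ((1 - q) * (1 - l * L) - (1 + q) * (L - l))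
      <= (1 + q) * ((1 - l) * ((1 - l) * (1 - L))) by lra.
  have q10 : 0 < 1 + q by lra.
  rewrite -(ler_pM2l q10).
  have : (1 + q) * (P1 - P2) * (1 + l) <= A * ((1 - q) * (1 - l * L) - (1 + q) * (L - l)) * (1 + l).
    by apply: ler_wpM2r => //; lra.
  have := ler_wpM2l (ltW A0) K'.
  lra.
have PP : 1 - P1 * P2 = A * (B * ((m - l) * (M - L))).
  have -> : 1 - P1 * P2 = (A + B) * (A * (l * L) + B * (m * M)) - P1 * P2 by rewrite AB ABl mul1r.
  by rewrite P1E P2E; ring.
have -> : (P1 - P2) * (a1 + a2) = a1 * ((P1 - P2) * (1 + l)) by rewrite a2E; ring.
have -> : (a1 - a2) * (1 - P1 * P2) = a1 * ((1 - l) * (1 - P1 * P2)) by rewrite a2E; ring.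
rewrite ler_wpM2l ?(ltW a10)//; apply: (le_trans J2); rewrite PP.
rewrite mulrCA; apply: ler_wpM2l; first lra.
by apply: ler_wpM2l => //; exact: ltW.
Qed.

(** With W = a1 b2 - a2 b1, the constraints solve to W al1 = b2 - P1 b1 and
    W al2 = P2 b2 - b1.  The difference of the two sides then factors, the
    nontrivial factor being the difference of the two sides of the gap
    inequality. *)
Lemma trapezoid_of_dual_gap (a1 a2 b1 b2 al1 al2 be1 be2 P1 P2 : R) :
  a1 * al1 + b1 * be1 = 1 -> a2 * al2 + b2 * be2 = 1 ->
  P1 = a2 * al1 + b2 * be1 -> P2 = a1 * al2 + b1 * be2 ->
  0 < 1 + P1 -> 0 < 1 + P2 -> 0 < b1 + b2 ->
  (P1 - P2) * (a1 + a2) <= (a1 - a2) * (1 - P1 * P2) ->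
  (a1 + a2) * (b2 - b1) / 2 <=
    (a1 * b2 - a2 * b1) * (a1 * al1 / (1 + P1) + a2 * al2 / (1 + P2)).
Proof.
move=> E1 E2 P1E P2E Q1 Q2 b0 H.
set W := a1 * b2 - a2 * b1.
have W1 : W * al1 = b2 - P1 * b1.
  have : W * al1 - b2 + P1 * b1 = b2 * (a1 * al1 + b1 * be1 - 1) by rewrite P1E /W; ring.
  by rewrite E1 subrr mulr0; lra.
have W2 : W * al2 = P2 * b2 - b1.
  have : W * al2 + b1 - P2 * b2 = b1 * (1 - (a2 * al2 + b2 * be2)) by rewrite P2E /W; ring.
  by rewrite E2 subrr mulr0; lra.
have -> : W * (a1 * al1 / (1 + P1) + a2 * al2 / (1 + P2)) =
   a1 * (W * al1) / (1 + P1) + a2 * (W * al2) / (1 + P2) by ring.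
rewrite W1 W2 -subr_ge0.
have -> : a1 * (b2 - P1 * b1) / (1 + P1) + a2 * (P2 * b2 - b1) / (1 + P2) -
  (a1 + a2) * (b2 - b1) / 2 =
  (b1 + b2) * ((a1 - a2) * (1 - P1 * P2) - (P1 - P2) * (a1 + a2)) / (2 * (1 + P1) * (1 + P2)).
  by field; rewrite !gt_eqF.
apply: divr_ge0; last by rewrite !mulr_ge0 // ltW.
by rewrite mulr_ge0 ?(ltW b0)// subr_ge0.
Qed.

End gap.

(** * The unit curve |x|^p + |b|^p = 1 and the boundary inequalities *)

Section curve.
#[local] Opaque powR expR.
Context {R : realType}.
Implicit Types (q b s r : R).

Lemma inv_le (x y : R) : 0 < x -> x <= y -> y^-1 <= x^-1.
Proof. by move=> x0 xy; rewrite lef_pV2 ?posrE // (lt_le_trans x0). Qed.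

(** Cut at 0 so that the weights built on it are continuous on the whole line and
    vanish outside ]-1, 1[. *)
Definition omega q b := Num.max 0 (1 - `|b| `^ (1 + q)).
(** The point (height q b, b) lies on the curve x^(1+q) + |b|^(1+q) = 1. *)
Definition height q b := omega q b `^ (1 + q)^-1.
(** The derivative of |b|^(1+q) is (1+q) spow q b. *)
Definition spow q b := Num.sg b * `|b| `^ q.

(** Minus the derivative of [height q]. *)
Definition slope q b := spow q b / height q b `^ q.
(** Let b be a solution of height q b * s - b = r.  When u = s^2 varies, b moves
    with the speed v = height q b / (2 s (1 + s * slope q b)); this is 2 r s^2 v. *)
Definition boundary_term q s r b := r * s * height q b / (1 + s * slope q b).

Context {q : R} (q0 : 0 < q) (q1 : q <= 1).
Let p0 : 0 < 1 + q. Proof. by rewrite addr_gt0. Qed.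

Lemma omega_ge0 b : 0 <= omega q b. Proof. by rewrite le_max lexx. Qed.
Lemma height_ge0 b : 0 <= height q b. Proof. exact: powR_ge0. Qed.

Lemma omegaE b : `|b| <= 1 -> omega q b = 1 - `|b| `^ (1 + q).
Proof.
move=> b1; rewrite /omega; apply: max_r; rewrite subr_ge0 -[leRHS](one_powR (1 + q)).
by rewrite ge0_ler_powR ?nnegrE ?(ltW p0) ?ler01.
Qed.

Lemma omega_gt0 b : `|b| < 1 -> 0 < omega q b.
Proof.
move=> b1; rewrite omegaE ?ltW // subr_gt0 -[ltRHS](one_powR (1 + q)).
by rewrite gt0_ltr_powR ?nnegrE ?p0 ?ler01.
Qed.

Lemma height_gt0 b : `|b| < 1 -> 0 < height q b.
Proof. by move=> b1; rewrite powR_gt0 // omega_gt0. Qed.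

Lemma omega0 b : 1 <= `|b| -> omega q b = 0.
Proof.
move=> b1; rewrite /omega; apply: max_l; rewrite subr_le0 -[leLHS](one_powR (1 + q)).
by rewrite ge0_ler_powR ?nnegrE ?(ltW p0) ?ler01.
Qed.

Lemma height0 b : 1 <= `|b| -> height q b = 0.
Proof. by move=> b1; rewrite /height omega0 // powR0 // invr_neq0 // gt_eqF. Qed.

Lemma heightX b : height q b `^ (1 + q) = omega q b.
Proof. by rewrite /height -powRrM mulVf ?gt_eqF // powRr1 // omega_ge0. Qed.

Lemma height_mul b : height q b * height q b `^ q = omega q b.
Proof.
have [b1|b1] := ltP `|b| 1; last by rewrite height0 // mul0r omega0.
by rewrite -heightX powRD_gt0 ?height_gt0 // powRr1 // height_ge0.
Qed.

Lemma spow_mul b : b * spow q b = `|b| `^ (1 + q).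
Proof.
rewrite /spow mulrA [b * _]mulrC -normrEsg.
have [->|b0] := eqVneq b 0; first by rewrite normr0 mul0r powR0 // gt_eqF.
by rewrite powRD_gt0 ?normr_gt0 // powRr1.
Qed.

Lemma omegaN b : omega q (- b) = omega q b. Proof. by rewrite /omega normrN. Qed.
Lemma heightN b : height q (- b) = height q b. Proof. by rewrite /height omegaN. Qed.

Lemma omega_norm b : omega q `|b| = omega q b. Proof. by rewrite /omega normr_id. Qed.

Lemma ge0_spow b : 0 <= b -> spow q b = b `^ q.
Proof.
rewrite le_eqVlt => /predU1P[<-|b0]; last by rewrite /spow gtr0_sg // gtr0_norm // mul1r.
by rewrite /spow sgr0 mul0r powR0 // gt_eqF.
Qed.

Lemma spowN b : spow q (- b) = - spow q b.
Proof. by rewrite /spow sgrN normrN mulNr. Qed.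

Lemma norm_spow b : `|spow q b| = `|b| `^ q.
Proof.
have [b0|b0] := leP 0 b.
  by rewrite ge0_spow // (ger0_norm b0) ger0_norm // powR_ge0.
rewrite -[b]opprK spowN ge0_spow ?oppr_ge0 ?(ltW b0) // !normrN.
by rewrite ger0_norm ?powR_ge0 // ltr0_norm.
Qed.

Lemma spow_le b1 b2 : b1 <= b2 -> spow q b1 <= spow q b2.
Proof.
have pos (x y : R) : 0 <= x -> x <= y -> spow q x <= spow q y.
  move=> x0 xy; rewrite !ge0_spow //; last exact: le_trans xy.
  by rewrite ge0_ler_powR ?nnegrE ?(ltW q0) // (le_trans x0).
have [b10|b10] := leP 0 b1; first exact: pos.
have [b20 _|b20 b12] := leP 0 b2.
  apply: (@le_trans _ _ 0); last by rewrite ge0_spow // powR_ge0.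
  by rewrite -[b1]opprK spowN ge0_spow ?oppr_le0 ?powR_ge0 // oppr_ge0 ltW.
rewrite -[b1]opprK -[b2]opprK !(spowN (- _)) lerN2; apply: pos.
  by rewrite oppr_ge0 ltW.
by rewrite lerN2.
Qed.

Lemma omega_le b1 b2 : `|b1| <= `|b2| -> omega q b2 <= omega q b1.
Proof.
move=> b12.
have [b21|b21] := leP `|b2| 1; last by rewrite (omega0 (ltW b21)) omega_ge0.
rewrite !omegaE //; last exact: le_trans b21.
by rewrite lerB // ge0_ler_powR ?nnegrE ?(ltW p0).
Qed.

Lemma height_le b1 b2 : `|b1| <= `|b2| -> height q b2 <= height q b1.
Proof.
move=> b12; rewrite /height; apply: ge0_ler_powR; rewrite ?nnegrE ?omega_ge0 ?invr_ge0 ?(ltW p0) //.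
exact: omega_le.
Qed.

Lemma height_lt b1 b2 : `|b1| < `|b2| -> `|b2| <= 1 -> height q b2 < height q b1.
Proof.
move=> b12 b21; rewrite /height; apply: gt0_ltr_powR; rewrite ?nnegrE ?omega_ge0 ?invr_gt0 //.
rewrite !omegaE //; last by rewrite (le_trans _ b21)// ltW.
by rewrite ltrD2l ltrN2 gt0_ltr_powR ?nnegrE.
Qed.

(** This is the concavity of the curve. *)
Lemma slope_le b1 b2 : `|b1| < 1 -> `|b2| < 1 -> b1 <= b2 -> slope q b1 <= slope q b2.
Proof.
move=> h1 h2 b12.
have c1 := height_gt0 h1; have c2 := height_gt0 h2.
have d1 : 0 < height q b1 `^ q by rewrite powR_gt0.
have d2 : 0 < height q b2 `^ q by rewrite powR_gt0.
have pos (x y : R) : `|x| < 1 -> `|y| < 1 -> 0 <= x -> x <= y -> slope q x <= slope q y.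
  move=> h1' h2' x0 xy; have y0 := le_trans x0 xy; rewrite /slope; apply: ler_pM.
  - by rewrite ge0_spow // powR_ge0.
  - by rewrite invr_ge0 powR_ge0.
  - exact: spow_le.
  - have cx := height_gt0 h1'; have c_y := height_gt0 h2'.
    have cyx : height q y <= height q x by apply: height_le; rewrite !ger0_norm.
    apply: inv_le; first exact: powR_gt0.
    apply: (ge0_ler_powR (ltW q0)).
    + by rewrite nnegrE (ltW c_y).
    + by rewrite nnegrE (ltW cx).
    + exact: cyx.
have [b10|b10] := leP 0 b1; first exact: pos.
have cyN b : slope q (- b) = - slope q b by rewrite /slope spowN heightN mulNr.
have [b20|b20] := leP 0 b2.
  apply: (@le_trans _ _ 0); last by rewrite /slope ge0_spow // divr_ge0 ?powR_ge0.
  rewrite -[b1]opprK cyN oppr_le0 /slope ge0_spow; last by rewrite oppr_ge0 ltW.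
  by rewrite divr_ge0 ?powR_ge0.
rewrite -[b1]opprK -[b2]opprK !(cyN (- _)) lerN2; apply: pos.
- by rewrite normrN.
- by rewrite normrN.
- by rewrite oppr_ge0 ltW.
- by rewrite lerN2.
Qed.

(** The dual vector of a point of the curve pairs to 1 with that point. *)
Lemma curve_id b : `|b| <= 1 -> height q b * height q b `^ q + b * spow q b = 1.
Proof. by move=> b1; rewrite height_mul spow_mul omegaE // subrK. Qed.

(** Solving the two equations for s and r in terms of the two points turns the
    claim into [trapezoid_of_dual_gap].  Its gap hypothesis is [dual_gap] when
    b1 > 0; when b1 <= 0 it is trivial, because then P1 <= P2 while 1 - P1 P2 is
    a product of two nonnegative factors. *)
Lemma boundary_term_trapezoid s r b1 b2 : 0 < s -> 0 <= r ->
  - 1 < b1 -> b2 < 1 -> `|b1| < b2 ->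
  height q b1 * s - b1 = r -> b2 - height q b2 * s = r ->
  [/\ 0 < 1 + s * slope q b1, 0 < 1 + s * slope q b2 &
      (b2 ^+ 2 - b1 ^+ 2) / 2 <= boundary_term q s r b1 + boundary_term q s r b2].
Proof.
move=> s0 r0 hb1 hb2 b12 H1 H2.
have b20 : 0 < b2 by apply: le_lt_trans b12; exact: normr_ge0.
have b12' : `|b1| < `|b2| by rewrite (gtr0_norm b20).
have n2 : `|b2| < 1 by rewrite gtr0_norm.
have n1 : `|b1| < 1 by apply: lt_trans n2.
have c1 := height_gt0 n1; have c2 := height_gt0 n2.
have c12 := height_lt b12' (ltW n2).
have E1 := curve_id (ltW n1); have E2 := curve_id (ltW n2).
have al10 : 0 < height q b1 `^ q by exact: powR_gt0.
have al20 : 0 < height q b2 `^ q by exact: powR_gt0.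
have be2E : spow q b2 = b2 `^ q by apply: ge0_spow; exact: ltW.
have be20 : 0 < b2 `^ q by exact: powR_gt0.
rewrite -be2E in be20.
have be1n : `|spow q b1| = `|b1| `^ q by exact: norm_spow.
have be12 : `|spow q b1| < spow q b2.
  rewrite be1n be2E; apply: (gt0_ltr_powR q0); rewrite ?nnegrE //.
  exact: ltW.
have ca1X : height q b1 `^ (1 + q) = 1 - `|b1| `^ (1 + q) by rewrite heightX omegaE // ltW.
have ca2X : height q b2 `^ (1 + q) = 1 - `|b2| `^ (1 + q) by rewrite heightX omegaE // ltW.
rewrite /boundary_term /slope.
move: (height q b1) H1 c1 c12 E1 al10 ca1X => a1 H1 c1 c12 E1 al10 ca1X.
move: (height q b2) H2 c2 c12 E2 al20 ca2X => a2 H2 c2 c12 E2 al20 ca2X.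
have [al1 al1E] : exists x, x = a1 `^ q by exists (a1 `^ q).
have [al2 al2E] : exists x, x = a2 `^ q by exists (a2 `^ q).
have [be1 be1E] : exists x, x = spow q b1 by exists (spow q b1).
have [be2 be2E'] : exists x, x = spow q b2 by exists (spow q b2).
rewrite -?al1E -?al2E -?be1E -?be2E' in E1 E2 al10 al20 be2E be20 be1n be12 *.
have nb1 : - `|b1| <= b1 by rewrite lerNl -normrN ler_norm.
have nb1' : b1 <= `|b1| by rewrite ler_norm.
have nbe1 : - `|be1| <= be1 by rewrite lerNl -normrN ler_norm.
(* P1 and P2 exceed -1 because |be1| <= be2 and |b1| <= b2. *)
pose P1 := a2 * al1 + b2 * be1; pose P2 := a1 * al2 + b1 * be2.
have u1 : - be2 * b2 <= be1 * b2 by apply: ler_wpM2r; [exact: ltW|lra].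
have u2 : - b2 * be2 <= b1 * be2 by apply: ler_wpM2r; [exact: ltW|lra].
have v1 := mulr_gt0 c2 al10.
have v2 := mulr_gt0 c2 al20.
have v3 := mulr_gt0 c1 al20.
have Q1 : 0 < 1 + P1 by rewrite /P1; clear -u1 v1 v2 E2; lra.
have Q2 : 0 < 1 + P2 by rewrite /P2; clear -u2 v2 v3 E2; lra.
have ss : s * (a1 + a2) = b1 + b2 by clear -H1 H2; lra.
have a0 : 0 < a1 + a2 by rewrite addr_gt0.
have sE : s = (b1 + b2) / (a1 + a2) by rewrite -ss; field; rewrite gt_eqF.
have rE : r = (a1 * b2 - a2 * b1) / (a1 + a2).
  by rewrite -H1 sE; field; rewrite gt_eqF.
have D1 : 1 + s * (be1 / al1) = (1 + P1) / (al1 * (a1 + a2)).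
  rewrite sE /P1.
  have -> : 1 + (b1 + b2) / (a1 + a2) * (be1 / al1) =
     (a1 * al1 + b1 * be1 + (a2 * al1 + b2 * be1)) / (al1 * (a1 + a2)).
    by field; rewrite !gt_eqF.
  by rewrite E1.
have D2 : 1 + s * (be2 / al2) = (1 + P2) / (al2 * (a1 + a2)).
  rewrite sE /P2.
  have -> : 1 + (b1 + b2) / (a1 + a2) * (be2 / al2) =
     (a2 * al2 + b2 * be2 + (a1 * al2 + b1 * be2)) / (al2 * (a1 + a2)).
    by field; rewrite !gt_eqF.
  by rewrite E2.
have gap : (P1 - P2) * (a1 + a2) <= (a1 - a2) * (1 - P1 * P2).
  have [b10|b10] := ltP 0 b1.
    apply: (@dual_gap R q a1 a2 b1 b2 P1 P2 q0 q1 c2 c12 b10).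
    - by rewrite -(gtr0_norm b10).
    - by rewrite ca1X (gtr0_norm b10) subrK.
    - by rewrite ca2X (gtr0_norm b20) subrK.
    - by rewrite /P1 al1E be1E ge0_spow // ltW.
    - by rewrite /P2 be2E al2E.
  have P12 : P1 <= P2.
    rewrite /P1 /P2 al1E al2E; apply: lerD.
      by apply: powR_ratio_le; rewrite ?(ltW q0) ?(ltW c2) ?(ltW c12).
    have : `|b1| * b2 `^ q <= b2 * `|b1| `^ q.
      by apply: powR_ratio_le; rewrite ?(ltW q0) ?normr_ge0 ?(ltW b12).
    rewrite be2E.
    have -> : be1 = - `|b1| `^ q.
      by rewrite ler0_norm // be1E -{1}[b1]opprK spowN ge0_spow // oppr_ge0.
    by rewrite ler0_norm //; lra.
  (* Cauchy-Binet; both factors are nonnegative as b1 <= 0 and be1 <= 0. *)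
have PP : 1 - P1 * P2 = (a1 * b2 - a2 * b1) * (al1 * be2 - al2 * be1).
    have -> : 1 - P1 * P2 = (a1 * al1 + b1 * be1) * (a2 * al2 + b2 * be2) - P1 * P2.
      by rewrite E1 E2 mul1r.
    by rewrite /P1 /P2; ring.
  have be10 : be1 <= 0 by rewrite be1E -[leRHS]oppr0 -[b1]opprK spowN ge0_spow ?oppr_ge0 // lerN2 powR_ge0.
  apply: (@le_trans _ _ 0).
    by apply: mulr_le0_ge0; [rewrite subr_le0|exact: ltW].
  apply: mulr_ge0; first by rewrite subr_ge0 ltW.
  rewrite PP; apply: mulr_ge0.
    rewrite subr_ge0; apply: (@le_trans _ _ 0).
      by apply: mulr_ge0_le0; [exact: ltW|exact: b10].
    by apply: mulr_ge0; exact: ltW.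
  rewrite subr_ge0; apply: (@le_trans _ _ 0).
    by apply: mulr_ge0_le0; [exact: ltW|exact: be10].
  by apply: mulr_ge0; exact: ltW.
have := trapezoid_of_dual_gap E1 E2 erefl erefl Q1 Q2.
move=> /(_ ltac:(clear -nb1 b12; lra) gap) T.
split; [by rewrite D1; apply: (divr_gt0 Q1); exact: mulr_gt0
      |by rewrite D2; apply: (divr_gt0 Q2); exact: mulr_gt0|].
have -> : r * s * a1 / (1 + s * (be1 / al1)) + r * s * a2 / (1 + s * (be2 / al2)) = s * ((a1 * b2 - a2 * b1) *
   (a1 * al1 / (1 + P1) + a2 * al2 / (1 + P2))).
  rewrite D1 D2 rE.
  by field; rewrite !gt_eqF.
have -> : (b2 ^+ 2 - b1 ^+ 2) / 2 = s * ((a1 + a2) * (b2 - b1) / 2).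
  by rewrite sE; field; rewrite gt_eqF.
by rewrite ler_wpM2l // ltW.
Qed.

Lemma boundary_term_anti s r b1 b2 : 0 < s -> 0 <= r -> `|b1| < 1 -> `|b2| < 1 ->
  b1 <= b2 -> `|b1| <= `|b2| -> 0 < 1 + s * slope q b1 -> boundary_term q s r b2 <= boundary_term q s r b1.
Proof.
move=> s0 r0 n1 n2 b12 nb12 D1.
have cb := slope_le n1 n2 b12.
have ab := height_le nb12.
have c2 := height_ge0 b2.
rewrite /boundary_term.
move: (slope q b1) (slope q b2) D1 cb => y1 y2 D1 cb.
move: (height q b1) (height q b2) ab c2 => a1 a2 ab c2.
have D : 1 + s * y1 <= 1 + s * y2 by rewrite lerD2l; apply: ler_wpM2l => //; exact: ltW.
apply: ler_pM.
- by apply: mulr_ge0 => //; apply: mulr_ge0 => //; exact: ltW.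
- by rewrite invr_ge0; apply: le_trans D; exact: ltW.
- by apply: ler_wpM2l => //; apply: mulr_ge0 => //; exact: ltW.
- exact: inv_le.
Qed.

(** Eliminating s leaves an inequality between b, r >= 1 and the coordinates of
    the dual vector of one point.  For b <= 0 the term with spow q b has the right
    sign; for b > 0 that coordinate is at most 1. *)
Lemma boundary_term_large s r b : 0 < s -> 1 <= r -> `|b| < 1 -> height q b * s - b = r ->
  0 < 1 + s * slope q b -> (1 - b ^+ 2) / 2 <= boundary_term q s r b.
Proof.
move=> s0 r1 n1 E D.
have a0 := height_gt0 n1.
have E1 := curve_id (ltW n1).
rewrite /boundary_term ler_pdivlMr // /slope; clear D.
have spb : b <= 0 -> spow q b <= 0.
  by move=> b0; rewrite -[leRHS]oppr0 -[b]opprK spowN ge0_spow ?oppr_ge0 // lerN2 powR_ge0.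
have spb' : 0 <= b -> spow q b = b `^ q by exact: ge0_spow.
move: (height q b) (spow q b) spb spb' a0 E E1 => a be spb spb' a0 E E1.
have : 0 < a `^ q by exact: powR_gt0.
move: (a `^ q) E1 => al E1 al0.
have sE : s = (r + b) / a by rewrite -E; field; rewrite gt_eqF.
have A0 : 0 < a * al by rewrite mulr_gt0.
rewrite -(ler_pM2r A0).
have -> : (1 - b ^+ 2) / 2 * (1 + s * (be / al)) * (a * al) =
  (1 - b ^+ 2) / 2 * (a * al + (r + b) * be).
  by rewrite sE; field; rewrite !gt_eqF.
have -> : r * s * a * (a * al) = r * (r + b) * (a * al).
  by rewrite sE; field; rewrite gt_eqF.
set A := a * al in A0 E1 *.
have [b1 b1'] : -1 < b /\ b < 1 by move: n1; rewrite ltr_norml => /andP[].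
have [b0|b0] := leP b 0.
  have be0 := spb b0.
  have h1 : (r + b) * be <= 0 by rewrite mulr_ge0_le0 //; lra.
  have h2 : (1 - b ^+ 2) / 2 * (A + (r + b) * be) <= (1 - b ^+ 2) / 2 * A.
    rewrite ler_wpM2l //; last by clear -h1; lra.
    by clear -b1 b1'; nra.
  apply: (le_trans h2); rewrite ler_wpM2r ?(ltW A0)//.
  have k1 : (1 + b) * (1 - b) <= (1 + b) * (2 * r) by apply: ler_wpM2l; clear -b1 b0 r1 b1'; lra.
  have k2 : 1 * (r + b) <= r * (r + b) by apply: ler_wpM2r; clear -b1 r1; lra.
  clear -k1 k2 r1 b1 b0; nra.
have beE := spb' (ltW b0).
have be0 : 0 < be by rewrite beE powR_gt0.
have be1 : be <= 1 by rewrite beE -[leRHS](one_powR q) ge0_ler_powR ?nnegrE // ltW.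
have h1 : (1 - b) * be <= A by lra.
have h2 : (1 - b ^+ 2) * be <= (1 + b) * A.
  have -> : (1 - b ^+ 2) * be = (1 + b) * ((1 - b) * be) by ring.
  by rewrite ler_wpM2l //; lra.
have h3 : (r + b) * ((1 - b ^+ 2) * be) <= (r + b) * ((1 + b) * A).
  by rewrite ler_wpM2l //; lra.
have h4 : (1 + b) * (1 + r) <= (r + b) * (2 * r).
  by apply: ler_pM; clear -b1 b1' r1 b0; lra.
have := ler_wpM2r (ltW A0) h4; lra.
Qed.

End curve.

(** * Convexity from functions touching from below *)

Section convexity_test.
Context {R : realType}.
Implicit Types (f g dg : R -> R) (t u x y : R).

(** The usual second-order condition, under weak regularity: g is differentiable
    near 0 and its derivative is differentiable at 0 only. *)
Lemma no_local_max g dg (D : R) :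
  (\forall t \near (0 : R), is_derive (t : R) 1 g (dg t)) ->
  is_derive (0 : R) 1 dg D -> 0 < D ->
  ~ (\forall t \near (0 : R), g t <= g 0).
Proof.
move=> Hg Hdg D0 Hmax.
have [phi [phiE phic phi0]] := (is_derive1_caratheodory dg 0 D).1 Hdg.
have Hphi : \forall t \near (0 : R), 0 < phi t.
  by apply: (cvgr_gt (phi 0) phic); rewrite phi0.
have : \forall t \near (0 : R), [/\ is_derive (t : R) 1 g (dg t), g t <= g 0 & 0 < phi t].
  by near=> t; split; near: t.
case=> e /= e0 He.
have He' t : `|t| < e -> [/\ is_derive (t : R) 1 g (dg t), g t <= g 0 & 0 < phi t].
  by move=> te; apply: He => /=; rewrite sub0r normrN.
have inI t : t \in `]- e, e[%R -> `|t| < e by rewrite in_itv /= ltr_norml.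
have dg0 : dg 0 = 0.
  have d0 : is_derive (0 : R) 1 g 0.
    apply: (@derive1_at_max _ g (- e) e 0).
    - by rewrite ge0_cp // ltW.
    - by move=> t /inI /He' [d _ _]; exact: ex_derive.
    - by rewrite in_itv /= oppr_lt0 e0.
    - by move=> t /inI /He' [].
  have [d1 _ _] := He' 0 (ltac:(by rewrite normr0)).
  have E0 : 'D_1 g 0 = 0 by case: d0.
  have E1 : 'D_1 g 0 = dg 0 by case: d1.
  by rewrite -E1.
(* The mean value theorem on [0, h] contradicts dg > 0 there. *)
pose h := e / 2.
have h0 : 0 < h by rewrite divr_gt0.
have he : h < e by rewrite /h ltr_pdivrMr // ltr_pMr // ltr1n.
have small t : 0 <= t -> t <= h -> `|t| < e.
  by move=> t0 th; rewrite ger0_norm // (le_lt_trans th).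
have dgh t : t \in `]0, h[%R -> is_derive (t : R) 1 g (dg t).
  rewrite in_itv /= => /andP[t0 th].
  by have [] := He' t (small t (ltW t0) (ltW th)).
have cgh : {within `[0, h], continuous g}.
  apply: derivable_within_continuous => t; rewrite in_itv /= => /andP[t0 th].
  by have [d _ _] := He' t (small t t0 th); exact: ex_derive.
have [c] := MVT h0 dgh cgh.
rewrite in_itv /= => /andP[c0 ch] E.
have [_ _ pc] := He' c (small c (ltW c0) (ltW ch)).
have [_ gh _] := He' h (small h (ltW h0) (lexx _)).
have : 0 < dg c * (h - 0).
  have := phiE c; rewrite dg0 !subr0 => ->.
  by rewrite !mulr_gt0.
by rewrite -E subr_gt0 ltNge gh.
Unshelve. all: by end_near. Qed.

(** D is the second derivative at the contact point, so this is the condition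
    f'' >= 0 in the viscosity sense.  The witness may depend on u. *)
Definition touches_below f (u : R) := exists g dg D,
  [/\ \forall t \near (0 : R), is_derive (t : R) 1 g (dg t),
      is_derive (0 : R) 1 dg D, 0 <= D, g 0 = f u &
      \forall t \near (0 : R), g t <= f (u + t)].

(** If f exceeds its chord at m, then f minus the chord plus a small convex
    quadratic still has a positive interior maximum on [x, y].  There the
    touching function, corrected in the same way, has a local maximum and a
    positive second derivative. *)
Lemma touches_below_chord f (x y m : R) : continuous f ->
  (forall u, touches_below f u) -> x < m -> m < y ->
  f m <= f x + (f y - f x) / (y - x) * (m - x).
Proof.
move=> cf tf xm my; rewrite leNgt; apply/negP => H.
have xy : x < y by exact: lt_trans my.
set k := (f y - f x) / (y - x) in H.
pose l u := f x + k * (u - x).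
have ly : l y = f y by rewrite /l /k; field; rewrite subr_eq0 gt_eqF.
pose del := f m - l m.
have del0 : 0 < del by rewrite subr_gt0.
have mm : 0 < (m - x) * (y - m) by rewrite mulr_gt0 // subr_gt0.
(* With this e the quadratic takes away half of the excess del at m. *)
pose e := del / (2 * ((m - x) * (y - m))).
have e0 : 0 < e by rewrite divr_gt0 // mulr_gt0.
pose G u := f u - l u + e * ((u - x) * (u - y)).
have Gx : G x = 0 by rewrite /G /l subrr; ring.
have Gy : G y = 0 by rewrite /G ly subrr; ring.
have Gm : 0 < G m.
  have -> : G m = del / 2.
    by rewrite /G -/del /e; field; rewrite !gt_eqF // subr_gt0.
  by rewrite divr_gt0.
have cG : {within `[x, y], continuous G}.
  apply: continuous_subspaceT => u.
  have cl : {for u, continuous l}.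
    by apply: cvgD; [exact: cvg_cst|apply: cvgMr; apply: cvgB; [exact: cvg_id|exact: cvg_cst]].
  apply: cvgD; first by apply: cvgB; [exact: cf|exact: cl].
  by apply: cvgMr; apply: cvgM; apply: cvgB; [exact: cvg_id|exact: cvg_cst|exact: cvg_id|exact: cvg_cst].
have [c cxy cmax] := EVT_max (ltW xy) cG.
have Gc : 0 < G c.
  by apply: (lt_le_trans Gm); apply: cmax; rewrite in_itv /= !ltW.
have [xc slope] : x < c /\ c < y.
  move: cxy; rewrite in_itv /= => /andP[xc slope]; split; rewrite lt_neqAle ?xc ?slope andbT.
    by apply/eqP => E; move: Gc; rewrite -E Gx ltxx.
  by apply/eqP => E; move: Gc; rewrite E Gy ltxx.
have [g [dg [D [Hg Hdg D0 g0 gf]]]] := tf c.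
pose K t := g t - l (c + t) + e * ((c + t - x) * (c + t - y)).
pose dK t := dg t - k + e * (2 * (c + t) - x - y).
apply: (@no_local_max K dK (D + e * 2)).
- near=> t.
  have Ht : is_derive (t : R) 1 g (dg t) by near: t.
  rewrite /K /l; apply: is_derive_eq.
  by rewrite /dK /GRing.scale /=; ring.
- rewrite /dK; apply: is_derive_eq.
  by rewrite /GRing.scale /=; ring.
- by rewrite ltr_wpDl // mulr_gt0.
- have n0 : \forall t \near (0 : R), x < c + t < y.
    exists (Num.min (c - x) (y - c)) => /=.
      by rewrite lt_min !subr_gt0 xc.
    move=> t /=; rewrite sub0r normrN lt_min ltr_norml => /andP[/andP[h1 _] h2].
    by move: h2; rewrite ltr_norml => /andP[_ h2]; apply/andP; split; lra.
  near=> t.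
  have gt : g t <= f (c + t) by near: t.
  have : x < c + t < y by near: t.
  move=> /andP[h1 h2].
  have : G (c + t) <= G c by apply: cmax; rewrite in_itv /= !ltW.
  rewrite /G /K g0 addr0; lra.
Unshelve. all: by end_near. Qed.

Lemma convex_functionP f : (forall x y t, 0 < t -> t < 1 -> x < y ->
    f (t * x + (1 - t) * y) <= t * f x + (1 - t) * f y) ->
  convex_function setT (f : R^o -> R^o).
Proof.
move=> H t x y _ _.
change (f (t%:num * x + (1 - t%:num) * y) <= t%:num * f x + (1 - t%:num) * f y).
have s0 : 0 <= t%:num by exact: ge0.
have s1 : t%:num <= 1 by exact: le1.
move: (t%:num) s0 s1 => s s0 s1.
move: s0; rewrite le_eqVlt => /predU1P[<-|s0]; first by rewrite !mul0r !add0r subr0 !mul1r.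
move: s1; rewrite le_eqVlt => /predU1P[->|s1]; first by rewrite subrr !mul0r !addr0 !mul1r.
have [xy|yx|->] := ltgtP x y; first exact: H.
- have t0 : 0 < 1 - s by rewrite subr_gt0.
  have t1 : 1 - s < 1 by rewrite ltrBlDr ltrDl.
  have := H y x (1 - s) t0 t1 yx.
  have -> : 1 - (1 - s) = s by ring.
  by rewrite addrC [leRHS]addrC.
- have E (z : R) : s * z + (1 - s) * z = z by ring.
  by rewrite !E.
Qed.

Lemma convex_functionE f : convex_function setT (f : R^o -> R^o) ->
  forall x y t, 0 <= t -> t <= 1 ->
    f (t * x + (1 - t) * y) <= t * f x + (1 - t) * f y.
Proof.
move=> H x y t t0 t1.
by have := H (Itv01 t0 t1) x y; rewrite !inE => /(_ Logic.I Logic.I).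
Qed.

Lemma touches_below_convex f : continuous f -> (forall u, touches_below f u) ->
  convex_function setT (f : R^o -> R^o).
Proof.
move=> cf tf; apply: convex_functionP => x y t t0 t1 xy.
have := @touches_below_chord f x y (t * x + (1 - t) * y) cf tf.
have yx : 0 < y - x by rewrite subr_gt0.
have -> : f x + (f y - f x) / (y - x) * (t * x + (1 - t) * y - x) = t * f x + (1 - t) * f y.
  by field; rewrite gt_eqF.
apply.
- have : 0 < (1 - t) * (y - x) by rewrite mulr_gt0 // subr_gt0.
  lra.
- have : 0 < t * (y - x) by rewrite mulr_gt0.
  lra.
Qed.

End convexity_test.

(** * Integrals over segments and regularity of the curve *)

Section interval_integral.
Context {R : realType}.
Notation mu := (@lebesgue_measure R).
Implicit Types (f g : R -> R) (a b c x : R).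

Definition segint f a b : R := \int[mu]_(t in `[a, b]) f t.

Lemma segint_integrable f a b : continuous f -> mu.-integrable `[a, b] (EFin \o f).
Proof.
move=> cf; apply: continuous_compact_integrable; first exact: segment_compact.
exact: continuous_subspaceT.
Qed.

Lemma segint_split f a b c : continuous f -> a <= b -> b <= c ->
  segint f a c = segint f a b + segint f b c.
Proof.
move=> cf ab bc; rewrite /segint.
have := @Rintegral_itvB R f (BLeft a) (BRight c) b (segint_integrable _ _ cf).
rewrite !bnd_simp => /(_ ab bc).
rewrite Rintegral_itv_obnd_cbnd => [<-|]; first by rewrite addrC subrK.
apply: integrableS (@segint_integrable f b c cf) => //.
by move=> x /=; rewrite !in_itv /= => /andP[/ltW -> ->].
Qed.

Lemma segint_le f g a b : continuous f -> continuous g ->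
  (forall x, a <= x -> x <= b -> f x <= g x) -> segint f a b <= segint g a b.
Proof.
move=> cf cg fg; apply: le_Rintegral => //; [exact: segint_integrable..|].
by move=> x /=; rewrite in_itv /= => /andP[]; exact: fg.
Qed.

Lemma eq_segint f g a b :
  (forall x, a <= x -> x <= b -> f x = g x) -> segint f a b = segint g a b.
Proof.
move=> fg; apply: eq_Rintegral => x; rewrite inE /= in_itv /= => /andP[].
exact: fg.
Qed.

Lemma segint_ge0 f a b : (forall x, a <= x -> x <= b -> 0 <= f x) -> 0 <= segint f a b.
Proof.
move=> f0; rewrite /segint /Rintegral; apply: fine_ge0; apply: integral_ge0 => x /=.
by rewrite in_itv /= lee_fin => /andP[]; exact: f0.
Qed.

Lemma segint_le0 f a b : continuous f ->
  (forall x, a <= x -> x <= b -> f x <= 0) -> segint f a b <= 0.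
Proof.
move=> cf f0; have c0 : continuous (fun _ : R => 0 : R) by move=> x; exact: cvg_cst.
apply: (le_trans (segint_le cf c0 f0)).
by rewrite /segint Rintegral_cst // mul0r.
Qed.

Lemma segintD f g a b : continuous f -> continuous g ->
  segint (fun x => f x + g x) a b = segint f a b + segint g a b.
Proof. by move=> cf cg; apply: RintegralD => //; exact: segint_integrable. Qed.

Lemma segintZ k f a b : continuous f -> segint (fun x => k * f x) a b = k * segint f a b.
Proof. by move=> cf; apply: RintegralZl => //; exact: segint_integrable. Qed.

Lemma segint_xx f a : segint f a a = 0.
Proof. by rewrite /segint set_itv1 Rintegral_set1. Qed.

Lemma is_derive_segint f a x : continuous f -> a < x -> is_derive x 1 (segint f a) (f x).
Proof.
move=> cf ax.
have [d e] := @continuous_FTC1_closed R f a x (x + 1) (ltac:(by rewrite ltrDl))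
  (segint_integrable _ _ cf) ax (cf x).
by apply: DeriveDef; [exact: d|rewrite -derive1E; exact: e].
Qed.

Lemma segint_reflect f a b : continuous f -> a <= b ->
  segint f (- b) (- a) = segint (fun x => f (- x)) a b.
Proof.
move=> cf ab; apply: (congr1 fine).
exact: (integration_by_substitution_oppr ab (continuous_subspaceT cf)).
Qed.

(** An odd integrand has an even primitive. *)
Lemma segint_odd f a x : continuous f -> (forall t, f (- t) = - f t) ->
  0 < a -> - a <= x -> x <= a -> segint f (- a) x = segint f (- a) (- x).
Proof.
move=> cf fodd a0.
suff H y : 0 <= y -> y <= a -> segint f (- y) y = 0.
  have pos y : 0 <= y -> y <= a -> segint f (- a) y = segint f (- a) (- y).
    move=> y0 ya; rewrite (@segint_split f (- a) (- y) y) ?lerN2 //; last by lra.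
    by rewrite H // addr0.
  move=> h1 h2; have [x0|x0] := leP 0 x; first exact: pos.
  rewrite -{1}[x]opprK -pos //; first by lra.
  by lra.
rewrite le_eqVlt => /predU1P[<- _|y0 ya]; first by rewrite oppr0 segint_xx.
rewrite (@segint_split f (- y) 0 y) //; [|lra|lra].
have -> : segint f (- y) 0 = segint (fun t => -1 * f t) 0 y.
  rewrite -{1}oppr0 segint_reflect ?(ltW y0) //.
  by apply: eq_segint => t _ _; rewrite fodd mulN1r.
by rewrite segintZ // mulN1r addNr.
Qed.

End interval_integral.

Section regularity.
Context {R : realType}.
Implicit Types (e b x : R).

Lemma continuous_ppow e : 0 < e -> continuous (fun x : R => Num.max 0 x `^ e).
Proof.
move=> e0 x; have [x0|x0] := ltP 0 x.
  have H : \forall t \near x, t `^ e = Num.max 0 t `^ e.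
    by near=> t; rewrite max_r // ltW //; near: t; exact: lt_nbhsr.
  have d : derivable (fun t : R => Num.max 0 t `^ e) x 1.
    have dx := @is_derive1_powR R e x x0.
    by have := near_eq_is_derive H dx; case.
  exact/differentiable_continuous/derivable1_diffP.
rewrite /continuous_at max_l // powR0 ?gt_eqF //.
apply/cvgrPdist_lt => /= eps eps0.
pose del := eps `^ e^-1.
have del0 : 0 < del by exact: powR_gt0.
near=> t.
have [t0|t0] := leP t 0; first by rewrite powR0 ?gt_eqF // subrr normr0.
rewrite sub0r normrN ger0_norm ?powR_ge0 //.
have -> : eps = del `^ e by rewrite /del -powRrM mulVf ?gt_eqF // powRr1 // ltW.
apply: gt0_ltr_powR => //; rewrite ?nnegrE ?(ltW t0) ?(ltW del0) //.
by near: t; apply: lt_nbhsl; exact: le_lt_trans del0.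
Unshelve. all: by end_near. Qed.

Context {q : R} (q0 : 0 < q) (q1 : q <= 1).
Let p0 : 0 < 1 + q. Proof. by rewrite addr_gt0. Qed.

Lemma continuous_npow e : 0 < e -> continuous (fun b : R => `|b| `^ e).
Proof.
move=> e0 b.
have -> : (fun b : R => `|b| `^ e) = (fun x => Num.max 0 x `^ e) \o Num.norm.
  by apply/funext => t /=; rewrite max_r.
by apply: continuous_comp; [exact: norm_continuous|exact: continuous_ppow].
Qed.

Lemma continuous_omega_pow e : 0 < e -> continuous (fun b => omega q b `^ e).
Proof.
move=> e0 b; rewrite /omega.
have -> : (fun b : R => Num.max 0 (1 - `|b| `^ (1 + q)) `^ e) =
  (fun x => Num.max 0 x `^ e) \o (fun b => 1 - `|b| `^ (1 + q)) by [].
apply: continuous_comp; last exact: continuous_ppow.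
by apply: cvgB; [exact: cvg_cst|exact: continuous_npow].
Qed.

Lemma continuous_height : continuous (height q).
Proof. by apply: continuous_omega_pow; rewrite invr_gt0. Qed.

(** At b = 0 the chain rule through |b| is not available, and a difference
    quotient is used. *)
Lemma is_derive_npow b : is_derive b 1 (fun b : R => `|b| `^ (1 + q)) ((1 + q) * spow q b).
Proof.
have pos (x : R) : 0 < x -> is_derive x 1 (fun b : R => `|b| `^ (1 + q)) ((1 + q) * spow q x).
  move=> x0; rewrite ge0_spow ?(ltW x0) //.
  have -> : q = 1 + q - 1 by ring.
  rewrite [in X in is_derive _ _ X _](_ : 1 + (1 + q - 1) = 1 + q); last by ring.
  rewrite [in X in X * _](_ : 1 + (1 + q - 1) = 1 + q); last by ring.
  apply: near_eq_is_derive (is_derive1_powR (1 + q) x0).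
  by near=> t; rewrite gtr0_norm //; near: t; exact: lt_nbhsr.
have [b0|b0|<-] := ltgtP 0 b; first exact: pos.
- have nb0 : 0 < - b by rewrite oppr_gt0.
  have dN : is_derive b 1 (@GRing.opp R) (- 1) by apply: is_derive_eq.
  have := @is_derive1_comp R (fun b : R => `|b| `^ (1 + q)) -%R b _ _ (pos _ nb0) dN.
  have -> : (1 + q) * spow q (- b) * -1 = (1 + q) * spow q b by rewrite spowN; ring.
  have -> : (fun b : R => `|b| `^ (1 + q)) \o -%R = (fun b : R => `|b| `^ (1 + q)).
    by apply/funext => t /=; rewrite normrN.
  by [].
- apply/is_derive1_caratheodory; exists (spow q); split.
  + by move=> z; rewrite normr0 powR0 ?gt_eqF // !subr0 mulrC spow_mul.
  + have s0 : spow q 0 = 0 :> R by rewrite ge0_spow // powR0 ?gt_eqF.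
    have c0 := @continuous_npow q q0 0.
    rewrite /continuous_at normr0 powR0 ?gt_eqF // in c0.
    rewrite /prop_for /continuous_at s0.
    apply/cvgr0Pnorm_lt => eps eps0; near=> t; rewrite norm_spow //.
    apply: (@le_lt_trans _ _ `| `|t| `^ q |); first exact: ler_norm.
    by near: t; move/cvgr0Pnorm_lt : c0; exact.
  + by rewrite ge0_spow // powR0 ?gt_eqF // mulr0.
Unshelve. all: by end_near. Qed.

Lemma is_derive_height b : `|b| < 1 -> is_derive b 1 (height q) (- slope q b).
Proof.
move=> b1; have o0 := omega_gt0 q0 b1.
have E := omegaE q0 (ltW b1).
have H : \forall t \near b, (fun x : R => x `^ (1 + q)^-1) (1 - `|t| `^ (1 + q)) = height q t.
  near=> t; rewrite /height omegaE //.
  by apply: ltW; near: t; apply: (@cvgr_lt _ _ _ _ Num.norm `|b|) => //; exact: norm_continuous.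
apply: near_eq_is_derive H _.
rewrite E in o0.
have d1 : is_derive b 1 (fun t : R => 1 - `|t| `^ (1 + q)) (- ((1 + q) * spow q b)).
  have d := is_derive_npow b.
  have := @is_deriveB R R R (fun=> 1) (fun t : R => `|t| `^ (1 + q)) b 1 0 _
    (is_derive_cst (1 : R) b 1) d.
  by rewrite sub0r.
have d2 := is_derive1_powR (1 + q)^-1 o0.
have := @is_derive1_comp R (fun x : R => x `^ (1 + q)^-1) (fun t : R => 1 - `|t| `^ (1 + q)) b _ _ d2 d1.
rewrite /comp -E => d; apply: is_derive_eq.
rewrite /slope /height -powRrM.
have -> : (1 + q)^-1 - 1 = - ((1 + q)^-1 * q) by field; rewrite gt_eqF.
rewrite -E in o0.
rewrite powRN; have := powR_gt0 ((1 + q)^-1 * q) o0.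
move: (omega q b `^ _) => X X0; field.
by rewrite (gt_eqF X0) (gt_eqF p0).
Unshelve. all: by end_near. Qed.

End regularity.

(** * Second-order behaviour of the averaged hinge *)

Section averaged_hinge.
Context {R : realType}.
Implicit Types (r s b u x y : R).

Definition weight (q g : R) b := omega q b `^ g.
(** The product weight * height: the exponents of omega add up. *)
Definition hweight (q g : R) b := omega q b `^ (g + (1 + q)^-1).
Definition moment (q g : R) b := weight q g b * height q b * b.
(** The value of (1-T)^alpha s + eps T^alpha when eps T^alpha is -b. *)
Definition zcurve (q : R) s b : R := height q b * s - b.
(** The function (x - k)_+ at x = z^2, with the threshold written as k = r^2 so that
    it starts to grow at z = r and z = - r. *)
Definition hinge r (z : R) : R := Num.max 0 (z ^+ 2 - r ^+ 2).
(** Up to a constant, the mean of the hinge of the perturbed variable when Y = s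
    and c = 1, in the coordinate b = - eps T^alpha. *)
Definition avg_hinge (q g : R) r s : R :=
  segint (fun b => weight q g b * hinge r (zcurve q s b)) (-1) 1.

Context {q g : R} (q0 : 0 < q) (q1 : q <= 1) (g1 : 1 <= g).
Local Notation rho := (weight q g).
Local Notation hh := (hweight q g).
Local Notation fL := (moment q g).
Local Notation zz := (zcurve q).
Local Notation Gam := (avg_hinge q g).
Let p0 : 0 < 1 + q. Proof. by rewrite addr_gt0. Qed.
Let g0 : 0 < g. Proof. exact: lt_le_trans g1. Qed.


Lemma weight_ge0 b : 0 <= rho b. Proof. exact: powR_ge0. Qed.

Lemma omega_le1 b : omega q b <= 1.
Proof. by rewrite /omega ge_max ler01 /= gerBl powR_ge0. Qed.

Lemma weight_le1 b : rho b <= 1.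
Proof.
rewrite /weight -[leRHS](one_powR g); apply: (ge0_ler_powR (ltW g0)).
- by rewrite nnegrE omega_ge0.
- by rewrite nnegrE ler01.
- exact: omega_le1.
Qed.

Lemma height_le1 b : height q b <= 1.
Proof.
rewrite /height -[leRHS](one_powR (1 + q)^-1); apply: ge0_ler_powR.
- by rewrite invr_ge0 ltW.
- by rewrite nnegrE omega_ge0.
- by rewrite nnegrE ler01.
- exact: omega_le1.
Qed.

Lemma hweightE b : hh b = rho b * height q b.
Proof.
have [b1|b1] := ltP `|b| 1.
  by rewrite /hweight powRD_gt0 // omega_gt0.
have ge0' : 0 < g + (1 + q)^-1 by rewrite addr_gt0 // invr_gt0.
rewrite height0 // mulr0 /hweight omega0 // powR0 //.
by rewrite gt_eqF.
Qed.

Lemma cont_weight : continuous rho. Proof. exact: continuous_omega_pow. Qed.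

Lemma cont_zcurve s : continuous (zz s).
Proof.
move=> b; apply: cvgB; last exact: cvg_id.
by apply: cvgM; [exact: continuous_height|exact: cvg_cst].
Qed.
Lemma cont_id : continuous (fun b : R => b). Proof. by move=> b; exact: cvg_id. Qed.

Lemma contM (f1 f2 : R -> R) : continuous f1 -> continuous f2 -> continuous (fun b => f1 b * f2 b).
Proof. by move=> h1 h2 b; apply: cvgM; [exact: h1|exact: h2]. Qed.
Lemma contD (f1 f2 : R -> R) : continuous f1 -> continuous f2 -> continuous (fun b => f1 b + f2 b).
Proof. by move=> h1 h2 b; apply: cvgD; [exact: h1|exact: h2]. Qed.
Lemma contB (f1 f2 : R -> R) : continuous f1 -> continuous f2 -> continuous (fun b => f1 b - f2 b).
Proof. by move=> h1 h2 b; apply: cvgB; [exact: h1|exact: h2]. Qed.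
Lemma cont_cst (k : R) : continuous (fun _ : R => k).
Proof. by move=> b; exact: cvg_cst. Qed.

Let fA b := rho b * (height q b * height q b).
Let fC r b := rho b * (b * b - r ^+ 2).

Lemma cont_fA : continuous fA.
Proof. by apply: contM; [exact: cont_weight|apply: contM; exact: continuous_height]. Qed.
Lemma cont_moment : continuous fL.
Proof. by apply: contM; [apply: contM; [exact: cont_weight|exact: continuous_height]|exact: cont_id]. Qed.
Lemma cont_fC r : continuous (fC r).
Proof.
apply: contM; first exact: cont_weight.
by apply: contB; [apply: contM; exact: cont_id|exact: cont_cst].
Qed.

Lemma cont_sq r s : continuous (fun b => rho b * (zz s b ^+ 2 - r ^+ 2)).
Proof.
apply: contM; first exact: cont_weight.
by apply: contB; [apply: contM; exact: cont_zcurve|exact: cont_cst].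
Qed.

Lemma cont_hinge r : continuous (hinge r).
Proof.
move=> z; rewrite /hinge; apply: (@continuous_max R R (fun=> 0) (fun z : R => z ^+ 2 - r ^+ 2)).
  exact: cvg_cst.
by apply: contB; [exact: exprn_continuous|exact: cont_cst].
Qed.

Lemma cont_weight_hinge r s : continuous (fun b => rho b * hinge r (zz s b)).
Proof.
apply: contM; first exact: cont_weight.
by move=> b; apply: continuous_comp; [exact: cont_zcurve|exact: cont_hinge].
Qed.

Lemma hinge_ge0 r z : 0 <= hinge r z. Proof. by rewrite /hinge le_max lexx. Qed.
Lemma hinge_ge r z : z ^+ 2 - r ^+ 2 <= hinge r z.
Proof. by rewrite /hinge le_max lexx orbT. Qed.

Let PA := segint fA (-1).
Let PL := segint fL (-1).
Let PC r := segint (fC r) (-1).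

(** Without the positive part the integral over a segment is a quadratic
    polynomial of s whose coefficients are increments of fixed primitives; this
    separates the dependence on s from the dependence on the ends. *)
Lemma segint_sqE r s x y : -1 <= x -> x <= y ->
  segint (fun b => rho b * (zz s b ^+ 2 - r ^+ 2)) x y =
  (PA y - PA x) * s ^+ 2 - (PL y - PL x) * (2 * s) + (PC r y - PC r x).
Proof.
move=> x1 xy.
have E f : continuous f -> segint f (-1) y - segint f (-1) x = segint f x y.
  by move=> cf; rewrite (segint_split cf x1 xy) addrC addKr.
rewrite /PA /PL /PC !E; [|exact: cont_fC|exact: cont_moment|exact: cont_fA].
have c1 : continuous (fun b => s ^+ 2 * fA b) by apply: contM; [exact: cont_cst|exact: cont_fA].
have c2 : continuous (fun b => - (2 * s) * fL b) by apply: contM; [exact: cont_cst|exact: cont_moment].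
have -> : (fun b => rho b * (zz s b ^+ 2 - r ^+ 2)) =
    (fun b => (s ^+ 2 * fA b + - (2 * s) * fL b) + fC r b).
  by apply/funext => b; rewrite /fA /moment /fC /zcurve; ring.
rewrite segintD; [|exact: contD|exact: cont_fC].
rewrite segintD //.
rewrite segintZ; last exact: cont_fA.
rewrite segintZ; last exact: cont_moment.
by ring.
Qed.

(** Dropping the positive part, and the part of the integral over the complement,
    can only lower the value. *)
Lemma avg_hinge_ge_pieces r s e0 x1 x2 : -1 <= e0 -> e0 <= x1 -> x1 <= x2 -> x2 <= 1 ->
  segint (fun b => rho b * (zz s b ^+ 2 - r ^+ 2)) e0 x1 +
  segint (fun b => rho b * (zz s b ^+ 2 - r ^+ 2)) x2 1 <= Gam r s.
Proof.
move=> h1 h2 h3 h4.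
have c := @cont_weight_hinge r s.
rewrite /avg_hinge (segint_split c h1 (le_trans h2 (le_trans h3 h4))).
rewrite (segint_split c h2 (le_trans h3 h4)) (segint_split c h3 h4).
have p x y : 0 <= segint (fun b => rho b * hinge r (zz s b)) x y.
  by apply: segint_ge0 => b _ _; apply: mulr_ge0; [exact: weight_ge0|exact: hinge_ge0].
have l x y : segint (fun b => rho b * (zz s b ^+ 2 - r ^+ 2)) x y <=
    segint (fun b => rho b * hinge r (zz s b)) x y.
  apply: segint_le => [||b _ _]; [exact: cont_sq|exact: c|].
  by apply: ler_wpM2l; [exact: weight_ge0|exact: hinge_ge].
have := p (-1) e0; have := p x1 x2; have := l e0 x1; have := l x2 1; lra.
Qed.

Lemma avg_hinge_eq_pieces r s e0 x1 x2 : -1 <= e0 -> e0 <= x1 -> x1 <= x2 -> x2 <= 1 ->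
  (forall b, -1 < b -> b <= e0 -> zz s b ^+ 2 <= r ^+ 2) ->
  (forall b, e0 <= b -> b <= x1 -> r ^+ 2 <= zz s b ^+ 2) ->
  (forall b, x1 <= b -> b <= x2 -> zz s b ^+ 2 <= r ^+ 2) ->
  (forall b, x2 <= b -> b < 1 -> r ^+ 2 <= zz s b ^+ 2) ->
  Gam r s = segint (fun b => rho b * (zz s b ^+ 2 - r ^+ 2)) e0 x1 +
  segint (fun b => rho b * (zz s b ^+ 2 - r ^+ 2)) x2 1.
Proof.
move=> h1 h2 h3 h4 k1 k2 k3 k4.
have c := @cont_weight_hinge r s.
rewrite /avg_hinge (segint_split c h1 (le_trans h2 (le_trans h3 h4))).
rewrite (segint_split c h2 (le_trans h3 h4)) (segint_split c h3 h4).
have rho0 b : `|b| = 1 -> rho b = 0.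
  by move=> b1; rewrite /weight omega0 ?b1 // powR0 // gt_eqF.
have z0 x y : -1 <= x -> (forall b, -1 < b -> x <= b -> b <= y -> zz s b ^+ 2 <= r ^+ 2) ->
    segint (fun b => rho b * hinge r (zz s b)) x y = 0.
  move=> xm H.
  have -> : segint (fun b => rho b * hinge r (zz s b)) x y = segint (fun b => 0 * rho b) x y.
    apply: eq_segint => b xb b_y.
    have := le_trans xm xb; rewrite le_eqVlt => /predU1P[<-|b1].
      by rewrite rho0 ?normrN1 // !mul0r.
    by rewrite /hinge max_l ?mulr0 ?mul0r // subr_le0 H.
  by rewrite segintZ ?mul0r //; exact: cont_weight.
rewrite (z0 (-1) e0) //; last by move=> b b1 _; exact: k1.
rewrite (z0 x1 x2); last 2 first.
- exact: le_trans h2.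
- by move=> b _; exact: k3.
rewrite !add0r; congr (_ + _); apply: eq_segint => b b1 b2.
  by rewrite /hinge max_r // subr_ge0 k2.
move: b2; rewrite le_eqVlt => /predU1P[->|b2].
  by rewrite rho0 ?normr1 // !mul0r.
by rewrite /hinge max_r // subr_ge0 k4.
Qed.

Section touching.
Variables (r s : R) (s0 : 0 < s).
Let sg t : R := Num.sqrt (s ^+ 2 + t).

Let sg0 : sg 0 = s.
Proof. by rewrite /sg addr0 sqrtr_sqr gtr0_norm. Qed.

Let is_derive_sg (t : R) : 0 < s ^+ 2 + t -> is_derive t 1 sg (2 * sg t)^-1.
Proof.
move=> h; have d := is_derive1_sqrt h.
have d' : is_derive t 1 (fun t : R => s ^+ 2 + t) 1.
  by apply: is_derive_eq; rewrite /GRing.scale /=; ring.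
by have := @is_derive1_comp R Num.sqrt (fun t : R => s ^+ 2 + t) t _ _ d d'; rewrite mulr1.
Qed.

Let is_derive_aff (b v t : R) : is_derive t 1 (fun t : R => b + v * t) v.
Proof. by apply: is_derive_eq; rewrite /GRing.scale /=; ring. Qed.

Let is_derive_segint_aff (f : R -> R) (b v t : R) : continuous f -> -1 < b + v * t ->
  is_derive t 1 (fun t => segint f (-1) (b + v * t)) (f (b + v * t) * v).
Proof.
move=> cf h; have d := is_derive_segint cf h.
exact: (@is_derive1_comp R (segint f (-1)) (fun t : R => b + v * t) t _ _ d (is_derive_aff b v t)).
Qed.

(** The part of the derivative of the touching function that is due to a moving
    end. *)
Let end_speed (b v t : R) := v * (rho (b + v * t) * (zz (sg t) (b + v * t) ^+ 2 - r ^+ 2)).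

(** When the end moves at the speed of the true solution of z^2 = r^2, the
    integrand at the end vanishes to second order.  The weight is only
    continuous, which is enough because it multiplies a function with zero value
    and zero derivative. *)
Let is_derive_end_speed0 (b v : R) :
  v = 0 \/ [/\ v * (2 * s * (1 + s * slope q b)) = height q b, `|b| < 1 & zz s b ^+ 2 = r ^+ 2] ->
  is_derive (0 : R) 1 (end_speed b v) 0.
Proof.
case=> [->|[vE b1 zE]].
  have -> : end_speed b 0 = fun=> 0 by apply/funext => t; rewrite /end_speed mul0r.
  exact: is_derive_cst.
pose N t := zz (sg t) (b + v * t) ^+ 2 - r ^+ 2.
have ss : 0 < s ^+ 2 + 0 by rewrite addr0 exprn_gt0.
have dN : is_derive (0 : R) 1 N 0.
  have d1 := is_derive_sg ss.
  have d2 := is_derive_aff b v 0.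
  have d3 : is_derive (0 : R) 1 (fun t => height q (b + v * t)) (- slope q b * v).
    have h : is_derive (b + v * 0) 1 (height q) (- slope q b).
      by rewrite mulr0 addr0; exact: is_derive_height.
    exact: (@is_derive1_comp R (height q) (fun t : R => b + v * t) 0 _ _ h d2).
  rewrite sg0 in d1.
  rewrite /N /zcurve; apply: is_derive_eq.
  rewrite /GRing.scale /= sg0 !mulr0 !addr0.
  rewrite -vE; field; rewrite gt_eqF //.
have [phi [phiE phic phi0]] := (is_derive1_caratheodory N 0 0).1 dN.
have N0 : N 0 = 0 by rewrite /N mulr0 addr0 sg0 zE subrr.
apply/is_derive1_caratheodory; exists (fun t => v * (rho (b + v * t) * phi t)); split.
- move=> z.
  have es t : end_speed b v t = v * (rho (b + v * t) * N t) by [].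
  have NE : N z = phi z * (z - 0) by rewrite -phiE N0 subr0.
  rewrite !es N0 NE; move: (rho _) (rho _) (phi z) => A B C; ring.
- apply: cvgMr; apply: cvgM; last exact: phic.
  apply: (@continuous_comp _ _ _ (fun t : R => b + v * t) rho); last exact: cont_weight.
  by apply: cvgD; [exact: cvg_cst|apply: cvgMr; exact: cvg_id].
- by rewrite phi0 !mulr0.
Qed.

(** The touching function G is the integral of weight * (z^2 - r^2) over
    [e0, b1 + v1 t] and [b2 + v2 t, 1].  In its derivative the terms of the moving
    ends are negligible by [is_derive_end_speed0], so the second derivative comes
    from dS and from the factor 1 / sqrt u only; the last hypothesis says that it
    is nonnegative.  The alternative v2 = 0 and b2 = 1 makes the second segment
    empty. *)
Lemma touch_of_boundary e0 b1 b2 v1 v2 : -1 <= e0 -> e0 < b1 -> b1 < b2 -> b2 <= 1 ->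
  [/\ v1 * (2 * s * (1 + s * slope q b1)) = height q b1, `|b1| < 1 & zz s b1 = r] ->
  (v2 = 0 /\ b2 = 1) \/
  [/\ v2 * (2 * s * (1 + s * slope q b2)) = height q b2, `|b2| < 1 & zz s b2 = - r] ->
  (forall b, -1 < b -> b <= e0 -> zz s b ^+ 2 <= r ^+ 2) ->
  (forall b, e0 <= b -> b <= b1 -> r ^+ 2 <= zz s b ^+ 2) ->
  (forall b, b1 <= b -> b <= b2 -> zz s b ^+ 2 <= r ^+ 2) ->
  (forall b, b2 <= b -> b < 1 -> r ^+ 2 <= zz s b ^+ 2) ->
  0 <= 2 * r * s ^+ 2 * (v1 * hh b1 + v2 * hh b2) + (PL b1 - PL e0 + (PL 1 - PL b2)) ->
  touches_below (fun u => Gam r (Num.sqrt u)) (s ^+ 2).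
Proof.
move=> e0m e0b1 b12 b21 H1 H2 k1 k2 k3 k4 HD.
have b1m : -1 < b1 by exact: le_lt_trans e0b1.
have b2m : -1 < b2 by exact: lt_trans b12.
pose S (P : R -> R) t := (P (b1 + v1 * t) - P e0) + (P 1 - P (b2 + v2 * t)).
pose G t := S PA t * (s ^+ 2 + t) - S PL t * (2 * sg t) + S (PC r) t.
pose dG t := S PA t - S PL t / sg t + (end_speed b1 v1 t - end_speed b2 v2 t).
pose dS (f : R -> R) t := f (b1 + v1 * t) * v1 - f (b2 + v2 * t) * v2.
have dSP f t : continuous f -> -1 < b1 + v1 * t -> -1 < b2 + v2 * t ->
    is_derive (t : R) 1 (S (segint f (-1))) (dS f t).
  move=> cf h1 h2.
  have d1 := is_derive_segint_aff cf h1; have d2 := is_derive_segint_aff cf h2.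
  by rewrite /S /dS; apply: is_derive_eq; ring.
have n1 : \forall t \near (0 : R), 0 < s ^+ 2 + t.
  have c : (fun t : R => s ^+ 2 + t) @ (0 : R) --> s ^+ 2 + 0.
    by apply: cvgD; [exact: cvg_cst|exact: cvg_id].
  by apply: (cvgr_gt _ c); rewrite addr0 exprn_gt0.
have caff (b v : R) : (fun t : R => b + v * t) @ (0 : R) --> b.
  have -> : b = b + v * 0 :> R by rewrite mulr0 addr0.
  rewrite [in X in X @ _](_ : b + v * 0 = b); last by rewrite mulr0 addr0.
  by apply: cvgD; [exact: cvg_cst|apply: cvgMr; exact: cvg_id].
have n2 : \forall t \near (0 : R), e0 < b1 + v1 * t by exact: (cvgr_gt _ (caff b1 v1)).
have n3 : \forall t \near (0 : R), b1 + v1 * t < b2 + v2 * t.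
  have c : (fun t : R => (b2 + v2 * t) - (b1 + v1 * t)) @ (0 : R) --> b2 - b1.
    by apply: cvgB; exact: caff.
  have h : 0 < b2 - b1 by rewrite subr_gt0.
  by near=> t; rewrite -subr_gt0; near: t; exact: (cvgr_gt _ c).
have n4 : \forall t \near (0 : R), b2 + v2 * t <= 1.
  case: H2 => [[-> ->]|[_ h _]].
    by near=> t; rewrite mul0r addr0.
  have b2l : b2 < 1 by apply: le_lt_trans h; exact: ler_norm.
  by near=> t; apply: ltW; near: t; exact: (cvgr_lt _ (caff b2 v2)).
have sgt t : 0 < s ^+ 2 + t -> sg t ^+ 2 = s ^+ 2 + t /\ 0 < sg t.
  by move=> h; rewrite /sg sqr_sqrtr ?(ltW h) // sqrtr_gt0.
have GE t : e0 < b1 + v1 * t -> b1 + v1 * t < b2 + v2 * t -> b2 + v2 * t <= 1 ->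
    0 < s ^+ 2 + t ->
    G t = segint (fun b => rho b * (zz (sg t) b ^+ 2 - r ^+ 2)) e0 (b1 + v1 * t) +
          segint (fun b => rho b * (zz (sg t) b ^+ 2 - r ^+ 2)) (b2 + v2 * t) 1.
  move=> h1 h2 h3 h4; rewrite !segint_sqE //.
  - have [E _] := sgt t h4; rewrite E /G /S.
    move: (PA _) (PA _) (PA _) (PA _) (PL _) (PL _) (PL _) (PL _)
      (PC _ _) (PC _ _) (PC _ _) (PC _ _) (sg t) => *; ring.
  - by apply: (le_trans e0m); apply: ltW; apply: (lt_trans h1).
  - exact: ltW.
exists G, dG, ((r / s) * (v1 * hh b1 + v2 * hh b2) + (S PL 0) / (2 * s ^+ 3)).
split.
- near=> t.
  have t1 : 0 < s ^+ 2 + t by near: t.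
  have t2 : e0 < b1 + v1 * t by near: t.
  have t3 : b1 + v1 * t < b2 + v2 * t by near: t.
  have m1 : -1 < b1 + v1 * t by exact: le_lt_trans t2.
  have m2 : -1 < b2 + v2 * t by exact: lt_trans t3.
  have [E spow] := sgt t t1.
  have dA := dSP _ _ cont_fA m1 m2; have dL := dSP _ _ cont_moment m1 m2.
  have dC := dSP _ _ (@cont_fC r) m1 m2; have dsg := is_derive_sg t1.
  rewrite -/PA in dA; rewrite -/PL in dL; rewrite -/(PC r) in dC.
  rewrite /G; apply: is_derive_eq.
  rewrite /GRing.scale /= -E /dG /end_speed /dS /fA /moment /fC /zcurve.
  move: (S PA t) (S PL t) (sg t) (rho (b1 + v1 * t)) (rho (b2 + v2 * t))
    (height q (b1 + v1 * t)) (height q (b2 + v2 * t)) spow => u1 u2 u9 u3 u4 u5 u6 u90.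
  move: (b1 + v1 * t) (b2 + v2 * t) => u7 u8.
  by field; rewrite (gt_eqF u90).
- have m1 : -1 < b1 + v1 * 0 by rewrite mulr0 addr0.
  have m2 : -1 < b2 + v2 * 0 by rewrite mulr0 addr0.
  have t1 : 0 < s ^+ 2 + 0 by rewrite addr0 exprn_gt0.
  have dA := dSP _ _ cont_fA m1 m2; have dL := dSP _ _ cont_moment m1 m2.
  have dsg := is_derive_sg t1.
  rewrite -/PA in dA; rewrite -/PL in dL.
  have e1 : is_derive (0 : R) 1 (end_speed b1 v1) 0.
    by apply: is_derive_end_speed0; right; case: H1 => h1 h2 ->; split.
  have e2 : is_derive (0 : R) 1 (end_speed b2 v2) 0.
    apply: is_derive_end_speed0; case: H2 => [[-> _]|[h1 h2 ->]]; first by left.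
    by right; split => //; rewrite sqrrN.
  have sgn0 : sg 0 != 0 by rewrite sg0 gt_eqF.
  have dV : is_derive (0 : R) 1 (fun t => (sg t)^-1) (- (sg 0) ^- 2 *: (2 * sg 0)^-1).
    exact: is_deriveV.
  rewrite /dG; apply: is_derive_eq.
  rewrite /GRing.scale /= /dS sg0 !mulr0 !addr0 /fA /moment !hweightE.
  have b1E : b1 = height q b1 * s - r by case: H1 => _ _ <-; rewrite /zcurve; ring.
  have B2 : b2 * v2 = (height q b2 * s + r) * v2.
    case: H2 => [[-> _]|[_ _ Z2]]; first by rewrite !mulr0.
    by congr (_ * _); rewrite -[r]opprK -Z2 /zcurve; ring.
  move: (rho b1) (rho b2) (S PL 0) => u1 u2 u3.
  move: (height q b1) (height q b2) b1E B2 => c1 c2 b1E B2.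
  rewrite -(mulrA _ b2 v2) B2 b1E.
  by field; rewrite (gt_eqF s0).
- have -> : r / s * (v1 * hh b1 + v2 * hh b2) + S PL 0 / (2 * s ^+ 3) =
    (2 * r * s ^+ 2 * (v1 * hh b1 + v2 * hh b2) + (PL b1 - PL e0 + (PL 1 - PL b2))) / (2 * s ^+ 3).
    rewrite /S !mulr0 !addr0.
    move: (hh b1) (hh b2) (PL b1) (PL b2) (PL e0) (PL 1) => u1 u2 u3 u4 u5 u6.
    by field; rewrite (gt_eqF s0).
  by apply: divr_ge0 => //; rewrite mulr_ge0 // exprn_ge0 // ltW.
- rewrite GE ?mulr0 ?addr0 // ?exprn_gt0 //.
  rewrite sg0 sqrtr_sqr (gtr0_norm s0).
  symmetry; apply: avg_hinge_eq_pieces => //; exact: ltW.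
- near=> t.
  have t1 : 0 < s ^+ 2 + t by near: t.
  have t2 : e0 < b1 + v1 * t by near: t.
  have t3 : b1 + v1 * t < b2 + v2 * t by near: t.
  have t4 : b2 + v2 * t <= 1 by near: t.
  rewrite GE //; apply: avg_hinge_ge_pieces => //; exact: ltW.
Unshelve. all: by end_near. Qed.

End touching.

End averaged_hinge.

(** * Convexity of the averaged hinge *)

Section hinge_convexity.
Context {R : realType}.
Context {q g : R} (q0 : 0 < q) (q1 : q <= 1) (g1 : 1 <= g).
Implicit Types (r s b u x y : R).
Local Notation rho := (weight q g).
Local Notation hh := (hweight q g).
Local Notation fL := (moment q g).
Local Notation zz := (zcurve q).
Local Notation Gam := (avg_hinge q g).
Local Notation PL := (segint fL (-1)).
Let p0 : 0 < 1 + q. Proof. by rewrite addr_gt0. Qed.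
Let g0 : 0 < g. Proof. exact: lt_le_trans g1. Qed.
Let cz s : continuous (zz s). Proof. exact: cont_zcurve. Qed.

Lemma zcurve_N1 s : zz s (-1) = 1.
Proof. by rewrite /zcurve height0 ?normrN1 // mul0r sub0r opprK. Qed.
Lemma zcurve_1 s : zz s 1 = -1.
Proof. by rewrite /zcurve height0 ?normr1 // mul0r sub0r. Qed.

Lemma zcurve_MVT s x y : 0 < s -> -1 <= x -> x < y -> y <= 1 ->
  exists c, [/\ x < c, c < y, `|c| < 1 & zz s y - zz s x = - (1 + s * slope q c) * (y - x)].
Proof.
move=> s0 x1 xy y1.
have small c : c \in `]x, y[%R -> `|c| < 1.
  rewrite in_itv /= => /andP[xc c_y]; rewrite ltr_norml.
  by apply/andP; split; [exact: le_lt_trans xc|exact: lt_le_trans y1].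
have dz c : c \in `]x, y[%R -> is_derive (c : R) 1 (zz s) (- (1 + s * slope q c)).
  move=> /small c1; have d := is_derive_height q0 c1.
  by rewrite /zcurve; apply: is_derive_eq; rewrite /GRing.scale /=; move: (slope q c) => *; ring.
have cf : {within `[x, y], continuous (zz s)} by apply: continuous_subspaceT; exact: cz.
have [c cxy E] := MVT xy dz cf.
exists c; split => //; last exact: small.
  by move: cxy; rewrite in_itv /= => /andP[].
by move: cxy; rewrite in_itv /= => /andP[].
Qed.

(** z is concave in b, since its derivative - (1 + s * slope) is nonincreasing:
    a value below both ends would force the derivative to be first negative and
    then positive. *)
Lemma zcurve_qconcave s x y w k : 0 < s -> -1 <= x -> x < y -> y < w -> w <= 1 ->
  k <= zz s x -> k <= zz s w -> k <= zz s y.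
Proof.
move=> s0 x1 xy yw w1 kx kw; rewrite leNgt; apply/negP => ky.
have yl : y <= 1 by exact: le_trans (ltW yw) w1.
have yg : -1 <= y by exact: le_trans x1 (ltW xy).
have [c [xc c_y c1 E1]] := zcurve_MVT s0 x1 xy yl.
have [d [yd dw d1 E2]] := zcurve_MVT s0 yg yw w1.
have cd : slope q c <= slope q d by apply: slope_le => //; exact: ltW (lt_trans c_y yd).
have h1 : 0 < 1 + s * slope q c.
  have : - (1 + s * slope q c) * (y - x) < 0 by rewrite -E1 subr_lt0; exact: lt_le_trans ky kx.
  by rewrite pmulr_llt0 ?subr_gt0 // oppr_lt0.
have h2 : 1 + s * slope q d < 0.
  have : 0 < - (1 + s * slope q d) * (w - y) by rewrite -E2 subr_gt0; exact: lt_le_trans ky kw.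
  by rewrite pmulr_lgt0 ?subr_gt0 // oppr_gt0.
have : 1 + s * slope q c <= 1 + s * slope q d by rewrite lerD2l; apply: ler_wpM2l => //; exact: ltW.
by move=> /(lt_le_trans h1) /lt_trans /(_ h2); rewrite ltxx.
Qed.

Lemma zcurve_geN1 s b : 0 < s -> -1 <= b -> b <= 1 -> -1 <= zz s b.
Proof.
move=> s0; rewrite le_eqVlt => /predU1P[<- _|b1]; first by rewrite zcurve_N1; lra.
rewrite le_eqVlt => /predU1P[->|b2]; first by rewrite zcurve_1.
apply: (@zcurve_qconcave s (-1) b 1) => //; first by rewrite zcurve_N1; lra.
by rewrite zcurve_1.
Qed.

Lemma sqr_le_of r z : - r <= z -> z <= r -> z ^+ 2 <= r ^+ 2.
Proof. by move=> h1 h2; rewrite -subr_ge0 subr_sqr mulr_ge0 //; lra. Qed.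
Lemma sqr_ge_of r z : 0 <= r -> r <= z -> r ^+ 2 <= z ^+ 2.
Proof. by move=> h1 h2; rewrite -subr_ge0 subr_sqr mulr_ge0 //; lra. Qed.
Lemma sqr_ge_ofN r z : 0 <= r -> z <= - r -> r ^+ 2 <= z ^+ 2.
Proof. by move=> h1 h2; rewrite -(sqrrN z); apply: sqr_ge_of => //; lra. Qed.

(** The integrand is odd. *)
Lemma moment_even x : -1 <= x -> x <= 1 -> PL x = PL `|x|.
Proof.
move=> x1 x2; have [x0|x0] := leP 0 x; first by rewrite ger0_norm.
rewrite ltr0_norm //; apply: (@segint_odd _ fL 1) => //.
  exact: cont_moment.
by move=> t; rewrite /moment /weight omegaN heightN mulrN.
Qed.

Lemma moment_1 : PL 1 = 0.
Proof. by have := @moment_even (-1); rewrite normrN1 segint_xx => <- //; lra. Qed.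

Lemma moment_split x y : -1 <= x -> x <= y -> PL y - PL x = segint fL x y.
Proof.
move=> x1 xy; rewrite (@segint_split _ fL (-1) x y) //; last exact: cont_moment.
by rewrite addrC addKr.
Qed.

Lemma moment_le0 x : -1 <= x -> x <= 1 -> PL x <= 0.
Proof.
move=> x1 x2; have nx : `|x| <= 1 by rewrite ler_norml x1.
have -> : PL x = PL (- `|x|).
  have h1 : -1 <= - `|x| by rewrite lerN2.
  have h2 : - `|x| <= 1 by apply: (@le_trans _ _ 0); rewrite ?oppr_le0.
  by rewrite (moment_even x1 x2) (moment_even h1 h2) normrN normr_id.
apply: segint_le0; first exact: cont_moment.
move=> b _ b2; rewrite /moment; apply: mulr_ge0_le0.
  by apply: mulr_ge0; [exact: weight_ge0|exact: height_ge0].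
by apply: (le_trans b2); rewrite oppr_le0.
Qed.

Lemma momentE b : fL b = hh b * b.
Proof. by rewrite hweightE. Qed.

Lemma hweight_le b1 b2 : `|b1| <= `|b2| -> hh b2 <= hh b1.
Proof.
move=> b12; have h := omega_le q0 b12; rewrite /hweight; apply: ge0_ler_powR.
- by apply: addr_ge0; [exact: ltW|rewrite invr_ge0 ltW].
- by rewrite nnegrE omega_ge0.
- by rewrite nnegrE omega_ge0.
- exact: h.
Qed.

Lemma hweight_ge0 b : 0 <= hh b. Proof. exact: powR_ge0. Qed.

Lemma segint_poly (c0 c1 x y : R) : x < y ->
  segint (fun b => (c0 + c1 * b ^+ 2) * b) x y =
  c0 * ((y ^+ 2 - x ^+ 2) / 2) + c1 * ((y ^+ 4 - x ^+ 4) / 4).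
Proof.
move=> xy; rewrite /segint /Rintegral.
pose F (b : R) := c0 / 2 * b ^+ 2 + c1 / 4 * b ^+ 4.
have dF (b : R) : is_derive b 1 F ((c0 + c1 * b ^+ 2) * b).
  by rewrite /F; apply: is_derive_eq; rewrite /GRing.scale /=; field.
have cF : continuous F.
  move=> b; apply/differentiable_continuous/derivable1_diffP.
  by case: (dF b).
rewrite (@continuous_FTC2 _ _ F) //.
- by rewrite /= /F; field.
- apply: continuous_subspaceT; apply: contM; last exact: cont_id.
  apply: contD; first exact: cont_cst.
  by apply: contM; [exact: cont_cst|exact: exprn_continuous].
- split.
  + by move=> b _; case: (dF b).
  + by apply: cvg_at_right_filter; exact: cF.
  + by apply: cvg_at_left_filter; exact: cF.
- by move=> b _; rewrite derive1E; case: (dF b).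
Qed.

(** The weight is a convex function of b^2: |b|^(1+q) is the power (1+q)/2 <= 1 of
    b^2, so omega is convex in b^2, and a power of exponent at least 1 preserves
    convexity. *)
Lemma hweight_chord x y b : 0 <= x -> x < y -> y <= 1 -> x <= b -> b <= y ->
  hh b <= hh x + (hh y - hh x) / (y ^+ 2 - x ^+ 2) * (b ^+ 2 - x ^+ 2).
Proof.
move=> x0 xy y1 xb b_y.
have b0 : 0 <= b by exact: le_trans xb.
have y0 : 0 <= y by exact: le_trans b_y.
have D0 : 0 < y ^+ 2 - x ^+ 2 by rewrite subr_gt0 ltr_pXn2r.
pose t := (y ^+ 2 - b ^+ 2) / (y ^+ 2 - x ^+ 2).
have t0 : 0 <= t by apply: divr_ge0; [rewrite subr_ge0 ler_pXn2r|exact: ltW].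
have t1 : t <= 1.
  by rewrite /t ler_pdivrMr // mul1r lerD2l lerN2 ler_pXn2r.
have bE : b ^+ 2 = t * x ^+ 2 + (1 - t) * y ^+ 2.
  by rewrite /t; field; rewrite gt_eqF.
have -> : hh x + (hh y - hh x) / (y ^+ 2 - x ^+ 2) * (b ^+ 2 - x ^+ 2) =
    t * hh x + (1 - t) * hh y.
  rewrite /t; move: (hh x) (hh y) => *; by field; rewrite gt_eqF.
(* th <= 1, as q <= 1; convexity is applied to the inverse exponent. *)
pose th := (1 + q) / 2.
have th0 : 0 < th by rewrite divr_gt0.
have thi : 1 <= th^-1 by rewrite invf_ge1 // /th ler_pdivrMr // mul1r; have := q1; lra.
have sqp z : 0 <= z -> `|z| `^ (1 + q) = (z ^+ 2) `^ th.
  move=> z0; rewrite ger0_norm // -powR_mulrn // -powRrM /th; congr (_ `^ _).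
  by field.
have cvx (e A B : R) : 1 <= e -> 0 <= A -> 0 <= B ->
    (t * A + (1 - t) * B) `^ e <= t * A `^ e + (1 - t) * B `^ e.
  move=> e1 A0 B0; have := @convex_powR R e e1 (Itv01 t0 t1) A B.
  rewrite !inE /= !in_itv /= !andbT => /(_ A0 B0).
  by rewrite !convRE.
have omb : omega q b <= t * omega q x + (1 - t) * omega q y.
  have bn : `|b| <= 1 by rewrite ger0_norm //; exact: le_trans y1.
  have xn : `|x| <= 1 by rewrite ger0_norm //; exact: le_trans (ltW xy) y1.
  have yn : `|y| <= 1 by rewrite ger0_norm.
  rewrite (omegaE q0 bn) (omegaE q0 xn) (omegaE q0 yn) !sqp //.
  set A := (x ^+ 2) `^ th; set B := (y ^+ 2) `^ th.
  have A0 : 0 <= A by exact: powR_ge0.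
  have B0 : 0 <= B by exact: powR_ge0.
  have s0 : 0 <= t * A + (1 - t) * B.
    by apply: addr_ge0; apply: mulr_ge0 => //; rewrite subr_ge0.
  have AE : x ^+ 2 = A `^ th^-1.
    by rewrite /A -powRrM mulfV ?gt_eqF // powRr1 // sqr_ge0.
  have BE : y ^+ 2 = B `^ th^-1.
    by rewrite /B -powRrM mulfV ?gt_eqF // powRr1 // sqr_ge0.
  have K : t * A + (1 - t) * B <= (b ^+ 2) `^ th.
    rewrite -[leLHS](powRr1 s0) -[X in _ `^ X](mulVf (lt0r_neq0 th0)) powRrM.
    apply: (ge0_ler_powR (ltW th0)).
    - by rewrite nnegrE powR_ge0.
    - by rewrite nnegrE sqr_ge0.
    - by rewrite bE AE BE; apply: cvx.
  have E (A' B' : R) : t * (1 - A') + (1 - t) * (1 - B') = 1 - (t * A' + (1 - t) * B') by ring.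
  by rewrite E lerD2l lerN2.
rewrite /hweight; set e := g + _.
have e1 : 1 <= e by rewrite /e -[leLHS]addr0; apply: lerD => //; rewrite invr_ge0 ltW.
apply: (le_trans _ (cvx e _ _ e1 (omega_ge0 _) (omega_ge0 _))).
apply: ge0_ler_powR.
- exact: le_trans e1.
- by rewrite nnegrE omega_ge0.
- by rewrite nnegrE; apply: addr_ge0; apply: mulr_ge0; rewrite ?omega_ge0 ?subr_ge0.
- exact: omb.
Qed.

(** The trapezoid rule for a convex function of b^2, with 2 b db as the measure. *)
Lemma moment_trapezoid x y : 0 <= x -> x < y -> y <= 1 ->
  segint fL x y <= (hh x + hh y) / 2 * ((y ^+ 2 - x ^+ 2) / 2).
Proof.
move=> x0 xy y1.
have D0 : 0 < y ^+ 2 - x ^+ 2.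
  by rewrite subr_gt0 ltr_pXn2r // nnegrE //; apply: ltW; exact: le_lt_trans xy.
pose c1 := (hh y - hh x) / (y ^+ 2 - x ^+ 2).
pose c0 := hh x - c1 * x ^+ 2.
have -> : (hh x + hh y) / 2 * ((y ^+ 2 - x ^+ 2) / 2) = segint (fun b => (c0 + c1 * b ^+ 2) * b) x y.
  rewrite segint_poly // /c0 /c1; move: (hh x) (hh y) => *; by field; rewrite gt_eqF.
apply: segint_le; first exact: cont_moment.
  apply: contM; last exact: cont_id.
  apply: contD; first exact: cont_cst.
  by apply: contM; [exact: cont_cst|exact: exprn_continuous].
move=> b xb b_y; rewrite momentE; apply: ler_wpM2r; first exact: le_trans xb.
apply: (le_trans (hweight_chord x0 xy y1 xb b_y)).
by rewrite /c0 -/c1 le_eqVlt; apply/orP; left; apply/eqP; ring.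
Qed.

(** On [x, 1] the weight is at most its value at x. *)
Lemma moment_tail x : 0 <= x -> x < 1 -> segint fL x 1 <= hh x * ((1 - x ^+ 2) / 2).
Proof.
move=> x0 x1.
have -> : hh x * ((1 - x ^+ 2) / 2) = segint (fun b => (hh x + 0 * b ^+ 2) * b) x 1.
  by rewrite segint_poly // expr1n mul0r addr0.
apply: segint_le; first exact: cont_moment.
  apply: contM; last exact: cont_id.
  apply: contD; first exact: cont_cst.
  by apply: contM; [exact: cont_cst|exact: exprn_continuous].
move=> b xb b1; rewrite momentE mul0r addr0.
have b0 := le_trans x0 xb.
apply: ler_wpM2r; first exact: b0.
by apply: hweight_le; rewrite !ger0_norm.
Qed.

Lemma lerN10 : -1 <= 0 :> R. Proof. lra. Qed.

Lemma chebyshev2 (h1 h2 B1 B2 T : R) : 0 <= h2 -> h2 <= h1 -> B2 <= B1 ->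
  T <= B1 + B2 -> (h1 + h2) / 2 * T <= h1 * B1 + h2 * B2.
Proof.
move=> h20 h21 B21 TB.
have k1 : (h1 + h2) / 2 * T <= (h1 + h2) / 2 * (B1 + B2) by apply: ler_wpM2l => //; lra.
have k2 : 0 <= (h1 - h2) * (B1 - B2) by apply: mulr_ge0; rewrite subr_ge0.
lra.
Qed.

(** For r < 1 the function z decreases through r at b1 and through -r at b2, with
    |b1| < b2 because b1 + b2 = s (height b1 + height b2) > 0.  The contribution of
    the part of S symmetric about 0 cancels, and the trapezoid rule and
    Chebyshev's inequality compare the rest with the boundary terms. *)
Lemma avg_hinge_touches_small r s : 0 < s -> 0 < r -> r < 1 ->
  touches_below (fun u => Gam r (Num.sqrt u)) (s ^+ 2).
Proof.
move=> s0 r0 r1.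
have n11 : (-1 : R) <= 1 by lra.
have nrr : - r <= r by lra.
have nr_r : - r < r by lra.
have r1' : r <= 1 by exact: ltW.
have aux c1 c2 y1 y2 : c1 * s - y1 = r -> c2 * s - y2 = - r -> s * (c1 + c2) = y1 + y2.
  by move=> h1 h2; lra.
have sub c y : 0 < y + c -> - c < y by lra.
have I1 : Num.min (zz s (-1)) (zz s 1) <= r <= Num.max (zz s (-1)) (zz s 1).
  rewrite zcurve_N1 zcurve_1 ge_min le_max; apply/andP; split; apply/orP; [right|left]; lra.
have [b1] := IVT n11 (continuous_subspaceT (@cz s)) I1.
rewrite in_itv /= => /andP[b1l b1r] Z1.
have b1m : -1 < b1.
  by rewrite lt_neqAle b1l andbT; apply/eqP => E; move: Z1; rewrite -E zcurve_N1; lra.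
have I2 : Num.min (zz s b1) (zz s 1) <= - r <= Num.max (zz s b1) (zz s 1).
  rewrite Z1 zcurve_1 ge_min le_max; apply/andP; split; apply/orP; [right|left]; lra.
have [b2] := IVT b1r (continuous_subspaceT (@cz s)) I2.
rewrite in_itv /= => /andP[b2l b2r] Z2.
have b12 : b1 < b2.
  by rewrite lt_neqAle b2l andbT; apply/eqP => E; move: Z2; rewrite -E Z1; lra.
have b2m : b2 < 1.
  by rewrite lt_neqAle b2r andbT; apply/eqP => E; move: Z2; rewrite E zcurve_1; lra.
have n1 : `|b1| < 1 by rewrite ltr_norml b1m /=; exact: lt_trans b2m.
have n2 : `|b2| < 1 by rewrite ltr_norml b2m andbT; exact: lt_trans b12.
have a1 := height_gt0 q0 n1; have a2 := height_gt0 q0 n2.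
have nb12 : `|b1| < b2.
  have := mulr_gt0 s0 (addr_gt0 a1 a2).
  rewrite (aux _ _ _ _ Z1 Z2) => h.
  by rewrite ltr_norml b12 andbT; apply: sub.
have Z1' : height q b1 * s - b1 = r by exact: Z1.
have Z2' : b2 - height q b2 * s = r by rewrite -[r]opprK -Z2 /zcurve opprB.
have [D1 D2 T] := boundary_term_trapezoid q0 q1 s0 (ltW r0) b1m b2m nb12 Z1' Z2'.
have b20 : 0 <= b2 by apply: le_trans (ltW nb12).
have nn : `|b1| <= `|b2| by rewrite (ger0_norm b20) ltW.
have BB := boundary_term_anti q0 s0 (ltW r0) n1 n2 (ltW b12) nn D1.
have HH := hweight_le nn.
pose v1 := height q b1 / (2 * s * (1 + s * slope q b1)).
pose v2 := height q b2 / (2 * s * (1 + s * slope q b2)).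
have den (y : R) : 0 < 1 + s * y -> 2 * s * (1 + s * y) != 0.
  by move=> h; rewrite gt_eqF // !mulr_gt0.
apply: (@touch_of_boundary _ q g q0 g1 r s s0 (-1) b1 b2 v1 v2 (lexx _) b1m b12 b2r).
- by split; [rewrite /v1 (divfK (den _ D1))|exact: n1|exact: Z1].
- by right; split; [rewrite /v2 (divfK (den _ D2))|exact: n2|exact: Z2].
- by move=> b h1 h2; move: (lt_le_trans h1 h2); rewrite ltxx.
- move=> b; rewrite le_eqVlt => /predU1P[<- _|h1].
    by rewrite zcurve_N1; apply: sqr_ge_of; apply: ltW.
  rewrite le_eqVlt => /predU1P[->|h2]; first by rewrite Z1.
  apply: sqr_ge_of; first exact: ltW.
  apply: (zcurve_qconcave s0 (lexx _) h1 h2 b1r); last by rewrite Z1.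
  by rewrite zcurve_N1 ltW.
- move=> b h1 h2; apply: sqr_le_of.
    move: h1; rewrite le_eqVlt => /predU1P[<-|h1]; first by rewrite Z1.
    move: h2; rewrite le_eqVlt => /predU1P[->|h2]; first by rewrite Z2.
    apply: (zcurve_qconcave s0 b1l h1 h2 b2r); last by rewrite Z2.
    by rewrite Z1.
  move: h1; rewrite le_eqVlt => /predU1P[<-|h1]; first by rewrite Z1.
  rewrite leNgt; apply/negP => h3.
  (* z(b) > r would, by quasi-concavity on [-1, b], give z(b1) > r. *)
  pose k := Num.min 1 (zz s b).
  have : k <= zz s b1.
    apply: (zcurve_qconcave s0 (lexx _) b1m h1 (le_trans h2 b2r)).
      by rewrite zcurve_N1 ge_min lexx.
    by rewrite ge_min lexx orbT.
  by rewrite Z1 leNgt lt_min r1 h3.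
- move=> b; rewrite le_eqVlt => /predU1P[<- _|h1 h2]; first by rewrite Z2 sqrrN.
  apply: sqr_ge_ofN; first exact: ltW.
  rewrite leNgt; apply/negP => h3.
  (* z(b) > - r would, by quasi-concavity on [b1, b], give z(b2) > - r. *)
  pose k := Num.min r (zz s b).
  have : k <= zz s b2.
    apply: (zcurve_qconcave s0 b1l b12 h1 (ltW h2)).
      by rewrite Z1 ge_min lexx.
    by rewrite ge_min lexx orbT.
  by rewrite Z2 leNgt lt_min h3 andbT nr_r.
- have E : 2 * r * s ^+ 2 * (v1 * hh b1 + v2 * hh b2) =
      hh b1 * boundary_term q s r b1 + hh b2 * boundary_term q s r b2.
    rewrite /v1 /v2 /boundary_term.
    move: (slope q b1) (slope q b2) (height q b1) (height q b2) (hh b1) (hh b2) D1 D2 =>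
      y1 y2 c1 c2 h1 h2 D1 D2.
    by field; rewrite !gt_eqF.
  rewrite E segint_xx moment_1 (moment_even (ltW b1m) b1r).
  have M := moment_split (le_trans lerN10 (normr_ge0 b1)) (ltW nb12).
  have := moment_trapezoid (normr_ge0 b1) nb12 b2r.
  rewrite -M (real_normK (num_real b1)) /hweight omega_norm -/(hweight q g b1) -/(hweight q g b2).
  move=> K; have C := chebyshev2 (hweight_ge0 b2) HH BB T.
  have := le_trans K C.
  move: (_ * _ + _ * _) (PL b2) (PL `|b1|) => X Y1 Y2.
  have -> : X + (Y2 - 0 + (0 - Y1)) = X - (Y1 - Y2) by ring.
  by rewrite subr_ge0.
Qed.

(** For r >= 1 the inequality z^2 > r^2 forces z > r.  If this never happens the
    average is 0, its least value.  Otherwise it happens between two points e0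
    and b1; the end e0 may be kept fixed, as the integral of the odd moment up to
    e0 has the favourable sign. *)
Lemma avg_hinge_touches_large r s : 0 < s -> 1 <= r ->
  touches_below (fun u => Gam r (Num.sqrt u)) (s ^+ 2).
Proof.
move=> s0 r1.
have n11 : (-1 : R) <= 1 by lra.
have r0 : 0 < r by lra.
have nr1 : - r <= -1 by lra.
have n1r : -1 < r by lra.
have [[bs [bs1 bs2 Zs]]|none] := pselect (exists b, [/\ -1 <= b, b <= 1 & r < zz s b]); last first.
  have le b : -1 <= b -> b <= 1 -> zz s b <= r.
    by move=> h1 h2; rewrite leNgt; apply/negP => h; apply: none; exists b.
  have G0 : Gam r (Num.sqrt (s ^+ 2)) = 0.
    rewrite sqrtr_sqr gtr0_norm // /avg_hinge.
    have -> : segint (fun b => rho b * hinge r (zz s b)) (-1) 1 = segint (fun b => 0 * rho b) (-1) 1.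
      apply: eq_segint => b h1 h2; rewrite /hinge max_l ?mulr0 ?mul0r // subr_le0.
      by apply: sqr_le_of; [exact: le_trans nr1 (zcurve_geN1 s0 h1 h2)|exact: le].
    by rewrite segintZ ?mul0r //; exact: cont_weight.
  exists (fun=> 0), (fun=> 0), 0; split.
  - by near=> t; exact: is_derive_cst.
  - exact: is_derive_cst.
  - exact: lexx.
  - by rewrite G0.
  - near=> t; apply: segint_ge0 => b _ _.
    by apply: mulr_ge0; [exact: weight_ge0|exact: hinge_ge0].
have bsm : -1 < bs.
  by rewrite lt_neqAle bs1 andbT; apply/eqP => E; move: Zs; rewrite -E zcurve_N1 ltNge r1.
have bsM : bs < 1.
  rewrite lt_neqAle bs2 andbT; apply/eqP => E; move: Zs; rewrite E zcurve_1 => h.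
  by have := lt_trans h n1r; rewrite ltxx.
have I0 : Num.min (zz s (-1)) (zz s bs) <= r <= Num.max (zz s (-1)) (zz s bs).
  by rewrite zcurve_N1 ge_min le_max r1 (ltW Zs) orbT.
have I1 : Num.min (zz s bs) (zz s 1) <= r <= Num.max (zz s bs) (zz s 1).
  by rewrite zcurve_1 ge_min le_max (ltW n1r) (ltW Zs) orbT.
have [e0] := IVT bs1 (continuous_subspaceT (@cz s)) I0.
rewrite in_itv /= => /andP[e0l e0r] Z0.
have [b1] := IVT bs2 (continuous_subspaceT (@cz s)) I1.
rewrite in_itv /= => /andP[b1l b1r] Z1.
have e0s : e0 < bs.
  by rewrite lt_neqAle e0r andbT; apply/eqP => E; move: Zs; rewrite -E Z0 ltxx.
have sb1 : bs < b1.
  by rewrite lt_neqAle b1l andbT; apply/eqP => E; move: Zs; rewrite E Z1 ltxx.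
have b1M : b1 < 1.
  by rewrite lt_neqAle b1r andbT; apply/eqP => E; move: n1r; rewrite -Z1 E zcurve_1 ltxx.
have b1m : -1 < b1 by exact: lt_trans bsm sb1.
have n1 : `|b1| < 1 by rewrite ltr_norml b1m.
have [c [bc cb c1 Ec]] := zcurve_MVT s0 bs1 sb1 b1r.
have D1 : 0 < 1 + s * slope q b1.
  have : - (1 + s * slope q c) * (b1 - bs) < 0 by rewrite -Ec Z1 subr_lt0.
  rewrite pmulr_llt0 ?subr_gt0 // oppr_lt0 => h; apply: (lt_le_trans h).
  by rewrite lerD2l; apply: ler_wpM2l; [exact: ltW|apply: (slope_le q0 c1 n1); exact: ltW].
have Z1' : height q b1 * s - b1 = r by exact: Z1.
have B := boundary_term_large q0 s0 r1 n1 Z1' D1.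
pose v1 := height q b1 / (2 * s * (1 + s * slope q b1)).
have den (y : R) : 0 < 1 + s * y -> 2 * s * (1 + s * y) != 0.
  by move=> h; rewrite gt_eqF // !mulr_gt0.
have e0b1 := lt_trans e0s sb1.
apply: (@touch_of_boundary _ q g q0 g1 r s s0 e0 b1 1 v1 0 e0l e0b1 b1M (lexx _)).
- by split; [rewrite /v1 (divfK (den _ D1))|exact: n1|exact: Z1].
- by left.
- move=> b h1 h2; have b1' : b <= 1 by exact: le_trans h2 (le_trans e0r bs2).
  apply: sqr_le_of; first exact: le_trans nr1 (zcurve_geN1 s0 (ltW h1) b1').
  move: h2; rewrite le_eqVlt => /predU1P[->|h2]; first by rewrite Z0.
  rewrite leNgt; apply/negP => h3.
  (* z > r at b and at bs would give z(e0) > r. *)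
  pose k := Num.min (zz s b) (zz s bs).
  have : k <= zz s e0.
    apply: (zcurve_qconcave s0 (ltW h1) h2 e0s bs2).
      by rewrite ge_min lexx.
    by rewrite ge_min lexx orbT.
  by rewrite Z0 leNgt lt_min h3 Zs.
- move=> b; rewrite le_eqVlt => /predU1P[<- _|h1]; first by rewrite Z0.
  rewrite le_eqVlt => /predU1P[->|h2]; first by rewrite Z1.
  apply: sqr_ge_of; first exact: ltW.
  by apply: (zcurve_qconcave s0 e0l h1 h2 b1r); rewrite ?Z0 ?Z1.
- move=> b h1 h2; have bm : -1 <= b by exact: le_trans (ltW b1m) h1.
  apply: sqr_le_of; first exact: le_trans nr1 (zcurve_geN1 s0 bm h2).
  move: h1; rewrite le_eqVlt => /predU1P[<-|h1]; first by rewrite Z1.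
  rewrite leNgt; apply/negP => h3.
  (* z > r at bs and at b would give z(b1) > r. *)
  pose k := Num.min (zz s bs) (zz s b).
  have : k <= zz s b1.
    apply: (zcurve_qconcave s0 bs1 sb1 h1 h2).
      by rewrite ge_min lexx.
    by rewrite ge_min lexx orbT.
  by rewrite Z1 leNgt lt_min h3 Zs.
- by move=> b h1 h2; move: (le_lt_trans h1 h2); rewrite ltxx.
- have E : 2 * r * s ^+ 2 * (v1 * hh b1 + 0 * hh 1) = hh b1 * boundary_term q s r b1.
    rewrite /v1 /boundary_term.
    move: (slope q b1) (height q b1) (hh b1) D1 => y1 c1' h1 D1'.
    by field; rewrite !gt_eqF.
  rewrite E (moment_1) subrr addr0 (moment_even (ltW b1m) b1r).
  have M := moment_split (le_trans lerN10 (normr_ge0 b1)) (ltW n1).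
  have := moment_tail (normr_ge0 b1) n1.
  rewrite -M moment_1 sub0r (real_normK (num_real b1)) /hweight omega_norm -/(hweight q g b1).
  have L0 := moment_le0 e0l (le_trans e0r bs2).
  have := ler_wpM2l (hweight_ge0 b1) B.
  move: (hh b1 * boundary_term q s r b1) (PL `|b1|) (PL e0) L0 (hh b1 * _) => X Y1 Y2 L0 W.
  move=> k1 k2.
  have -> : X + (Y1 - Y2) = (X - - Y1) + - Y2 by ring.
  apply: addr_ge0; last by rewrite oppr_ge0.
  by rewrite subr_ge0; apply: le_trans k2 k1.
Unshelve. all: by end_near. Qed.

(** The weight is even, so the integrand may be averaged over b and -b; the two
    squares (A - b)^2 and (A + b)^2 have a mean at least b^2. *)
Lemma avg_hinge_ge_at0 r s : Gam r 0 <= Gam r s.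
Proof.
pose F b := rho b * hinge r (zz s b).
have cF : continuous F by exact: cont_weight_hinge.
have FN : Gam r s = segint (fun b => F (- b)) (-1) 1.
  have n11 : (-1 : R) <= 1 by lra.
  by have := segint_reflect cF n11; rewrite opprK.
have cFN : continuous (fun b => F (- b)).
  by move=> b; apply: continuous_comp; [exact: opp_continuous|exact: cF].
have c0 : continuous (fun b => rho b * hinge r (zz 0 b)) by exact: cont_weight_hinge.
have H : segint (fun b => 2 * (rho b * hinge r (zz 0 b))) (-1) 1 <= segint (fun b => F b + F (- b)) (-1) 1.
  apply: segint_le; [by apply: contM; [exact: cont_cst|exact: c0]|exact: contD|].
  move=> b _ _; rewrite /F /weight omegaN mulrCA -mulrDr; apply: ler_wpM2l; first exact: weight_ge0.
  rewrite /zcurve heightN /hinge mulr0 sub0r opprK sqrrN.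
  move: (height q b * s) => A.
  have [h|h] := leP (b ^+ 2 - r ^+ 2) 0.
    by rewrite mulr0 addr_ge0 // le_max lexx.
  have h1 : (A - b) ^+ 2 - r ^+ 2 <= Num.max 0 ((A - b) ^+ 2 - r ^+ 2) by rewrite le_max lexx orbT.
  have h2 : (A + b) ^+ 2 - r ^+ 2 <= Num.max 0 ((A + b) ^+ 2 - r ^+ 2) by rewrite le_max lexx orbT.
  have h3 : 0 <= A ^+ 2 by exact: sqr_ge0.
  apply: (le_trans _ (lerD h1 h2)); lra.
have E1 : segint (fun b => F b + F (- b)) (-1) 1 = 2 * Gam r s.
  by rewrite segintD // -FN mulr_natl mulr2n.
have E2 : segint (fun b => 2 * (rho b * hinge r (zz 0 b))) (-1) 1 = 2 * Gam r 0.
  by rewrite segintZ.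
by move: H; rewrite E1 E2 ler_pM2l.
Qed.

Lemma hinge_lip r x y : hinge r x - hinge r y <= `|x ^+ 2 - y ^+ 2|.
Proof.
rewrite /hinge lerBlDr ge_max addr_ge0 //=; last by rewrite le_max lexx.
have h : y ^+ 2 - r ^+ 2 <= Num.max 0 (y ^+ 2 - r ^+ 2) by rewrite le_max lexx orbT.
have h' := ler_norm (x ^+ 2 - y ^+ 2); lra.
Qed.

Lemma avg_hinge_lip r s t : Gam r s - Gam r t <= 2 * (`|s - t| * (`|s + t| + 2)).
Proof.
pose K := `|s - t| * (`|s + t| + 2).
have K0 : 0 <= K by apply: mulr_ge0 => //; rewrite addr_ge0.
have cs := @cont_weight_hinge R q g q0 g1 r s.
have ct := @cont_weight_hinge R q g q0 g1 r t.
have cK : continuous (fun _ : R => K) by exact: cont_cst.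
have H : Gam r s <= segint (fun b => rho b * hinge r (zz t b) + K) (-1) 1.
  apply: segint_le => //; first exact: contD.
  move=> b b1 b2.
  have h0 := weight_ge0 (q := q) (g := g) b.
  have h1 := weight_le1 (q := q) g1 b.
  have h2 := hinge_lip r (zz s b) (zz t b).
  have h3 : `|zz s b ^+ 2 - zz t b ^+ 2| <= K.
    have a0 := height_ge0 (q := q) b; have a1 := height_le1 q0 b.
    have -> : zz s b ^+ 2 - zz t b ^+ 2 = height q b * ((s - t) * (height q b * (s + t) - 2 * b)).
      by rewrite /zcurve; move: (height q b) => *; ring.
    move: (height q b) a0 a1 => a a0 a1.
    rewrite normrM (ger0_norm a0) normrM.
    have e1 : `|a * (s + t) - 2 * b| <= `|s + t| + 2.
      apply: (le_trans (ler_normB _ _)); apply: lerD.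
        by rewrite normrM (ger0_norm a0); apply: ler_piMl.
      by rewrite normrM ger0_norm // ler_piMr // ler_norml b1.
    have e2 : `|s - t| * `|a * (s + t) - 2 * b| <= K by apply: ler_wpM2l.
    apply: (le_trans _ e2); apply: ler_piMl => //; exact: mulr_ge0.
  have h4 : hinge r (zz s b) <= hinge r (zz t b) + K.
    by rewrite -lerBlDl; apply: le_trans h2 h3.
  apply: (le_trans (ler_wpM2l h0 h4)); rewrite mulrDr lerD2l.
  exact: ler_piMl.
have E : segint (fun _ : R => K) (-1) 1 = 2 * K.
  rewrite /segint Rintegral_cst //= lebesgue_measure_itv /= lte_fin.
  have -> : (-1 < 1 :> R) = true by lra.
  by rewrite -EFinB /=; ring.
by move: H; rewrite segintD // E -lerBlDl.
Qed.

Lemma continuous_avg_hinge r : continuous (Gam r).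
Proof.
move=> t.
have c : (fun s : R => 2 * (`|s - t| * (`|s + t| + 2))) @ t --> 2 * (`|t - t| * (`|t + t| + 2)).
  apply: cvgMr; apply: cvgM.
    by apply: cvg_norm; apply: cvgB; [exact: cvg_id|exact: cvg_cst].
  apply: cvgD; last exact: cvg_cst.
  by apply: cvg_norm; apply: cvgD; [exact: cvg_id|exact: cvg_cst].
rewrite subrr normr0 mul0r mulr0 in c.
apply/cvgrPdist_lt => e e0; near=> s.
have h1 := avg_hinge_lip r s t; have h2 := avg_hinge_lip r t s.
rewrite distrC (addrC t s) in h2.
have h3 : 2 * (`|s - t| * (`|s + t| + 2)) < e by near: s; exact: (cvgr_lt _ c).
rewrite ltr_norml; apply/andP; split.
  by rewrite ltrNl opprB; exact: le_lt_trans h1 h3.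
exact: le_lt_trans h2 h3.
Unshelve. all: by end_near. Qed.

(** For u <= 0 the square root is 0, and the constant touching function is
    admissible because s = 0 minimises the average. *)
Lemma avg_hinge_convex r : 0 < r ->
  convex_function setT ((fun u => Gam r (Num.sqrt u)) : R^o -> R^o).
Proof.
move=> r0; apply: touches_below_convex.
  by move=> u; apply: continuous_comp; [exact: sqrt_continuous|exact: continuous_avg_hinge].
move=> u; have [u0|u0] := ltP 0 u.
  rewrite -(sqr_sqrtr (ltW u0)).
  have s0 : 0 < Num.sqrt u by rewrite sqrtr_gt0.
  by have [r1|r1] := ltP r 1; [exact: avg_hinge_touches_small|exact: avg_hinge_touches_large].
exists (fun=> Gam r 0), (fun=> 0), 0; split.
- by near=> t; exact: is_derive_cst.
- exact: is_derive_cst.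
- exact: lexx.
- by rewrite ler0_sqrtr.
- by near=> t; exact: avg_hinge_ge_at0.
Unshelve. all: by end_near. Qed.

End hinge_convexity.

Section two_parameter.
Context {R : realType}.
Context {q g : R} (q0 : 0 < q) (q1 : q <= 1) (g1 : 1 <= g).
Implicit Types (c r y b : R).
Let g0 : 0 < g. Proof. exact: lt_le_trans g1. Qed.

(** The average with a general factor c; for c = 1 it is [avg_hinge], and c = 0 is
    allowed. *)
Definition beta_avg (q g c r y : R) : R :=
  segint (fun b => weight q g b * hinge r (height q b * y - c * b)) (-1) 1.
Local Notation Gc := (beta_avg q g).

Lemma continuous_beta_integrand c r y :
  continuous (fun b => weight q g b * hinge r (height q b * y - c * b)).
Proof.
apply: contM; first exact: cont_weight.
move=> b; apply: (@continuous_comp _ _ _ (fun b => height q b * y - c * b) (hinge r)); last exact: cont_hinge.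
by apply: contB; apply: contM; [exact: continuous_height|exact: cont_cst|exact: cont_cst|exact: cont_id].
Qed.

(** The reflection b |-> - b, that is the symmetry of the Rademacher sign. *)
Lemma beta_avg_even c r y : Gc c r (- y) = Gc c r y.
Proof.
have n11 : (-1 : R) <= 1 by lra.
have := segint_reflect (@continuous_beta_integrand c r (- y)) n11.
rewrite opprK /beta_avg => ->.
apply: eq_segint => b _ _; rewrite /weight omegaN heightN /hinge; congr (_ * Num.max 0 (_ - _)).
by rewrite -sqrrN; congr (_ ^+ 2); ring.
Qed.

Lemma beta_avg_norm c r y : Gc c r `|y| = Gc c r y.
Proof. by have [y0|y0] := leP 0 y; [rewrite ger0_norm|rewrite ltr0_norm // beta_avg_even]. Qed.

Lemma beta_avg_ge0 c r y : 0 <= Gc c r y.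
Proof. by apply: segint_ge0 => b _ _; apply: mulr_ge0; [exact: weight_ge0|exact: hinge_ge0]. Qed.

Lemma hinge_scale c r z : 0 < c -> hinge r (c * z) = c ^+ 2 * hinge (r / c) z.
Proof.
move=> c0; rewrite /hinge maxr_pMr ?mulr0 ?sqr_ge0 //; congr (Num.max 0 _).
by field; rewrite gt_eqF.
Qed.

Lemma beta_avg_scale c r y : 0 < c -> Gc c r y = c ^+ 2 * avg_hinge q g (r / c) (y / c).
Proof.
move=> c0; rewrite /avg_hinge -segintZ; last exact: cont_weight_hinge.
apply: eq_segint => b _ _.
have -> : height q b * y - c * b = c * zcurve q (y / c) b.
  by rewrite /zcurve; move: (height q b) => a; field; rewrite gt_eqF.
by rewrite hinge_scale // mulrCA.
Qed.

Lemma sqrt_convex (a k x y t : R) : 0 <= a -> 0 <= k -> 0 <= t -> t <= 1 ->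
  Num.max 0 (a * Num.max 0 (t * x + (1 - t) * y) - k) <=
  t * Num.max 0 (a * Num.max 0 x - k) + (1 - t) * Num.max 0 (a * Num.max 0 y - k).
Proof.
move=> a0 k0 t0 t1; have t1' : 0 <= 1 - t by rewrite subr_ge0.
have mx (z w : R) : z <= Num.max w z by rewrite le_max lexx orbT.
have mp (z : R) : 0 <= Num.max 0 z by rewrite le_max lexx.
have h : Num.max 0 (t * x + (1 - t) * y) <= t * Num.max 0 x + (1 - t) * Num.max 0 y.
  rewrite ge_max; apply/andP; split; first by rewrite addr_ge0 // mulr_ge0.
  by apply: lerD; apply: ler_wpM2l.
rewrite ge_max; apply/andP; split; first by rewrite addr_ge0 // mulr_ge0.
have h1 := ler_wpM2l t0 (mx (a * Num.max 0 x - k) 0).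
have h2 := ler_wpM2l t1' (mx (a * Num.max 0 y - k) 0).
have h3 := ler_wpM2l a0 h.
apply: (le_trans _ (lerD h1 h2)).
move: (Num.max 0 x) (Num.max 0 y) (Num.max 0 (_ + _)) h3 => X Y Z h3; lra.
Qed.

(** For c > 0 the average is a rescaling of [avg_hinge].  For c = 0 the integrand
    is, for each b, already a convex function of u. *)
Lemma beta_avg_convex c r : 0 <= c -> 0 < r ->
  convex_function setT ((fun u => Gc c r (Num.sqrt u)) : R^o -> R^o).
Proof.
rewrite le_eqVlt => /predU1P[<- r0|c0 r0]; last first.
  have rc : 0 < r / c by rewrite divr_gt0.
  have K := convex_functionE (avg_hinge_convex q0 q1 g1 rc).
  have E u : Gc c r (Num.sqrt u) = c ^+ 2 * avg_hinge q g (r / c) (Num.sqrt (u / c ^+ 2)).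
    rewrite beta_avg_scale //; congr (_ * avg_hinge _ _ _ _).
    rewrite [in RHS]mulrC -exprVn sqrtrM ?sqr_ge0 // sqrtr_sqr ger0_norm ?invr_ge0 ?(ltW c0) //.
    by rewrite mulrC.
  apply: convex_functionP => x y t t0 t1 _; rewrite !E.
  have -> : (t * x + (1 - t) * y) / c ^+ 2 = t * (x / c ^+ 2) + (1 - t) * (y / c ^+ 2) by ring.
  apply: (le_trans (ler_wpM2l (sqr_ge0 c) (K _ _ _ (ltW t0) (ltW t1)))).
  by rewrite le_eqVlt; apply/orP; left; apply/eqP; ring.
apply: convex_functionP => x y t t0 t1 _.
have c1 z k : continuous (fun b => k * (weight q g b * hinge r (height q b * Num.sqrt z - 0 * b))).
  by apply: contM; [exact: cont_cst|exact: continuous_beta_integrand].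
rewrite /beta_avg -!segintZ; try exact: continuous_beta_integrand.
rewrite -segintD //.
apply: segint_le => [||b _ _]; [exact: continuous_beta_integrand|exact: contD|].
have h := weight_ge0 (q := q) (g := g) b.
have E z : hinge r (height q b * Num.sqrt z - 0 * b) = Num.max 0 (height q b ^+ 2 * Num.max 0 z - r ^+ 2).
  rewrite /hinge mul0r subr0 exprMn; congr (Num.max 0 (_ * _ - _)).
  have [z0|z0] := leP 0 z; first by rewrite sqr_sqrtr.
  by rewrite ler0_sqrtr ?expr0n // ltW.
rewrite !E.
have := sqrt_convex x y (sqr_ge0 (height q b)) (sqr_ge0 r) (ltW t0) (ltW t1).
move=> /(ler_wpM2l h) /le_trans; apply.
by rewrite le_eqVlt; apply/orP; left; apply/eqP; ring.
Qed.

(** The cross term of the square has an odd integrand. *)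
Lemma beta_avg_quadratic c : exists A C : R, forall y, Gc c 0 y = A * y ^+ 2 + C.
Proof.
pose fA b := weight q g b * (height q b * height q b).
pose fC b := weight q g b * (b * b).
have cA : continuous fA by apply: contM; [exact: cont_weight|apply: contM; exact: continuous_height].
have cC : continuous fC by apply: contM; [exact: cont_weight|apply: contM; exact: cont_id].
have cL : continuous (moment q g) by exact: cont_moment.
exists (segint fA (-1) 1), (c ^+ 2 * segint fC (-1) 1) => y.
have -> : Gc c 0 y =
    segint (fun b => (y ^+ 2 * fA b + (- (2 * c * y)) * moment q g b) + c ^+ 2 * fC b) (-1) 1.
  apply: eq_segint => b _ _; rewrite /hinge expr0n subr0 max_r ?sqr_ge0 //.
  by rewrite /fA /fC /moment; move: (weight q g b) (height q b) => u v; ring.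
rewrite segintD; [|by apply: contD; apply: contM => //; exact: cont_cst
  |by apply: contM => //; exact: cont_cst].
rewrite segintD; [|by apply: contM => //; exact: cont_cst..].
rewrite segintZ // segintZ // segintZ // (moment_1 q0 g1); ring.
Qed.

End two_parameter.

(** * Hinges determine the convex order of nonnegative variables *)

Section subgradient.
Context {R : realType}.
Variable Phi : R -> R.
Hypothesis cPhi : convex_function setT (Phi : R^o -> R^o).
Implicit Types (x y z : R).

Lemma convex_slopes z x y : z < x -> x < y ->
  (Phi x - Phi z) / (x - z) <= (Phi y - Phi x) / (y - x).
Proof.
move=> zx xy.
have zx0 : 0 < x - z by rewrite subr_gt0.
have xy0 : 0 < y - x by rewrite subr_gt0.
have zy0 : 0 < y - z by rewrite subr_gt0; exact: lt_trans xy.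
pose t := (y - x) / (y - z).
have t0 : 0 <= t by rewrite divr_ge0 // ltW.
have t1 : t <= 1 by rewrite ler_pdivrMr // mul1r lerD2l lerN2 ltW.
have := convex_functionE cPhi z y t0 t1.
have -> : t * z + (1 - t) * y = x by rewrite /t; field; rewrite gt_eqF.
move=> H.
have H' : (y - z) * Phi x <= (y - x) * Phi z + (x - z) * Phi y.
  have -> : (y - x) * Phi z + (x - z) * Phi y = (y - z) * (t * Phi z + (1 - t) * Phi y).
    by rewrite /t; field; rewrite gt_eqF.
  by rewrite ler_wpM2l // ltW.
rewrite ler_pdivrMr // mulrAC ler_pdivlMr //; lra.
Qed.

(** The supremum of the slopes to the left of x serves as subgradient at x; it is
    finite because the slopes to the right of x bound them. *)
Lemma convex_subgradient : exists m : R -> R, forall x y, Phi x + m x * (y - x) <= Phi y.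
Proof.
pose S x := [set s | exists2 z, z < x & s = (Phi x - Phi z) / (x - z)].
have ub x y : x < y -> ubound (S x) ((Phi y - Phi x) / (y - x)).
  by move=> xy s [z zx ->]; exact: convex_slopes.
have ne x : S x !=set0.
  by exists ((Phi x - Phi (x - 1)) / (x - (x - 1))); exists (x - 1) => //; rewrite ltrBlDr ltrDl.
have hs x : has_sup (S x).
  split; first exact: ne.
  by exists ((Phi (x + 1) - Phi x) / (x + 1 - x)); apply: ub; rewrite ltrDl.
exists (fun x => sup (S x)) => x y.
have [xy|yx|->] := ltgtP x y; last by rewrite subrr mulr0 addr0.
- have xy0 : 0 < y - x by rewrite subr_gt0.
  have : sup (S x) <= (Phi y - Phi x) / (y - x) by apply: ge_sup; [exact: ne|exact: ub].
  by rewrite ler_pdivlMr // => h; rewrite addrC -lerBrDr.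
- have yx0 : 0 < x - y by rewrite subr_gt0.
  have : (Phi x - Phi y) / (x - y) <= sup (S x).
    by apply: ub_le_sup; [case: (hs x)|exists y].
  rewrite ler_pdivrMr // => h.
  have -> : sup (S x) * (y - x) = - (sup (S x) * (x - y)) by rewrite -mulrN opprB.
  by rewrite lerBlDr -lerBlDl.
Qed.

End subgradient.

Section hinge_approximation.
Context {R : realType}.
Variables (Phi m : R -> R).
Hypothesis sub : forall x y : R, Phi x + m x * (y - x) <= Phi y.
Implicit Types (x y del : R) (k : nat).

Lemma subgradient_nd x y : x <= y -> m x <= m y.
Proof.
rewrite le_eqVlt => /predU1P[->//|xy].
have h1 := sub x y; have h2 := sub y x.
have : 0 <= (m y - m x) * (y - x) by lra.
by rewrite pmulr_lge0 ?subr_gt0 // subr_ge0.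
Qed.

(** The excess over the tangent at 0 of the polygon with slope m (j del) on the
    j-th cell of the grid with mesh del. *)
Definition hinge_sum del k x : R :=
  \sum_(j < k) (m (j.+1%:R * del) - m (j%:R * del)) * Num.max 0 (x - j.+1%:R * del).

Lemma hinge_sum_ge0 del k x : 0 <= del -> 0 <= hinge_sum del k x.
Proof.
move=> d0; apply: sumr_ge0 => j _; apply: mulr_ge0; last by rewrite le_max lexx.
by rewrite subr_ge0; apply: subgradient_nd; rewrite ler_wpM2r // ler_nat.
Qed.

Let P del k x := Phi 0 + m 0 * x + hinge_sum del k x.

Let hsumS del k x : hinge_sum del k.+1 x =
  hinge_sum del k x + (m (k.+1%:R * del) - m (k%:R * del)) * Num.max 0 (x - k.+1%:R * del).
Proof. by rewrite /hinge_sum big_ord_recr. Qed.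

(** Three facts proved together by induction on the number of cells: the polygon
    is below Phi, its last side is straight, and on the cells already covered the
    error is at most the mesh times the total variation of the slope. *)
Let polygon_inv del k : 0 < del ->
  [/\ forall x, 0 <= x -> P del k x <= Phi x,
      forall x y, k%:R * del <= x -> k%:R * del <= y ->
        P del k y - P del k x = m (k%:R * del) * (y - x) &
      forall x, 0 <= x -> x <= k.+1%:R * del -> Phi x - P del k x <= del * (m x - m 0)].
Proof.
move=> d0; elim: k => [|k [I1 I2 I3]].
  rewrite mul0r mul1r; split.
  - by move=> x x0; have := sub 0 x; rewrite /P /hinge_sum big_ord0 subr0 addr0.
  - by move=> x y _ _; rewrite /P /hinge_sum !big_ord0; ring.
  - move=> x x0 xd; rewrite /P /hinge_sum big_ord0 addr0.
    have h1 := sub x 0.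
    have h2 : x * (m x - m 0) <= del * (m x - m 0).
      by apply: ler_wpM2r => //; rewrite subr_ge0 subgradient_nd.
    lra.
have kk : k%:R * del <= k.+1%:R * del by rewrite ler_wpM2r ?ler_nat // ltW.
set a := k.+1%:R * del in kk I3 *.
have a0 : 0 <= a by rewrite mulr_ge0 // ltW.
have PS x : P del k.+1 x = P del k x + (m a - m (k%:R * del)) * Num.max 0 (x - a).
  by rewrite /P hsumS addrA.
have Plo x : x <= a -> P del k.+1 x = P del k x.
  by move=> xa; rewrite PS max_l ?mulr0 ?addr0 // subr_le0.
have Phi' x : a <= x -> P del k.+1 x = P del k a + m a * (x - a).
  move=> ax; rewrite PS max_r ?subr_ge0 //.
  have := I2 a x kk (le_trans kk ax); move: (P _ _ _) (P _ _ _) => A B; lra.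
split.
- move=> x x0; have [xa|/ltW ax] := leP x a; first by rewrite Plo // I1.
  by rewrite Phi' //; apply: le_trans (sub a x); rewrite lerD2r I1.
- by move=> x y ax ay; rewrite !Phi' //; ring.
- move=> x x0 xa2; have [xa|ax] := leP x a; first by rewrite Plo // I3.
  rewrite Phi' ?(ltW ax) //.
  have h0 := I3 a a0 (lexx a); have h1 := sub x a.
  have xad : x - a <= del.
    by move: xa2; rewrite -[k.+2]addn1 natrD mulrDl mul1r -/a lerBlDl.
  have h2 : (x - a) * (m x - m a) <= del * (m x - m a).
    by apply: ler_wpM2r => //; rewrite subr_ge0 subgradient_nd // ltW.
  lra.
Qed.

Lemma hinge_sum_le del k x : 0 < del -> 0 <= x -> hinge_sum del k x <= Phi x - (Phi 0 + m 0 * x).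
Proof. by move=> d0 x0; have [I _ _] := polygon_inv k d0; rewrite lerBrDl; exact: I. Qed.

(** With mesh 1/(n+1) and (n+1)^2 cells the grid eventually covers [0, x], and
    the error is at most (m x - m 0)/(n+1). *)
Lemma hinge_sum_cvg x : 0 <= x ->
  (fun n : nat => hinge_sum n.+1%:R^-1 (n.+1 * n.+1) x) @ \oo --> Phi x - (Phi 0 + m 0 * x).
Proof.
move=> x0; apply/cvgrPdist_lt => e e0.
have K0 : 0 <= m x - m 0 by rewrite subr_ge0 subgradient_nd.
near=> n.
have d0 : (0 : R) < n.+1%:R^-1 by rewrite invr_gt0.
have [_ _ I] := polygon_inv (n.+1 * n.+1) d0.
have L := hinge_sum_le (n.+1 * n.+1) d0 x0.
rewrite ger0_norm ?subr_ge0 //.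
have xn : x <= (n.+1 * n.+1).+1%:R * n.+1%:R^-1.
  rewrite ler_pdivlMr //; apply: (@le_trans _ _ (n.+1%:R * n.+1%:R)).
    rewrite ler_wpM2r //.
    apply: (@le_trans _ _ n%:R); last by rewrite ler_nat.
    by near: n; exact: nbhs_infty_ger.
  by rewrite -natrM ler_nat.
have := I x x0 xn; rewrite /P opprD addrA => h.
apply: (le_lt_trans h).
rewrite mulrC ltr_pdivrMr // mulrC -ltr_pdivrMr //.
apply: (@lt_le_trans _ _ n%:R); last by rewrite ler_nat.
by near: n; exact: nbhs_infty_gtr.
Unshelve. all: by end_near. Qed.

End hinge_approximation.

Section hinge_order.
Context {d : measure_display} {Om : measurableType d} {R : realType}.
Variable P : probability Om R.
Implicit Types (U V W : Om -> R) (Phi : R -> R) (r del : R).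
Local Open Scope ereal_scope.

Let measurable_hinge_sum (m : R -> R) del k U : measurable_fun setT U ->
  measurable_fun setT (fun w => hinge_sum m del k (U w)).
Proof.
move=> mU; rewrite /hinge_sum; apply: measurable_sum => j.
apply: measurable_funM; first exact: measurable_cst.
apply: measurable_maxr; first exact: measurable_cst.
by apply: measurable_funB => //; exact: measurable_cst.
Qed.

Let integral_hinge_sum_le (m : R -> R) del k U V :
  {homo m : x y / (x <= y)%R} -> (0 < del)%R ->
  measurable_fun setT U -> measurable_fun setT V ->
  (forall r, (0 < r)%R -> \int[P]_w (Num.max 0 (U w - r))%:E <= \int[P]_w (Num.max 0 (V w - r))%:E) ->
  \int[P]_w (hinge_sum m del k (U w))%:E <= \int[P]_w (hinge_sum m del k (V w))%:E.
Proof.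
move=> mnd d0 mU mV H.
have mh W r : measurable_fun setT W -> measurable_fun setT (fun w : Om => (Num.max 0 (W w - r))%:E).
  move=> mW; apply/measurable_EFinP; apply: measurable_maxr; first exact: measurable_cst.
  by apply: measurable_funB => //; exact: measurable_cst.
pose c j := (m (j.+1%:R * del) - m (j%:R * del))%R.
have c0 j : (0 <= c j)%R.
  by rewrite subr_ge0; apply: mnd; rewrite ler_wpM2r ?ler_nat // ltW.
have E W : measurable_fun setT W -> \int[P]_w (hinge_sum m del k (W w))%:E =
    \sum_(j < k) (c j)%:E * \int[P]_w (Num.max 0 (W w - j.+1%:R * del))%:E.
  move=> mW; under eq_integral do rewrite /hinge_sum -sumEFin.
  rewrite ge0_integral_sum //.
  - apply: eq_bigr => j _; under eq_integral do rewrite EFinM.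
    rewrite ge0_integralZl //.
    + exact: mh.
    + by move=> w _; rewrite lee_fin le_max lexx.
    + by rewrite lee_fin; exact: c0.
  - move=> j; apply/measurable_EFinP; apply: measurable_funM; first exact: measurable_cst.
    by apply/measurable_EFinP; exact: mh.
  - by move=> j w _; rewrite lee_fin; apply: mulr_ge0; [exact: c0|rewrite le_max lexx].
rewrite !E //; apply: lee_sum => j _.
apply: lee_wpmul2l; first by rewrite lee_fin.
by apply: H; rewrite mulr_gt0.
Qed.

(** Subtract from Phi its tangent at 0, whose mean is the same for U and V.  The
    remaining gap is the limit of sums of hinges that stay below it: Fatou's lemma
    bounds the mean for U, and domination the mean for V.  If the gap of V has an
    infinite mean, so has Phi(V), and there is nothing to prove. *)
Lemma cx_le_hinges U V :
  (U : Om -> R) \in Lfun P 1 -> (V : Om -> R) \in Lfun P 1 ->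
  (forall w, (0 <= U w)%R) -> (forall w, (0 <= V w)%R) ->
  'E_P[U] = 'E_P[V] ->
  (forall r, (0 < r)%R -> \int[P]_w (Num.max 0 (U w - r))%:E <= \int[P]_w (Num.max 0 (V w - r))%:E) ->
  cx_le P U V.
Proof.
move=> LU LV U0 V0 EUV H; split => // Phi cPhi exU exV.
have /Lfun1_integrable iU := LU; have /Lfun1_integrable iV := LV.
have mU : measurable_fun setT U by apply/measurable_EFinP; exact: measurable_int iU.
have mV : measurable_fun setT V by apply/measurable_EFinP; exact: measurable_int iV.
have [m sub] := convex_subgradient cPhi.
pose l x := (Phi 0 + m 0 * x)%R.
pose gap x := (Phi x - l x)%R.
pose D n x := hinge_sum m n.+1%:R^-1 (n.+1 * n.+1) x.
have gap0 x : (0 <= gap x)%R by rewrite subr_ge0; have := sub 0%R x; rewrite subr0.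
have Dn0 n : (0 < (n.+1%:R^-1 : R))%R by rewrite invr_gt0.
have mD n W : measurable_fun setT W -> measurable_fun setT (fun w => (D n (W w))%:E).
  by move=> mW; apply/measurable_EFinP; exact: measurable_hinge_sum.
have Dcvg W : (forall w, (0 <= W w)%R) -> forall w, (D n (W w))%:E @[n --> \oo] --> (gap (W w))%:E.
  by move=> W0 w; apply: cvg_EFin; [by near=> n|exact: (hinge_sum_cvg sub (W0 w))].
have mgap W : measurable_fun setT W -> (forall w, (0 <= W w)%R) ->
    measurable_fun setT (fun w => (gap (W w))%:E).
  move=> mW W0; apply: (emeasurable_fun_cvg (fun n w => (D n (W w))%:E)).
  - by move=> n; exact: mD.
  - by move=> w _; exact: Dcvg.
have fatouU : \int[P]_w (gap (U w))%:E <= \int[P]_w (gap (V w))%:E.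
  have -> : \int[P]_w (gap (U w))%:E = \int[P]_w limn_einf (fun n => (D n (U w))%:E).
    apply: eq_integral => w _; apply/esym.
    by have [-> _] := cvg_limn_einf_sup (Dcvg U U0 w).
  apply: (@le_trans _ _ (limn_einf (fun n => \int[P]_w (D n (U w))%:E))).
    apply: fatou => //.
    - by move=> n; exact: (mD n U mU).
    - by move=> n w _; rewrite lee_fin; apply: (hinge_sum_ge0 sub); exact: ltW.
  have B n : \int[P]_w (D n (U w))%:E <= \int[P]_w (gap (V w))%:E.
    apply: (@le_trans _ _ (\int[P]_w (D n (V w))%:E)).
      by apply: integral_hinge_sum_le => // x y; exact: subgradient_nd.
    apply: ge0_le_integral => //.
    - by move=> w _; rewrite lee_fin; apply: (hinge_sum_ge0 sub); exact: ltW.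
    - exact: (mD n V mV).
    - exact: (mgap V mV V0).
    - by move=> w _; rewrite lee_fin; exact: (hinge_sum_le sub).
  rewrite limn_einf_lim; apply: lime_le; first exact: is_cvg_einfs.
  near=> n; apply: (le_trans _ (B n)).
  by apply: ereal_inf_lbound; exists n => /=.
have il W : P.-integrable setT (EFin \o W) -> P.-integrable setT (EFin \o (l \o W)).
  move=> iW.
  have -> : EFin \o (l \o W) = (fun w => (cst (Phi 0) w)%:E + ((m 0)%:E * (W w)%:E)).
    by apply/funext => w; rewrite /= /l EFinD EFinM.
  apply: integrableD => //; last exact: integrableZl.
  exact: finite_measure_integrable_cst.
have El W : P.-integrable setT (EFin \o W) ->
    \int[P]_w (l (W w))%:E = (Phi 0)%:E + (m 0)%:E * \int[P]_w (W w)%:E.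
  move=> iW; under eq_integral do rewrite /l EFinD EFinM.
  rewrite integralD //; last 2 first.
  - exact: finite_measure_integrable_cst.
  - exact: integrableZl.
  have -> : \int[P]_w (Phi 0)%:E = (Phi 0)%:E.
    rewrite (integral_cst P measurableT) -[RHS]mule1; congr (_ * _).
    exact: probability_setT.
  by rewrite integralZl.
have EUV' : \int[P]_w (l (U w))%:E = \int[P]_w (l (V w))%:E.
  by rewrite !El //; move: EUV; rewrite unlock => ->.
have Phil x : Phi x = (gap x + l x)%R by rewrite /gap subrK.
have EPhi W : P.-integrable setT (EFin \o W) -> P.-integrable setT (fun w => (gap (W w))%:E) ->
    \int[P]_w (Phi (W w))%:E = \int[P]_w (gap (W w))%:E + \int[P]_w (l (W w))%:E.
  move=> iW iG; under eq_integral do rewrite Phil EFinD.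
  by rewrite integralD //; exact: il.
have gapabs W : \int[P]_w `|(gap (W w))%:E| = \int[P]_w (gap (W w))%:E.
  by apply: eq_integral => w _; rewrite gee0_abs // lee_fin.
rewrite unlock /=.
have [fin|inf] := ltP (\int[P]_w (gap (V w))%:E) +oo.
  have iGV : P.-integrable setT (fun w => (gap (V w))%:E).
    by apply/integrableP; split; [exact: (mgap V mV V0)|rewrite gapabs].
  have iGU : P.-integrable setT (fun w => (gap (U w))%:E).
    by apply/integrableP; split; [exact: (mgap U mU U0)|rewrite gapabs (le_lt_trans fatouU)].
  by rewrite !EPhi // EUV' leeD2r.
have mPhi W : measurable_fun setT W -> (forall w, (0 <= W w)%R) ->
    measurable_fun setT (fun w => (Phi (W w))%:E).
  move=> mW W0.
  have -> : (fun w => (Phi (W w))%:E) = (fun w => (gap (W w))%:E + (l (W w))%:E).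
    by apply/funext => w; rewrite Phil EFinD.
  apply: emeasurable_funD; first exact: (mgap W mW W0).
  apply/measurable_EFinP; apply: measurable_funD; first exact: measurable_cst.
  by apply: measurable_funM => //; exact: measurable_cst.
(* The gap of V has an infinite mean and the tangent a finite one. *)
suff -> : \int[P]_w (Phi (V w))%:E = +oo by exact: leey.
rewrite integralE.
have neg : \int[P]_w ((fun w => (Phi (V w))%:E)^\- w) < +oo.
  apply: (@le_lt_trans _ _ (\int[P]_w `|(l (V w))%:E|)).
    apply: ge0_le_integral => //.
    - exact/measurable_funeneg/mPhi.
    - apply: measurableT_comp => //; exact: measurable_int (il V iV).
    - move=> w _; rewrite funenegE ge_max abse_ge0 andbT -EFinN /= lee_fin.
      rewrite Phil opprD; apply: (@le_trans _ _ (- l (V w))%R).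
        by rewrite gerDr oppr_le0.
      by rewrite -normrN ler_norm.
  by have /integrableP[] := il V iV.
have pos : \int[P]_w ((fun w => (Phi (V w))%:E)^\+ w) = +oo.
  apply/eqP; rewrite -leye_eq leNgt; apply/negP => fin.
  have iPhi : P.-integrable setT (fun w => (Phi (V w))%:E).
    apply/integrableP; split; first exact: mPhi.
    under eq_integral do rewrite -/((abse \o (fun w => (Phi (V w))%:E)) _) fune_abse.
    rewrite ge0_integralD //; last 2 first.
    - exact/measurable_funepos/mPhi.
    - exact/measurable_funeneg/mPhi.
    exact: lte_add_pinfty.
  move: inf; rewrite leNgt => /negP; apply.
  have : P.-integrable setT (fun w => (gap (V w))%:E).
    have -> : (fun w => (gap (V w))%:E) = (fun w => (Phi (V w))%:E - (l (V w))%:E).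
      by apply/funext => w; rewrite /gap EFinB.
    by apply: integrableB => //; exact: il.
  by move=> /integrableP[_]; rewrite gapabs.
rewrite pos; move: neg.
by case: (\int[P]_w ((fun w => (Phi (V w))%:E)^\- w)).
Unshelve. all: by end_near. Qed.

End hinge_order.

Section convex_order.
Context {d : measure_display} {Om : measurableType d} {R : realType}.
Variable P : probability Om R.
Implicit Types (U V : Om -> R) (Phi : R -> R).
Local Open Scope ereal_scope.

(** For a nonnegative Phi the expectations always exist. *)
Lemma cx_le_nonneg Phi U V : cx_le P U V ->
  convex_function setT (Phi : R^o -> R^o) -> (forall x, (0 <= Phi x)%R) ->
  \int[P]_w (Phi (U w))%:E <= \int[P]_w (Phi (V w))%:E.
Proof.
move=> [_ _ H] cPhi Phi0.
have ex W : expectation_exists P (Phi \o W).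
  right; suff -> : 'E_P[(Phi \o W)^\-] = 0 by rewrite ltry.
  rewrite unlock; apply: integral0_eq => w _; congr (_%:E).
  by rewrite /funrneg /= max_r // oppr_le0.
by have := H Phi cPhi (ex U) (ex V); rewrite unlock.
Qed.

Lemma integrable_affine U (a b : R) : U \in Lfun P 1 ->
  P.-integrable setT (fun w => (a * U w + b)%:E).
Proof.
move=> /Lfun1_integrable iU.
have -> : (fun w => (a * U w + b)%:E) = (fun w => a%:E * (U w)%:E + (cst b w)%:E).
  by apply/funext => w; rewrite EFinD EFinM.
apply: integrableD => //; first exact: integrableZl.
exact: finite_measure_integrable_cst.
Qed.

(** Both an affine function and its opposite are convex. *)
Lemma cx_le_affine U V (a b : R) : cx_le P U V ->
  \int[P]_w (a * U w + b)%:E = \int[P]_w (a * V w + b)%:E.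
Proof.
suff le a' b' : cx_le P U V ->
    \int[P]_w (a' * U w + b')%:E <= \int[P]_w (a' * V w + b')%:E.
  move=> H; apply/eqP; rewrite eq_le le //=.
  have [LU LV _] := H.
  have opp W : W \in Lfun P 1 ->
      \int[P]_w (- a * W w + - b)%:E = - \int[P]_w (a * W w + b)%:E.
    move=> LW; rewrite -mulN1e -EFinN -integralZl //; last exact: integrable_affine.
    by apply: eq_integral => w _; rewrite -EFinM mulN1r opprD mulNr.
  by have := le (- a)%R (- b)%R H; rewrite (opp U LU) (opp V LV) leeN2.
move=> [LU LV H].
have ex W : W \in Lfun P 1 -> expectation_exists P ((fun x => a' * x + b')%R \o W).
  move=> LW; left; rewrite unlock.
  have := integrable_funrpos measurableT (integrable_affine a' b' LW).
  exact: integrable_lty.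
have := H (fun x => a' * x + b')%R _ (ex U LU) (ex V LV); rewrite unlock; apply.
apply: convex_functionP => x y t _ _ _.
by rewrite le_eqVlt; apply/orP; left; apply/eqP; ring.
Qed.

End convex_order.

(** * Densities, independence and the substitution t = b^p *)

Section density.
Context {d : measure_display} {T : measurableType d} {R : realType}.
Variables (nu mu : {measure set T -> \bar R}) (k : T -> R).
Hypotheses (mk : measurable_fun setT k) (k0 : forall x, 0 <= k x).
Hypothesis nuE : forall A, measurable A -> (nu A = \int[mu]_(x in A) (k x)%:E)%E.
Local Open Scope ereal_scope.
Import HBNNSimple.

Let indic_density (A : set T) : measurable A ->
  \int[nu]_x (\1_A x)%:E = \int[mu]_x ((\1_A x)%:E * (k x)%:E).
Proof.
move=> mA; rewrite integral_indic // setIT nuE // integral_mkcond.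
apply: eq_integral => x _; rewrite patchE indicE.
by case: (x \in A); rewrite /= ?mul1e ?mul0e.
Qed.

Let nnsfun_density (f : {nnsfun T >-> R}) :
  \int[nu]_x (f x)%:E = \int[mu]_x ((f x)%:E * (k x)%:E).
Proof.
under [LHS]eq_integral do rewrite fimfunE -fsumEFin//.
rewrite [LHS]ge0_integral_fsum//; last 2 first.
  - by move=> r; exact/measurable_EFinP/measurableT_comp.
  - by move=> n x _; rewrite EFinM nnfun_muleindic_ge0.
under [RHS]eq_integral.
  move=> x xD; rewrite muleC fimfunE -fsumEFin// ge0_mule_fsumr; last first.
    by move=> r; rewrite EFinM nnfun_muleindic_ge0.
  over.
rewrite [RHS]ge0_integral_fsum//; last 2 first.
  - by move=> r; apply: emeasurable_funM; [exact/measurable_EFinP|exact/measurable_EFinP/measurableT_comp].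
  - move=> n x _; apply: mule_ge0; first by rewrite lee_fin.
    by rewrite EFinM nnfun_muleindic_ge0.
apply: eq_fsbigr => r _.
rewrite integralZl_indic_nnsfun // indic_density; last first.
  exact: measurable_sfunP.
have [r0|r0] := leP 0%R r.
  rewrite -ge0_integralZl //.
  - by apply: eq_integral => x _; rewrite EFinM [RHS]muleC muleA.
  - apply: emeasurable_funM; exact/measurable_EFinP.
  - by move=> x _; rewrite mule_ge0 ?lee_fin.
rewrite preimage_nnfun0 //; transitivity (0 : \bar R).
  suff -> : \int[mu]_x ((\1_set0 x)%:E * (k x)%:E) = 0 by rewrite mule0.
  by apply: integral0_eq => x _; rewrite indicE in_set0 mul0e.
apply/esym; apply: integral0_eq => x _.
by rewrite indicE in_set0 mulr0 mule0.
Qed.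

(** By linearity from indicators to simple functions, and then by monotone
    convergence. *)
Lemma ge0_integral_density (f : T -> \bar R) :
  measurable_fun setT f -> (forall x, 0 <= f x) ->
  \int[nu]_x f x = \int[mu]_x (f x * (k x)%:E).
Proof.
move=> mf f0.
pose f_ := nnsfun_approx measurableT mf.
transitivity (limn (fun n => \int[nu]_x (f_ n x)%:E)).
  rewrite -monotone_convergence//=.
  - apply: eq_integral => ? /[!inE] xD; apply/esym/cvg_lim => //=.
    exact: cvg_nnsfun_approx.
  - by move=> n; exact/measurable_EFinP/measurable_funTS.
  - by move=> n ? _; rewrite lee_fin.
  - by move=> ? _ ? ? mn; rewrite lee_fin; exact/lefP/nd_nnsfun_approx.
transitivity (limn (fun n => \int[mu]_x ((f_ n x)%:E * (k x)%:E))).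
  by congr (lim (_ @ \oo)); apply/funext => n; exact: nnsfun_density.
rewrite -monotone_convergence//=.
- apply: eq_integral => x /[!inE] xD; apply/cvg_lim => //=.
  apply: cvgeZr => //; exact: cvg_nnsfun_approx.
- move=> n; apply: emeasurable_funM; exact/measurable_EFinP/measurable_funTS.
- by move=> n x _; rewrite mule_ge0 ?lee_fin.
- move=> x _ m n mn; apply: lee_wpmul2r; first by rewrite lee_fin.
  by rewrite lee_fin; exact/lefP/nd_nnsfun_approx.
Qed.

End density.

Section independence.
Context {d : measure_display} {Om : measurableType d} {R : realType}.
Variable P : probability Om R.
Local Open Scope ereal_scope.

(** Independence identifies the joint law with the product of the laws, by
    uniqueness of the product measure; the formula is then Tonelli's theorem. *)
Lemma ge0_integral_independent {d1 d2 : measure_display}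
    {E1 : measurableType d1} {E2 : measurableType d2}
    (X : Om -> E1) (Y : Om -> E2) (f : E1 * E2 -> \bar R) :
  measurable_fun setT X -> measurable_fun setT Y -> independent_RV P X Y ->
  measurable_fun setT f -> (forall z, 0 <= f z) ->
  \int[P]_w f (X w, Y w) = \int[P]_w (\int[P]_v f (X v, Y w)).
Proof.
move=> mX mY ind mf f0.
have mXY : measurable_fun setT (fun w => (X w, Y w)) by exact: measurable_fun_pair.
pose X' : {mfun Om >-> E1} := mfun_Sub (mem_set mX).
pose Y' : {mfun Om >-> E2} := mfun_Sub (mem_set mY).
pose XY' : {mfun Om >-> (E1 * E2)%type} := mfun_Sub (mem_set mXY).
pose PX := distribution P X'; pose PY := distribution P Y'.
transitivity (\int[distribution P XY']_z f z).
  by rewrite ge0_integral_distribution.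
have -> : \int[distribution P XY']_z f z = \int[PX \x PY]_z f z.
  apply: eq_measure_integral => A mA _; apply/esym.
  by apply: product_measure_unique.
rewrite fubini_tonelli2 //.
rewrite ge0_integral_distribution.
- apply: eq_integral => w _; rewrite /fubini_G /=.
  rewrite ge0_integral_distribution //.
  by apply: measurableT_comp; [exact: mf|exact: measurable_fun_pair].
- exact: measurable_fun_fubini_tonelli_G.
- by move=> y; exact: integral_ge0.
Qed.

Lemma independent_RV_compr {d1 d2 d3 : measure_display} {E1 : measurableType d1}
    {E2 : measurableType d2} {E3 : measurableType d3}
    (X : Om -> E1) (Y : Om -> E2) (f : E2 -> E3) :
  measurable_fun setT f -> independent_RV P X Y -> independent_RV P X (f \o Y).
Proof.
move=> mf ind A B mA mB; rewrite comp_preimage; apply: ind => //.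
by rewrite -[_ @^-1` _]setTI; exact: mf.
Qed.

End independence.

Section laws.
Context {R : realType}.
Notation mu := (@lebesgue_measure R).
Context {q g : R} (q0 : 0 < q) (g0 : 0 < g).
Let al : R := (1 + q)^-1.
Let al0 : 0 < al. Proof. by rewrite invr_gt0 addr_gt0. Qed.
Let pow_itv (t : R) : 0 < t -> t < 1 -> 0 < t `^ al /\ t `^ al < 1.
Proof.
move=> t0 t1; split; first exact: powR_gt0.
rewrite -[ltRHS](one_powR al); apply: (gt0_ltr_powR al0) => //.
  by rewrite nnegrE ltW.
by rewrite nnegrE.
Qed.

(** In the coordinate b = t^al the weight and the height are powers of 1 - t. *)
Lemma curve_powR (t : R) : 0 < t -> t < 1 ->
  weight q g (t `^ al) = (1 - t) `^ g /\ height q (t `^ al) = (1 - t) `^ al.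
Proof.
move=> t0 t1; have [u0 u1] := pow_itv t0 t1.
have n1 : `|t `^ al| <= 1 by rewrite gtr0_norm // ltW.
have o : omega q (t `^ al) = 1 - t.
  rewrite (omegaE q0 n1) gtr0_norm // -powRrM mulVf ?powRr1 ?(ltW t0) //.
  by rewrite gt_eqF // addr_gt0.
by rewrite /weight /height o.
Qed.

Let x (n : nat) : R := n.+3%:R^-1.
Let x_gt0 n : 0 < x n. Proof. by rewrite invr_gt0. Qed.
Let x_third n : x n <= 3^-1.
Proof. by rewrite lef_pV2 ?posrE // ler_nat. Qed.
Let x_lt n : x n < 1 - x n.
Proof. have := x_third n; lra. Qed.
Let x_nd m n : (m <= n)%N -> x n <= x m.
Proof. by move=> mn; rewrite lef_pV2 ?posrE // ler_nat. Qed.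
Let x_small (e : R) : 0 < e -> exists n, x n <= e.
Proof.
move=> e0; have [n ne] : exists n : nat, e^-1 <= n%:R.
  by exists (Num.bound e^-1); apply/ltW/archi_boundP; rewrite invr_ge0 ltW.
exists n; rewrite /x -[leRHS]invrK; apply: inv_le; first by rewrite invr_gt0.
by apply: (le_trans ne); rewrite ler_nat -addn3 leq_addr.
Qed.

Let J n : set R := `[x n, 1 - x n].
Let I n : set R := `[x n `^ al, (1 - x n) `^ al].

Let bigJ : \bigcup_n J n = `]0, 1[%classic.
Proof.
apply/seteqP; split => t /=.
  move=> [n _]; rewrite /J /= !in_itv /= => /andP[h1 h2].
  have := x_gt0 n => h0; apply/andP; split; first exact: lt_le_trans h1.
  by apply: (le_lt_trans h2); rewrite gtrBl.
rewrite in_itv /= => /andP[t0 t1].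
have m0 : 0 < Num.min t (1 - t) by rewrite lt_min t0 subr_gt0.
have [n] := x_small m0; rewrite le_min => /andP[h1 h2].
by exists n => //; rewrite /J /= in_itv /= h1 /= lerBrDr addrC -lerBrDr.
Qed.

Let bigI : \bigcup_n I n = `]0, 1[%classic.
Proof.
apply/seteqP; split => b /=.
  move=> [n _]; rewrite /I /= !in_itv /= => /andP[h1 h2].
  apply/andP; split; first by apply: lt_le_trans h1; exact: powR_gt0.
  apply: (le_lt_trans h2).
  have h3 : 1 - x n < 1 by rewrite gtrBl.
  have h4 : 0 < 1 - x n by apply: lt_trans (x_lt n).
  by have [] := pow_itv h4 h3.
rewrite in_itv /= => /andP[b0 b1].
have : (`]0, 1[%classic : set R) (b `^ (1 + q)).
  rewrite /= in_itv /= powR_gt0 //= -[ltRHS](one_powR (1 + q)).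
  by apply: gt0_ltr_powR; rewrite ?nnegrE ?(ltW b0) // addr_gt0.
rewrite -bigJ => -[n _]; rewrite /J /= in_itv /= => /andP[h1 h2].
have bE : b = (b `^ (1 + q)) `^ al.
  by rewrite -powRrM mulfV ?powRr1 ?(ltW b0) // gt_eqF // addr_gt0.
have h4 : 0 < 1 - x n by apply: lt_trans (x_lt n).
exists n => //; rewrite /I /= in_itv /= bE; apply/andP; split.
  by apply: (ge0_ler_powR (ltW al0)) => //; rewrite nnegrE ?powR_ge0 ?(ltW (x_gt0 n)).
by apply: (ge0_ler_powR (ltW al0)) => //; rewrite nnegrE ?powR_ge0 ?(ltW h4).
Qed.

Let measurable_itv01 (f : R -> R) : measurable_fun setT f ->
  forall D : set R, measurable_fun D (EFin \o f).
Proof. by move=> mf D; apply/measurable_EFinP/measurable_funTS. Qed.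

(** The derivative of t^al has no limit at 0, so the substitution is made on
    compact subintervals first. *)
Let subst_n n (f : R -> R) : continuous f ->
  (\int[mu]_(b in I n) (f b)%:E =
   \int[mu]_(t in J n) (f (t `^ al) * (al * t `^ (al - 1)))%:E)%E.
Proof.
move=> cf.
have pos (t : R) : x n <= t -> 0 < t by move=> h; exact: lt_le_trans h.
have dp (t : R) : 0 < t -> is_derive t 1 (@powR R ^~ al) (al * t `^ (al - 1)).
  by move=> t0; exact: is_derive1_powR.
have d1 (t : R) : 0 < t -> derive1 (@powR R ^~ al) t = al * t `^ (al - 1).
  by move=> t0; rewrite derive1E; case: (dp t t0).
have cp (t : R) (e : R) : 0 < t -> {for t, continuous (@powR R ^~ e)}.
  move=> t0; apply/differentiable_continuous/derivable1_diffP.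
  by case: (@is_derive1_powR R e t t0).
have cd (t : R) : 0 < t -> derive1 (@powR R ^~ al) z @[z --> t] --> derive1 (@powR R ^~ al) t.
  move=> t0; rewrite d1 //.
  have c : al * z `^ (al - 1) @[z --> t] --> al * t `^ (al - 1).
    by apply: cvgMr; exact: cp.
  apply: cvg_trans c; apply: near_eq_cvg; near=> z; rewrite d1 //.
  by near: z; exact: lt_nbhsr.
have x0 := x_gt0 n.
have y0 : 0 < 1 - x n by apply: lt_trans (x_lt n).
rewrite /I (@integration_by_substitution_increasing R (@powR R ^~ al) f (x n) (1 - x n)).
- apply: eq_integral => t; rewrite inE /J /= in_itv /= => /andP[h1 _].
  by rewrite -(d1 t (pos t h1)).
- exact: ltW.
- move=> u v; rewrite !in_itv /= => /andP[u1 _] /andP[v1 _] uv.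
  by apply: (gt0_ltr_powR al0) => //; rewrite nnegrE ltW // pos.
- by move=> t; rewrite in_itv /= => /andP[h1 _]; apply: cd; exact: lt_trans h1.
- apply/cvg_ex; exists (derive1 (@powR R ^~ al) (x n)).
  by apply: cvg_at_right_filter; exact: cd.
- apply/cvg_ex; exists (derive1 (@powR R ^~ al) (1 - x n)).
  by apply: cvg_at_left_filter; exact: cd.
- split.
  + move=> t; rewrite in_itv /= => /andP[h1 _].
    by case: (dp t (lt_trans x0 h1)).
  + by apply: cvg_at_right_filter; exact: cp.
  + by apply: cvg_at_left_filter; exact: cp.
- exact: continuous_subspaceT.
Unshelve. all: by end_near. Qed.

(** Monotone convergence along the compact subintervals, on both sides. *)
Lemma integral_powR_subst (f : R -> R) : continuous f -> (forall b, 0 <= f b) ->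
  (\int[mu]_(t in `]0%R, 1%R[) (f (t `^ al) * (al * t `^ (al - 1)))%:E =
   (segint f 0 1)%:E)%E.
Proof.
move=> cf f0.
pose h (t : R) := f (t `^ al) * (al * t `^ (al - 1)).
have mf : measurable_fun setT f by exact: continuous_measurable_fun.
have mh : measurable_fun setT h.
  apply: measurable_funM; first by apply: measurableT_comp => //; exact: measurable_powR.
  by apply: measurable_funM; [exact: measurable_cst|exact: measurable_powR].
have Jnd : {homo J : n m / (n <= m)%N >-> (n <= m)%O}.
  move=> m n mn; rewrite subsetEset => t; rewrite /J /= !in_itv /= => /andP[h1 h2].
  have := x_nd mn => h3; apply/andP; split; first exact: le_trans h1.
  by apply: (le_trans h2); rewrite lerD2l lerN2.
have Ind : {homo I : n m / (n <= m)%N >-> (n <= m)%O}.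
  move=> m n mn; rewrite subsetEset => t; rewrite /I /= !in_itv /= => /andP[h1 h2].
  have h3 := x_nd mn.
  have y0 k : 0 <= 1 - x k by apply: ltW; apply: lt_trans (x_lt k).
  apply/andP; split.
    by apply: le_trans h1; apply: (ge0_ler_powR (ltW al0)) => //; rewrite nnegrE ltW.
  apply: (le_trans h2); apply: (ge0_ler_powR (ltW al0)); rewrite ?nnegrE ?y0 //.
  by rewrite lerD2l lerN2.
have c1 : (\int[mu]_(t in J i) (h t)%:E)%E @[i --> \oo] -->
    (\int[mu]_(t in \bigcup_i J i) (h t)%:E)%E.
  apply: ge0_nondecreasing_set_cvg_integral => //.
  - by move=> i; exact: measurable_itv.
  - by move=> i; exact: measurable_itv01.
  - by move=> i t _; rewrite lee_fin mulr_ge0 // mulr_ge0 ?powR_ge0 // ltW.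
have c2 : (\int[mu]_(t in I i) (f t)%:E)%E @[i --> \oo] -->
    (\int[mu]_(t in \bigcup_i I i) (f t)%:E)%E.
  apply: ge0_nondecreasing_set_cvg_integral => //.
  - by move=> i; exact: measurable_itv.
  - by move=> i; exact: measurable_itv01.
  - by move=> i t _; rewrite lee_fin.
rewrite bigJ in c1; rewrite bigI in c2.
have e1 : (\int[mu]_(t in `]0%R, 1%R[) (h t)%:E = \int[mu]_(t in `]0%R, 1%R[) (f t)%:E)%E.
  have EE : (fun i => \int[mu]_(t in J i) (h t)%:E)%E = (fun i => \int[mu]_(t in I i) (f t)%:E)%E.
    by apply/funext => i; rewrite (subst_n i cf).
  by rewrite EE in c1; apply: (cvg_unique _ c1 c2).
rewrite -/h [LHS]e1.
rewrite -(@integral_itv_bndoo R 0 1 (EFin \o f) true false); last exact: measurable_itv01.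
rewrite /segint /Rintegral fineK //.
by apply: integrable_fin_num => //; exact: segint_integrable.
Qed.

End laws.

(** * The mean of a hinge of the perturbed variable *)

Section assembly.
Context {d : measure_display} {Om : measurableType d} {R : realType}.
Variable P : probability Om R.
Notation mu := (@lebesgue_measure R).
Local Open Scope ereal_scope.

(** The events eps = 1 and eps = -1 already have total probability 1, so their
    complement is negligible. *)
Lemma rademacher_integral (eps : {RV P >-> R}) (G : R -> \bar R) :
  rademacher P eps -> measurable_fun setT G -> (forall e, 0 <= G e) ->
  \int[P]_w G (eps w) = (2^-1)%:E * G 1%R + (2^-1)%:E * G (-1)%R.
Proof.
move=> [P1 P2] mG G0.
pose A e : set Om := eps @^-1` [set e].
have mA e : measurable (A e) by rewrite -[A e]setTI; exact: measurable_funPT.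
have mE : measurable_fun setT (fun w => G (eps w)) by exact: measurableT_comp.
have d0 : A 1%R `&` A (-1)%R = set0.
  apply/seteqP; split => // w [h1 h2].
  have E1 : eps w = 1%R := h1; have E2 : eps w = (-1)%R := h2.
  move: E2; rewrite E1 => /eqP.
  by rewrite -subr_eq0 opprK gt_eqF.
have disj : [disjoint A 1%R & A (-1)%R] by apply/disj_set2P.
have PU : P (A 1%R `|` A (-1)%R) = 1.
  rewrite measureU //.
  transitivity ((2^-1)%:E + (2^-1)%:E : \bar R).
    by congr (_ + _); [exact: P1|exact: P2].
  by rewrite -EFinD; congr (_%:E); field.
have PC : P (~` (A 1%R `|` A (-1)%R)) = 0.
  by rewrite probability_setC ?PU ?subee //; exact: measurableU.
have -> : \int[P]_w G (eps w) = \int[P]_(w in (A 1%R `|` A (-1)%R) `|` ~` (A 1%R `|` A (-1)%R)) G (eps w).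
  by rewrite setUv.
have mU := measurableU _ _ (mA 1%R) (mA (-1)%R).
have dU : [disjoint A 1%R `|` A (-1)%R & ~` (A 1%R `|` A (-1)%R)].
  by apply/disj_set2P; rewrite setICr.
rewrite (ge0_integral_setU P mU (measurableC mU) _ _ dU) //; last first.
  exact: measurable_funS mE.
have -> : \int[P]_(w in ~` (A 1%R `|` A (-1)%R)) G (eps w) = 0.
  apply: null_set_integral => //; first exact: measurableC.
  exact: measurable_funS mE.
rewrite adde0 ge0_integral_setU //; last exact: measurable_funS mE.
have piece e : \int[P]_(w in A e) G (eps w) = G e * P (A e).
  rewrite -integral_cst //; apply: eq_integral => w; rewrite inE => Aw.
  by have -> : eps w = e := Aw.
have P1' : P (A 1%R) = (2^-1)%:E := P1.
have P2' : P (A (-1)%R) = (2^-1)%:E := P2.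
by rewrite !piece P1' P2' ![_ * (2^-1)%:E]muleC.
Qed.

Lemma measurable_pow_comp {d' : measure_display} {E : measurableType d'} (f : E -> R) e :
  measurable_fun setT f -> measurable_fun setT (fun x => f x `^ e)%R.
Proof. by move=> mf; exact: (measurableT_comp (measurable_powR e) mf). Qed.

Section beta.
Variables (al be : R) (T : {RV P >-> R}).
Hypotheses (al0 : (0 < al)%R) (lawT : has_beta_law T al be).

Lemma beta_weight_ge0 t : (0 <= beta_weight al be t)%R.
Proof. by rewrite mulr_ge0 // powR_ge0. Qed.

Lemma real_beta_fun_ge0 : (0 <= real_beta_fun al be)%R.
Proof.
by apply: fine_ge0; apply: integral_ge0 => t _; rewrite lee_fin; exact: beta_weight_ge0.
Qed.

Lemma measurable_beta_weight : measurable_fun setT (beta_weight al be).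
Proof.
apply: measurable_funM; first exact: measurable_pow_comp.
apply: measurable_pow_comp.
by apply: measurable_funB => //; exact: measurable_cst.
Qed.

Lemma beta_integral (H : R -> \bar R) : measurable_fun setT H -> (forall t, 0 <= H t) ->
  \int[P]_w H (T w) =
  \int[mu]_(t in `]0%R, 1%R[) (H t * (beta_weight al be t / real_beta_fun al be)%:E).
Proof.
move=> mH H0.
have mk : measurable_fun setT (real_beta_pdf al be).
  apply: measurable_funM; last exact: measurable_cst.
  apply/measurable_restrict => //; apply: measurable_funTS; exact: measurable_beta_weight.
have k0 t : (0 <= real_beta_pdf al be t)%R.
  rewrite divr_ge0 ?real_beta_fun_ge0 // patchE.
  by case: ifPn => // _; exact: beta_weight_ge0.
(* Lebesgue measure lives on the alias measurableTypeR R of the line, so T is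
   viewed as a variable with values there. *)
have mT : @measurable_fun _ _ Om (measurableTypeR R) setT T by move=> mD A mA; exact: (measurable_funPT T mD).
pose T' : {mfun Om >-> measurableTypeR R} :=
  @mfun_Sub _ _ Om (measurableTypeR R) T (mem_set mT).
have law' (A : set (measurableTypeR R)) : measurable A ->
  distribution P T' A = \int[mu]_(t in A) (real_beta_pdf al be t)%:E := @lawT A.
transitivity (\int[distribution P T']_t H t).
  by rewrite ge0_integral_distribution.
have -> := @ge0_integral_density _ (measurableTypeR R) R _ _ _ mk k0 law' H mH H0.
rewrite [RHS]integral_mkcond; apply: eq_integral => t _.
rewrite /real_beta_pdf !patchE; case: ifPn => // _.
by rewrite mul0r mule0.
Qed.


Hypothesis al1 : (2^-1 <= al < 1)%R.
Hypothesis be1 : (1 + 2 * al <= be)%R.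
Let q : R := (al^-1 - 1)%R.
Let g : R := (be - 1)%R.
Let q0 : (0 < q)%R.
Proof. by rewrite subr_gt0 invf_gt1 //; case/andP: al1. Qed.
Let q1 : (q <= 1)%R.
Proof.
rewrite lerBlDr -[(1 + 1)%R]invrK lef_pV2 ?posrE ?invr_gt0 //.
by case/andP: al1.
Qed.
Let alE : ((1 + q)^-1 = al)%R.
Proof. by rewrite addrC subrK invrK. Qed.
Let g1 : (1 <= g)%R.
Proof. by rewrite lerBrDr (le_trans _ be1) // lerD2l; case/andP: al1; lra. Qed.
Let g0 : (0 < g)%R. Proof. exact: lt_le_trans g1. Qed.

(** The factor 2 comes from the sign and the factor al from db = al t^(al-1) dt. *)
Definition beta_scale : R := (2 * (al * real_beta_fun al be))^-1%R.

Lemma beta_scale_ge0 : (0 <= beta_scale)%R.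
Proof. by rewrite invr_ge0 !mulr_ge0 ?(ltW al0) ?real_beta_fun_ge0. Qed.

Lemma measurable_hinge r : measurable_fun setT (@hinge R r).
Proof. by apply: continuous_measurable_fun; exact: cont_hinge. Qed.

(** Folding [-1, 0] onto [0, 1]: the two terms are the two values of the sign. *)
Lemma beta_avg_fold c r y :
  segint (fun b => weight q g b * hinge r (height q b * y + c * b) +
               weight q g b * hinge r (height q b * y - c * b))%R 0%R 1%R =
  beta_avg q g c r y.
Proof.
pose f b := (weight q g b * hinge r (height q b * y - c * b))%R.
have cf : continuous f .
  exact: continuous_beta_integrand.
have fN b : f (- b)%R = (weight q g b * hinge r (height q b * y + c * b))%R.
  by rewrite /f /weight omegaN heightN mulrN opprK.
have cfN : continuous (fun b => f (- b)%R).
  by move=> b; apply: (@continuous_comp _ _ _ -%R f); [exact: opp_continuous|exact: cf].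
have h01 : (0 <= 1 :> R)%R by [].
have h10 : (-1 <= 0 :> R)%R by rewrite oppr_le0.
transitivity (segint (fun b => f (- b) + f b)%R 0%R 1%R).
  by apply: eq_segint => b _ _; rewrite fN.
rewrite segintD // /beta_avg -/f (segint_split cf h10 h01); congr (_ + _)%R.
by have := segint_reflect cf h01; rewrite oppr0.
Qed.

(** Integrate over the sign first, then over the law of T in the coordinate
    b = t^al. *)
Lemma hinge_mean (eps : {RV P >-> R}) c r y :
  rademacher P eps -> independent_RV P T eps ->
  \int[P]_w (hinge r ((1 - T w) `^ al * y + c * T w `^ al * eps w))%:E =
  (beta_scale * beta_avg q g c r y)%:E.
Proof.
move=> re ind.
pose F (z : R * R) : \bar R :=
  (hinge r ((1 - z.2) `^ al * y + c * z.2 `^ al * z.1))%:E.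
have F0 z : 0 <= F z by rewrite lee_fin; exact: hinge_ge0.
have mF : measurable_fun setT F.
  apply/measurable_EFinP; apply: measurableT_comp; first exact: measurable_hinge.
  apply: measurable_funD.
    apply: measurable_funM => //; apply: measurable_pow_comp.
    by apply: measurable_funB.
  apply: measurable_funM => //; apply: measurable_funM => //.
  exact: measurable_pow_comp.
have mFe e : measurable_fun setT (fun t => F (e, t)).
  by apply: measurableT_comp => //; exact: measurable_fun_pair.
have mFt t : measurable_fun setT (fun e => F (e, t)).
  by apply: measurableT_comp => //; exact: measurable_fun_pair.
(* The sign is put first, so that the inner integral is over eps. *)
have ind' : independent_RV P eps T.
  by move=> A B mA mB; rewrite setIC ind // muleC.
transitivity (\int[P]_w F (eps w, T w)) => //.
rewrite ge0_integral_independent //.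
pose H t := (2^-1)%:E * F (1%R, t) + (2^-1)%:E * F ((-1)%R, t).
have H0 t : 0 <= H t by rewrite adde_ge0 // mule_ge0.
have mH : measurable_fun setT H.
  by apply: emeasurable_funD; apply: measurable_funeM.
transitivity (\int[P]_w H (T w)).
  by apply: eq_integral => w _; rewrite (rademacher_integral re (mFt (T w))).
rewrite beta_integral //.
pose f b := (weight q g b * hinge r (height q b * y + c * b) +
             weight q g b * hinge r (height q b * y - c * b))%R.
have f0 b : (0 <= f b)%R.
  by apply: addr_ge0; apply: mulr_ge0; [exact: weight_ge0|exact: hinge_ge0
    |exact: weight_ge0|exact: hinge_ge0].
have cf : continuous f.
  move=> b; apply: cvgD; last exact: continuous_beta_integrand.
  have := @continuous_beta_integrand _ q g q0 g1 (- c)%R r y b.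
  by under [X in continuous_at _ X -> _]eq_fun do rewrite mulNr opprK.
transitivity (\int[mu]_(t in `]0%R, 1%R[)
    (beta_scale%:E * (f (t `^ al) * (al * t `^ (al - 1)))%:E)).
  apply: eq_integral => t; rewrite inE /= in_itv /= => /andP[t0 t1].
  have [e1 e2] := @curve_powR _ q g q0 t t0 t1.
  rewrite alE in e1 e2.
  have -> : H t = (2^-1 * hinge r ((1 - t) `^ al * y + c * t `^ al * 1) +
    2^-1 * hinge r ((1 - t) `^ al * y + c * t `^ al * -1))%:E.
    by rewrite EFinD !EFinM.
  rewrite -!EFinM; congr (_%:E).
  rewrite /f e1 e2 /beta_weight /beta_scale mulrN1 !mulr1 -/g.
  move: (real_beta_fun al be) (hinge _ _) (hinge _ _) ((1 - t) `^ g)%R (t `^ (al - 1))%R => B h1 h2 x1 x2.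
  rewrite !invfM; move: B^-1%R => B'.
  by field; rewrite gt_eqF.
rewrite ge0_integralZl_EFin //.
- have := integral_powR_subst q0 cf f0; rewrite alE => ->.
  by rewrite beta_avg_fold -EFinM.
- by move=> t _; rewrite lee_fin mulr_ge0 // mulr_ge0 ?powR_ge0 // ltW.
- apply/measurable_EFinP; apply: measurable_funTS; apply: measurable_funM.
    apply: measurableT_comp; first exact: continuous_measurable_fun.
    exact: measurable_powR.
  by apply: measurable_funM => //; exact: measurable_powR.
- exact: beta_scale_ge0.
Qed.

Lemma hinge_transfer (eps Y : {RV P >-> R}) c r :
  rademacher P eps -> independent_RV P T eps ->
  independent_RV P (fun w => (T w, eps w)) Y ->
  \int[P]_w (hinge r ((1 - T w) `^ al * Y w + c * T w `^ al * eps w))%:E =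
  \int[P]_w (beta_scale * beta_avg q g c r (Y w))%:E.
Proof.
move=> re ind indY.
pose F (z : (R * R) * R) : \bar R :=
  (hinge r ((1 - z.1.1) `^ al * z.2 + c * z.1.1 `^ al * z.1.2))%:E.
have F0 z : 0 <= F z by rewrite lee_fin; exact: hinge_ge0.
have m11 : measurable_fun setT (fun z : (R * R) * R => z.1.1).
  by apply: (measurableT_comp (f := fst)).
have m12 : measurable_fun setT (fun z : (R * R) * R => z.1.2).
  by apply: (measurableT_comp (f := snd)).
have mF : measurable_fun setT F.
  apply/measurable_EFinP; apply: measurableT_comp; first exact: measurable_hinge.
  apply: measurable_funD.
    apply: measurable_funM => //; apply: measurable_pow_comp.
    by apply: measurable_funB.
  apply: measurable_funM => //; apply: measurable_funM => //.
  exact: measurable_pow_comp.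
transitivity (\int[P]_w F ((T w, eps w), Y w)) => //.
rewrite (@ge0_integral_independent _ _ _ P _ _ _ _ (fun w => (T w, eps w)) Y) //; last first.
  exact: measurable_fun_pair.
by apply: eq_integral => w _; rewrite hinge_mean.
Qed.

End beta.

End assembly.

(** * The theorem *)

Unset Implicit Arguments.

Theorem theorem1p3 (R : realType) (d : measure_display) (Om : measurableType d)
    (P : probability Om R) (alpha beta c : R)
    (Y1 Y2 T eps : {RV P >-> R}) :
  2^-1 <= alpha < 1 ->
  1 + 2 * alpha <= beta ->
  0 <= c ->
  (Y1 : Om -> R) \in Lfun P 2%:E ->
  (Y2 : Om -> R) \in Lfun P 2%:E ->
  has_beta_law T alpha beta ->
  rademacher P eps ->
  independent_RV P T eps ->
  independent_RV P (fun w => (T w, eps w)) (fun w => (Y1 w, Y2 w)) ->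
  cx_le P (fun w => Y1 w ^+ 2) (fun w => Y2 w ^+ 2) ->
  cx_le P
    (fun w => ((1 - T w) `^ alpha * Y1 w + c * T w `^ alpha * eps w) ^+ 2)
    (fun w => ((1 - T w) `^ alpha * Y2 w + c * T w `^ alpha * eps w) ^+ 2).
Proof.
move=> al1 be1 c0 _ _ lawT re ind indY cxY.
have [ale alt] := andP al1.
have al0 : 0 < alpha by apply: lt_le_trans ale; rewrite invr_gt0.
pose q := alpha^-1 - 1; pose g := beta - 1.
have q0 : 0 < q by rewrite subr_gt0 invf_gt1.
have q1 : q <= 1.
  by rewrite lerBlDr -[(1 + 1)%R]invrK lef_pV2 ?posrE ?invr_gt0.
have g1 : 1 <= g by rewrite lerBrDr (le_trans _ be1) // lerD2l; lra.
pose k := beta_scale alpha beta; have k0 : 0 <= k := beta_scale_ge0 beta al0.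
pose X (Y : {RV P >-> R}) w := (1 - T w) `^ alpha * Y w + c * T w `^ alpha * eps w.
have mX Y : measurable_fun setT (X Y).
  apply: measurable_funD; apply: measurable_funM => //.
    by apply: measurable_pow_comp; apply: measurable_funB.
  by apply: measurable_funM => //; exact: measurable_pow_comp.
have ind1 : independent_RV P (fun w => (T w, eps w)) Y1.
  exact: (independent_RV_compr (f := fst) _ indY).
have ind2 : independent_RV P (fun w => (T w, eps w)) Y2.
  exact: (independent_RV_compr (f := snd) _ indY).
have tr r (Y : {RV P >-> R}) : independent_RV P (fun w => (T w, eps w)) Y ->
    (\int[P]_w (hinge r (X Y w))%:E = \int[P]_w (k * beta_avg q g c r (Y w))%:E)%E.
  by move=> iY; exact: hinge_transfer.
(* r = 0: the mean of the perturbed square is affine in the mean of the square,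
   which gives integrability and the equality of the means. *)
have [A [C quad]] := beta_avg_quadratic q0 g1 c.
have sq (Y : {RV P >-> R}) : independent_RV P (fun w => (T w, eps w)) Y ->
    (\int[P]_w (X Y w ^+ 2)%:E = \int[P]_w (k * A * Y w ^+ 2 + k * C)%:E)%E.
  move=> iY; transitivity (\int[P]_w (hinge 0 (X Y w))%:E)%E.
    by apply: eq_integral => w _; rewrite /hinge expr0n subr0 max_r // sqr_ge0.
  by rewrite tr //; apply: eq_integral => w _; rewrite quad mulrDr mulrA.
have L1 (Y : {RV P >-> R}) : independent_RV P (fun w => (T w, eps w)) Y ->
    (fun w => Y w ^+ 2) \in Lfun P 1 -> (fun w => X Y w ^+ 2) \in Lfun P 1.
  move=> iY LY; apply/Lfun1_integrable/integrableP; split.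
    by apply/measurable_EFinP; exact: measurable_funX.
  under eq_integral do rewrite /= ger0_norm ?sqr_ge0 //.
  rewrite sq //.
  exact: integrable_lty (integrable_affine (k * A) (k * C) LY).
have [LY1 LY2 _] := cxY.
apply: cx_le_hinges; [exact: L1|exact: L1|by move=> w; exact: sqr_ge0..| |].
  by rewrite unlock sq // sq //; exact: cx_le_affine cxY.
move=> s s0.
have hs (Y : {RV P >-> R}) : (\int[P]_w (Num.max 0 (X Y w ^+ 2 - s))%:E =
             \int[P]_w (hinge (Num.sqrt s) (X Y w))%:E)%E.
  by apply: eq_integral => w _; rewrite /hinge sqr_sqrtr // ltW.
rewrite !hs !tr //.
(* The convex function to which the hypothesis is applied. *)
pose Phi u := k * beta_avg q g c (Num.sqrt s) (Num.sqrt u).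
have sY (Y : {RV P >-> R}) : (\int[P]_w (k * beta_avg q g c (Num.sqrt s) (Y w))%:E =
    \int[P]_w (Phi (Y w ^+ 2))%:E)%E.
  by apply: eq_integral => w _; rewrite /Phi sqrtr_sqr beta_avg_norm.
have Phi0 u : 0 <= Phi u by apply: mulr_ge0 => //; exact: beta_avg_ge0.
have cPhi : convex_function setT (Phi : R^o -> R^o).
  have s0' : 0 < Num.sqrt s by rewrite sqrtr_gt0.
  have cb := convex_functionE (beta_avg_convex q0 q1 g1 c0 s0').
  apply: convex_functionP => x y t t0 t1 _.
  apply: le_trans (ler_wpM2l k0 (cb x y t (ltW t0) (ltW t1))) _.
  by rewrite /Phi mulrDr mulrCA [X in _ + X <= _]mulrCA.
by rewrite (sY Y1) (sY Y2); exact: (@cx_le_nonneg _ _ _ P Phi _ _ cxY cPhi Phi0).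
Qed.
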